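(* Let $\mathcal K=\{H,J\}$ be a Krein space, $J=P_+-P_-$, $H=H_+\oplus H_-$, and let $A$ be a closed densely defined operator in $H$ such that $\mathcal D_+\oplus\mathcal D_-$ is a core of $A$, where $\mathcal D_\pm=\mathcal D(A)\cap H_\pm$, with block entries $A_{11},A_{12},A_{21},A_{22}$. Assume: (i') $A$ is $m$-dissipative in $\mathcal K$; (ii) $-A_{22}$ (with domain $\mathcal D_-$) is maximal dissipative in the Hilbert space $H_-$; and that for some $\mu_0\in\mathbb C^+$: (iii) $F(\mu_0)=(A_{22}-\mu_0)^{-1}A_{21}$ (with domain $\mathcal D_+$) is bounded; (iv) $G(\mu_0)=A_{12}(A_{22}-\mu_0)^{-1}$ is a compact operator from $H_-$ to $H_+$. Let $\mathcal L^+$ be an $A$-invariant maximal nonnegative subspace of $\mathcal K$ such that $A^+=A|_{\mathcal L^+}$ satisfies $\sigma(A^+)\subset\overline{\mathbb C^+}$. Suppose there is $\mu\in\mathbb C^+$ such that $iS(\mu)$ generates an $H_0$-semigroup in $H_+$, where $S(\mu)$ denotes the closure of the operator $A_{11}-A_{12}(A_{22}-\mu)^{-1}A_{21}$ with domain $\mathcal D_+$. Then $iA^+$ generates an $H_0$-semigroup in $\mathcal L^+$.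
   Context: $H$ is a separable complex Hilbert space with inner product $(\cdot,\cdot)$; $P_+,P_-$ are complementary orthogonal projections, $P_++P_-=1$, $J=P_+-P_-$, $H_\pm=P_\pm(H)$. The Krein space $\mathcal K=\{H,J\}$ is $H$ equipped with the indefinite inner product $[x,y]=(Jx,y)$. $\mathbb C^+$ and $\mathbb C^-$ are the open upper and lower half-planes; $\overline{\mathbb C^+}$ is the closed upper half-plane. A (closed) subspace $\mathcal L$ is nonnegative if $[x,x]\ge 0$ for all $x\in\mathcal L$, and maximal nonnegative if it has no proper nonnegative extension. A densely defined operator $T$ in a Hilbert space is dissipative if $\operatorname{Im}(Tx,x)\ge 0$ for all $x\in\mathcal D(T)$, and maximal dissipative ($m$-dissipative) if it has no proper dissipative extension (equivalently, it is dissipative and $\mathbb C^-\subset\rho(T)$). $A$ is $m$-dissipative in $\mathcal K$ if $JA$ is $m$-dissipative in $H$. Block entries: $A_{11}=P_+AP_+$ and $A_{21}=P_-AP_+$ are regarded as operators from $\mathcal D_+\subset H_+$ to $H_+$ and $H_-$ respectively; $A_{12}=P_+AP_-$ and $A_{22}=P_-AP_-$ as operators from $\mathcal D_-\subset H_-$ to $H_+$ and $H_-$ respectively. $A$-invariance: a subspace $\mathcal L$ is $A$-invariant if $\mathcal D(A)\cap\mathcal L$ is dense in $\mathcal L$ and $Ax\in\mathcal L$ for all $x\in\mathcal D(A)\cap\mathcal L$. The restriction $A|_{\mathcal L}$ is the operator in $\mathcal L$ with domain $\mathcal D(A)\cap\mathcal L$. An operator $B$ is a generator of an $H_0$-semigroup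 if for every $\varepsilon>0$ the operator $B-\varepsilon$ generates a holomorphic semigroup. *)

(* Defs.v *)
From HB Require Import structures.
From mathcomp Require Import all_boot all_order all_algebra.
From mathcomp Require Import complex.
From mathcomp Require Import all_classical all_reals all_analysis.

Set Implicit Arguments.
Unset Strict Implicit.
Unset Printing Implicit Defensive.

Import Order.TTheory GRing.Theory Num.Theory.
Import numFieldNormedType.Exports.

Local Open Scope classical_set_scope.
Local Open Scope ring_scope.
Local Open Scope complex_scope.

Notation ReC := complex.Re.
Notation ImC := complex.Im.

(* Unbounded operators are represented by their graphs: T (x, y) means that
   x belongs to the domain of T and T x = y.  Thus equality and inclusion of
   sets are equality and extension of operators, and the algebraic operations
   below carry their natural domains.  A Hilbert subspace of H is a set V, and
   "operator from V to W" is a predicate on graphs. *)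
Section Operators.
Context {R : realType} {H : completeNormedModType R[i]}.
Implicit Types (V W D : set H) (S T : set (H * H)) (f : H -> H).

Definition linear_subspace V : Prop :=
  V 0 /\ forall (c : R[i]) x y, V x -> V y -> V (c *: x + y).

Definition closed_subspace V : Prop := linear_subspace V /\ closed V.

Definition op_dom T : set H := [set p.1 | p in T].

Definition linear_operator V W T : Prop :=
  [/\ forall x y, T (x, y) -> V x /\ W y,
      T (0, 0),
      forall (c : R[i]) x x' y y',
        T (x, y) -> T (x', y') -> T (c *: x + x', c *: y + y')
    & forall x y y', T (x, y) -> T (x, y') -> y = y'].

Definition densely_defined V T : Prop := V `<=` closure (op_dom T).

Definition op_restrict T D : set (H * H) := [set p | T p /\ D p.1].

(* f \o T *)
Definition op_map f T : set (H * H) := [set (p.1, f p.2) | p in T].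

Definition op_scale (c : R[i]) T : set (H * H) := op_map ( *:%R c) T.

(* T - c *)
Definition op_shift T (c : R[i]) : set (H * H) :=
  [set (p.1, p.2 - c *: p.1) | p in T].

Definition op_sub S T : set (H * H) :=
  [set p | exists y z, [/\ S (p.1, y), T (p.1, z) & p.2 = y - z]].

(* S \o T *)
Definition op_comp S T : set (H * H) :=
  [set p | exists y, T (p.1, y) /\ S (y, p.2)].

Definition op_inv T : set (H * H) := [set (p.2, p.1) | p in T].

Definition is_core T D : Prop :=
  D `<=` op_dom T /\ closure (op_restrict T D) = T.

Definition op_bounded T : Prop :=
  exists M : R, forall x y, T (x, y) -> `|y| <= M%:C * `|x|.

Definition compact_operator V W T : Prop :=
  [/\ linear_operator V W T, op_dom T = V
    & precompact [set y | exists x, `|x| <= 1 /\ T (x, y)]].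

Definition resolvent_set V T : set R[i] :=
  [set l | let S := op_inv (op_shift T l) in
           [/\ linear_operator V V S, op_dom S = V & op_bounded S]].

Definition spectrum V T : set R[i] := ~` resolvent_set V T.

Definition invariant_subspace T V : Prop :=
  V `<=` closure (op_dom T `&` V) /\
  forall x y, T (x, y) -> V x -> V y.

(* The open sector |arg z| < arctan k. *)
Definition sector (k : R) : set R[i]^o :=
  [set z : R[i] | `|ImC z| < k * ReC z].

(* Bounded holomorphic semigroup in the Hilbert space V, as in Kato's class
   H(omega, 0): uniformly bounded and strongly continuous at 0 on every smaller
   sector.  Holomorphy is pointwise, i.e. complex differentiability
   of z |-> U z x; only the values U z x with z in the sector and x in V
   matter. *)
Definition holomorphic_semigroup V (k : R) (U : R[i] -> H -> H) : Prop :=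
  [/\ forall z x, sector k z -> V x -> V (U z x),
      forall z c x y, sector k z -> V x -> V y ->
        U z (c *: x + y) = c *: U z x + U z y,
      forall z w x, sector k z -> sector k w -> V x ->
        U (z + w) x = U z (U w x),
      forall x z, V x -> sector k z ->
        derivable (fun w : R[i]^o => U w x) z 1
    & forall k' : R, 0 < k' < k ->
        (exists M : R, forall z x, sector k' z -> V x ->
           `|U z x| <= M%:C * `|x|) /\
        (forall x, V x ->
           (fun z : R[i]^o => U z x) @ within (sector k') (nbhs (0 : R[i]^o))
             --> x)].

Definition semigroup_generator V (U : R[i] -> H -> H) : set (H * H) :=
  [set p | [/\ V p.1, V p.2 &
    (fun t : R => (t%:C)^-1 *: (U t%:C p.1 - p.1)) @ 0^'+ --> p.2]].

Definition generates_holomorphic V T : Prop :=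
  exists k U, [/\ 0 < k, holomorphic_semigroup V k U
                & semigroup_generator V U = T].

Definition generates_H0 V T : Prop :=
  forall e : R, 0 < e -> generates_holomorphic V (op_shift T e%:C).

End Operators.

(* The inner product is linear in its first argument. *)
Section HilbertKrein.
Context {R : realType} {H : completeNormedModType R[i]}.
Variable dot : {dot H for @Num.conj R[i]}.
Implicit Types (V L : set H) (T : set (H * H)).

(* A complete normed space over R[i] is Hilbert when its (R[i]-valued) norm
   comes from the inner product. *)
Definition separable_hilbert : Prop :=
  (forall x, `|x| ^+ 2 = dot x x) /\
  exists D : set H, countable D /\ dense D.

Definition orthogonal_projection (P : H -> H) : Prop :=
  (forall x, P (P x) = P x) /\ (forall x y, dot (P x) y = dot x (P y)).

Definition complementary_projections (Pp Pm : H -> H) : Prop :=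
  [/\ orthogonal_projection Pp, orthogonal_projection Pm
    & forall x, Pp x + Pm x = x].

Definition dissipative V T : Prop :=
  [/\ linear_operator V V T, densely_defined V T
    & forall x y, T (x, y) -> 0 <= ImC (dot y x)].

Definition max_dissipative V T : Prop :=
  dissipative V T /\
  forall T', dissipative V T' -> T `<=` T' -> T' = T.

(* For the Krein space with fundamental symmetry J, where [x, y] = (J x, y). *)
Definition krein_max_dissipative (J : H -> H) T : Prop :=
  max_dissipative [set: H] (op_map J T).

Definition nonnegative_subspace (J : H -> H) L : Prop :=
  closed_subspace L /\ forall x, L x -> 0 <= dot (J x) x.

Definition max_nonnegative (J : H -> H) L : Prop :=
  nonnegative_subspace J L /\
  forall L', nonnegative_subspace J L' -> L `<=` L' -> L' = L.

End HilbertKrein.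

(* The block P A Q for projections P and Q, with V the range of Q. *)
Definition op_block (R : realType) (H : completeNormedModType R[i])
    (P : H -> H) (A : set (H * H)) (V : set H) : set (H * H) :=
  op_map P (op_restrict A V).

(* Main.v *)
From HB Require Import structures.
Require Import Defs.
From mathcomp Require Import all_boot all_order all_algebra.
From mathcomp Require Import complex zify ring lra cyclic separable cyclotomic.
From mathcomp Require Import all_classical all_reals all_analysis.

Set Implicit Arguments.
Unset Strict Implicit.
Unset Printing Implicit Defensive.

Import Order.TTheory GRing.Theory Num.Theory.
Import numFieldNormedType.Exports.

Local Open Scope classical_set_scope.
Local Open Scope ring_scope.
Local Open Scope complex_scope.

(* Both the hypothesis on S(mu) and the conclusion amount to an estimate
   |z| |x| <= M |(z - T) x| for Re z > 0.  It holds for the generator of a bounded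
   holomorphic semigroup U, as one sees from
   tau^-1 x = int_0^oo e^(-z tau t) U(tau t) (z - T) x dt
   with tau in the sector chosen so that |z| is controlled by Re (z tau).
   Conversely, it bounds the powers of V = (1 - z T)^-1 together with
   n |(V - 1) V^n| for z in a sector, so that the exponential formula converges to
   a holomorphic semigroup.

   For x in L and y = A x one has P+ y = s + k, where s = S(mu) P+ x and
   |k| <= E |P+ x| + gam |P- (A - mu') x|.  Here gam is arbitrarily small,
   because the compactness of G(mu0) forces G(mu') to be small for suitable mu'.
   Since |P- x| <= |P+ x| on the nonnegative subspace L, the estimate for S(mu)
   passes to the restriction of A to L for large spectral parameters; for bounded
   ones it follows from the assumption on the spectrum. *)

(** Vector-valued integrals become finite sums: contour integrals turn into means over roots of
    unity, the Laplace integral into a geometric sum. The delicate point is that the power bounds be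
    uniform in n. A bound C/|1 - w| inserted into Cauchy's formula for (1 - w V)^-1 loses a factor
    log n. For the cube (1 - w V)^-3 it does not: the coefficient of w^n carries a weight of order
    n^2, the mean of |1 - w|^-2 over |w| = r is of order 1/(1 - r), and the third factor costs at
    most another 1/(1 - r), all balanced by taking 1 - r of order 1/n. On L the spectrum may touch
    the real axis, so the estimate is claimed only for Im l <= - epsilon, where bounded l range over
    a compact part of the resolvent set; the constant depends on epsilon. For large l the term E |P+
    x| and the one due to shifting i S(mu) by 1 are absorbed by |l| |P+ x|. The error gam |l| |P- x|
    is of the same order in l as the left-hand side, which is why it takes compactness of G(mu0),
    and not only boundedness, to make gam small against the constant of S(mu). *)

(* The square-zero extension of R by V is a commutative ring containing V, so
   that [ring] decides identities between linear combinations in V. *)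
Section SquareZero.
Context {R : comNzRingType} {V : lmodType R}.

Definition sqz : Type := (R * V)%type.

HB.instance Definition _ := GRing.Zmodule.on sqz.

Definition sqz_one : sqz := (1, 0).
Definition sqz_mul (p q : sqz) : sqz := (p.1 * q.1, p.1 *: q.2 + q.1 *: p.2).

Fact sqz_mulA : associative sqz_mul.
Proof.
move=> [a u] [b v] [c w]; rewrite /sqz_mul /= mulrA; congr pair.
rewrite !scalerDr !scalerA addrA; by congr (_ + _ + _) => //; rewrite mulrC.
Qed.

Fact sqz_mulC : commutative sqz_mul.
Proof.
by move=> [a u] [b v]; rewrite /sqz_mul /= mulrC; congr pair; rewrite addrC.
Qed.

Fact sqz_mul1 : left_id sqz_one sqz_mul.
Proof.
by move=> [a u]; rewrite /sqz_mul /= mul1r scale1r scaler0 addr0.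
Qed.

Fact sqz_mulDl : left_distributive sqz_mul +%R.
Proof.
move=> [a u] [b v] [c w]; rewrite /sqz_mul /=; congr pair => /=.
  by rewrite mulrDl.
by rewrite scalerDl scalerDr addrACA.
Qed.

Fact sqz_neq0 : sqz_one != 0.
Proof. by apply/eqP => -[/eqP]; rewrite oner_eq0. Qed.

HB.instance Definition _ := GRing.Zmodule_isComNzRing.Build sqz
  sqz_mulA sqz_mulC sqz_mul1 sqz_mulDl sqz_neq0.

Definition sqv (v : V) : sqz := (0, v).
Definition sqs (c : R) : sqz := (c, 0).

Lemma sqv_inj : injective sqv. Proof. by move=> u v []. Qed.
Lemma sqv0 : sqv 0 = 0. Proof. by []. Qed.
Lemma sqvD u v : sqv (u + v) = sqv u + sqv v.
Proof. by rewrite /sqv; congr pair => /=; rewrite addr0. Qed.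
Lemma sqvN u : sqv (- u) = - sqv u.
Proof. by rewrite /sqv; congr pair => /=; rewrite oppr0. Qed.
Lemma sqvZ c u : sqv (c *: u) = sqs c * sqv u.
Proof. by rewrite /sqv /sqs; congr pair => /=; rewrite ?mulr0 ?scaler0 ?addr0. Qed.
Lemma sqs0 : sqs 0 = 0. Proof. by []. Qed.
Lemma sqs1 : sqs 1 = 1. Proof. by []. Qed.
Lemma sqsD a b : sqs (a + b) = sqs a + sqs b.
Proof. by rewrite /sqs; congr pair => /=; rewrite addr0. Qed.
Lemma sqsN a : sqs (- a) = - sqs a.
Proof. by rewrite /sqs; congr pair => /=; rewrite oppr0. Qed.
Lemma sqsM a b : sqs (a * b) = sqs a * sqs b.
Proof. by rewrite /sqs; congr pair => /=; rewrite !scaler0 addr0. Qed.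
Lemma sqsMn a n : sqs (a *+ n) = sqs a *+ n.
Proof. by elim: n => // n IH; rewrite !mulrS sqsD IH. Qed.
Lemma sqsX a n : sqs (a ^+ n) = sqs a ^+ n.
Proof. by elim: n => // n IH; rewrite !exprS sqsM IH. Qed.

Definition sqzE := (sqvD, sqvN, sqvZ, sqsD, sqsN, sqsM, sqsMn, sqsX, sqv0, sqs0, sqs1).

End SquareZero.

Ltac vring := apply: sqv_inj; rewrite ?sqzE; ring.

Lemma archimedean_inv (R : archiRealFieldType) (a e : R) : 0 <= a -> 0 < e ->
  exists N, forall n, (N <= n)%N -> a / n.+1%:R <= e.
Proof.
move=> a0 e0; exists (Num.truncn (a / e)).+1 => n Nn.
rewrite ler_pdivrMr ?ltr0Sn // mulrC -ler_pdivrMr //.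
by apply/ltW; apply: lt_trans (truncnS_gt _) _; rewrite ltr_nat ltnS.
Qed.

(** * Real-valued moduli, norms and limits of sequences *)

Section ComplexNorm.
Context {R : realType}.
Implicit Types (z w : R[i]).

(** Norms over [R[i]] take their values in [R[i]]; [cm] and [nr] move moduli and norms to [R], where
    [lra] and [nra] apply. *)
Definition cm z : R := ReC `|z|.

Lemma cmE z : `|z| = (cm z)%:C.
Proof. by rewrite /cm normc_def. Qed.

Lemma cm_ge0 z : 0 <= cm z.
Proof. by rewrite -lecR -cmE normr_ge0. Qed.

Lemma cmD z w : cm (z + w) <= cm z + cm w.
Proof. by rewrite -lecR rmorphD /= -!cmE ler_normD. Qed.

Lemma cmB z w : cm (z - w) <= cm z + cm w.
Proof. by rewrite -lecR rmorphD /= -!cmE ler_normB. Qed.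

Lemma cmN z : cm (- z) = cm z.
Proof. by rewrite /cm normrN. Qed.

Lemma cmM z w : cm (z * w) = cm z * cm w.
Proof. by apply: complexI; rewrite rmorphM /= -!cmE normrM. Qed.

Lemma cmX z n : cm (z ^+ n) = cm z ^+ n.
Proof. by apply: complexI; rewrite rmorphXn /= -!cmE normrX. Qed.

Lemma cmV z : cm z^-1 = (cm z)^-1.
Proof. by apply: complexI; rewrite fmorphV /= -!cmE normfV. Qed.

Lemma cmR (t : R) : cm t%:C = `|t|.
Proof. by rewrite /cm normc_def /= expr0n addr0 sqrtr_sqr. Qed.

Lemma cm_gt0 z : (0 < cm z) = (z != 0).
Proof. by rewrite -ltcR -cmE normr_gt0. Qed.

Lemma cm0 : cm 0 = 0. Proof. by rewrite /cm normr0. Qed.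
Lemma cm1 : cm 1 = 1. Proof. by rewrite /cm normr1. Qed.
Lemma cmn n : cm n%:R = n%:R.
Proof. by rewrite -(rmorph_nat (real_complex R)) cmR normr_nat. Qed.

Lemma ler_Re_cm z : `|ReC z| <= cm z.
Proof. by rewrite -lecR -cmE normc_ge_Re. Qed.

Lemma sqr_cm z : cm z ^+ 2 = ReC z ^+ 2 + ImC z ^+ 2.
Proof. by apply: complexI; rewrite rmorphXn /= -cmE add_Re2_Im2. Qed.

Lemma ler_Im_cm z : `|ImC z| <= cm z.
Proof.
rewrite -(ler_pXn2r (n := 2)) ?nnegrE ?cm_ge0 //.
by rewrite sqr_cm real_normK ?num_real // lerDr sqr_ge0.
Qed.

Lemma cm_le_ReIm z : cm z <= `|ReC z| + `|ImC z|.
Proof.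
rewrite [z in X in X <= _]complexE; apply: le_trans (cmD _ _) _.
rewrite cmM !cmR (_ : cm 'i = 1) ?mul1r //.
by rewrite /cm normc_def /= expr0n /= add0r expr1n sqrtr1.
Qed.

End ComplexNorm.

Section RealNorm.
Context {R : realType} {V : normedModType R[i]}.
Implicit Types (x y : V) (u v : nat -> V).

Definition nr x : R := ReC `|x|.

Lemma nrE x : `|x| = (nr x)%:C.
Proof. by rewrite /nr RRe_real // ger0_real. Qed.

Lemma nr_ge0 x : 0 <= nr x.
Proof. by rewrite -lecR -nrE normr_ge0. Qed.

Lemma nrD x y : nr (x + y) <= nr x + nr y.
Proof. by rewrite -lecR rmorphD /= -!nrE ler_normD. Qed.

Lemma nrN x : nr (- x) = nr x.
Proof. by rewrite /nr normrN. Qed.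

Lemma nrB x y : nr (x - y) <= nr x + nr y.
Proof. by rewrite -(nrN y) nrD. Qed.

Lemma nrBC x y : nr (x - y) = nr (y - x).
Proof. by rewrite -nrN opprB. Qed.

Lemma nrZ (c : R[i]) x : nr (c *: x) = cm c * nr x.
Proof. by apply: complexI; rewrite rmorphM /= -cmE -!nrE normrZ. Qed.

Lemma nr0 : nr (0 : V) = 0. Proof. by rewrite /nr normr0. Qed.

Lemma nr_eq0 x : nr x = 0 -> x = 0.
Proof. by move=> x0; apply/eqP; rewrite -normr_eq0 nrE x0. Qed.

Lemma nr_small_eq0 x : (forall e : R, 0 < e -> nr x <= e) -> x = 0.
Proof.
move=> h; apply: nr_eq0; apply/eqP; rewrite eq_le nr_ge0 andbT.
by apply/ler_addgt0Pr => e e0; rewrite add0r h.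
Qed.

Lemma nr_sum (I : Type) (r : seq I) (P : pred I) (F : I -> V) :
  nr (\sum_(i <- r | P i) F i) <= \sum_(i <- r | P i) nr (F i).
Proof.
elim/big_rec2: _ => [|i a b _ h]; first by rewrite nr0.
by apply: le_trans (nrD _ _) _; rewrite lerD2l.
Qed.

Lemma nr_triangle x y z : nr (x - z) <= nr (x - y) + nr (y - z).
Proof. by rewrite (_ : x - z = (x - y) + (y - z)) ?nrD //; vring. Qed.

Definition seq_lim u x : Prop :=
  forall e : R, 0 < e -> exists N, forall n, (N <= n)%N -> nr (u n - x) <= e.

Definition seq_cauchy u : Prop :=
  forall e : R, 0 < e -> exists N, forall n m, (N <= n)%N -> (N <= m)%N ->
    nr (u n - u m) <= e.

Lemma seq_lim_cauchy u x : seq_lim u x -> seq_cauchy u.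
Proof.
move=> h e e0; have [N hN] := h (e / 2) ltac:(lra).
exists N => n m /hN hn /hN hm; have := nr_triangle (u n) x (u m).
by rewrite (nrBC x); lra.
Qed.

Lemma seq_lim_uniq u x y : seq_lim u x -> seq_lim u y -> x = y.
Proof.
move=> hx hy; apply/eqP; rewrite -subr_eq0; apply/eqP/nr_small_eq0 => e e0.
have [N hN] := hx (e / 2) ltac:(lra); have [M hM] := hy (e / 2) ltac:(lra).
have := hN (maxn N M) (leq_maxl _ _); have := hM (maxn N M) (leq_maxr _ _).
by have := nr_triangle x (u (maxn N M)) y; rewrite (nrBC x (u _)); lra.
Qed.

Lemma seq_lim_cst x : seq_lim (fun=> x) x.
Proof. by move=> e e0; exists 0%N => n _; rewrite subrr nr0 ltW. Qed.

Lemma seq_limD u v x y : seq_lim u x -> seq_lim v y ->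
  seq_lim (fun n => u n + v n) (x + y).
Proof.
move=> hx hy e e0.
have [N hN] := hx (e / 2) ltac:(lra); have [M hM] := hy (e / 2) ltac:(lra).
exists (maxn N M) => n; rewrite geq_max => /andP[/hN h1 /hM h2].
rewrite (_ : _ - _ = (u n - x) + (v n - y)); last by vring.
by have := nrD (u n - x) (v n - y); lra.
Qed.

Lemma seq_limZ (c : R[i]) u x : seq_lim u x ->
  seq_lim (fun n => c *: u n) (c *: x).
Proof.
move=> hx e e0; have c0 := cm_ge0 c.
have [N hN] := hx (e / (cm c + 1)) ltac:(apply: divr_gt0; lra).
exists N => n /hN h; rewrite -scalerBr nrZ.
have : (cm c + 1) * nr (u n - x) <= e.
  by rewrite mulrC -ler_pdivlMr //; lra.
by have := nr_ge0 (u n - x); nra.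
Qed.

Lemma seq_lim_near u v x :
  seq_lim u x -> seq_lim (fun n => v n - u n) 0 -> seq_lim v x.
Proof.
move=> hu hv; rewrite -[x]add0r; have := seq_limD hv hu.
by congr seq_lim; apply/funext => n; rewrite subrK.
Qed.

Lemma seq_limB u v x y : seq_lim u x -> seq_lim v y ->
  seq_lim (fun n => u n - v n) (x - y).
Proof.
move=> hu hv; have := seq_limD hu (seq_limZ (-1) hv); rewrite scaleN1r.
by congr seq_lim; apply/funext => n; rewrite scaleN1r.
Qed.

Lemma seq_lim_nr u x (b : R) : seq_lim u x ->
  (exists N, forall n, (N <= n)%N -> nr (u n) <= b) -> nr x <= b.
Proof.
move=> hu [M hM]; apply/ler_addgt0Pr => e e0; have [N hN] := hu e e0.
have := hN (maxn N M) (leq_maxl _ _); have := hM (maxn N M) (leq_maxr _ _).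
by have := nr_triangle x (u (maxn N M)) 0; rewrite !subr0 (nrBC x); lra.
Qed.

Lemma seq_limS u x : seq_lim u x -> seq_lim (fun n => u n.+1) x.
Proof.
by move=> h e /h[N hN]; exists N => n Nn; apply: hN; rewrite ltnW.
Qed.

Lemma seq_lim_le u x (a : R) (N0 : nat) :
  0 <= a -> (forall n, (N0 <= n)%N -> nr (u n - x) <= a / n.+1%:R) ->
  seq_lim u x.
Proof.
move=> a0 h e e0; have [N hN] := archimedean_inv a0 e0.
exists (maxn N0 N) => n; rewrite geq_max => /andP[/h h1 /hN h2].
exact: le_trans h1 h2.
Qed.

End RealNorm.

(** * Discrete Cauchy and Poisson formulas on roots of unity *)

Section RootsOfUnity.
Context {R : realType}.

(** ['X^n - 1] splits over the closed field [R[i]] and is separable in characteristic 0, so it has n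
    distinct roots; these form a cyclic group. *)
Lemma prim_root_exists (n : nat) : (0 < n)%N ->
  exists w : R[i], n.-primitive_root w.
Proof.
pose p : {poly R[i]} := 'X^n - 1; have [r Dp] := closed_field_poly_normal p.
move=> n_gt0; rewrite (monicP _) ?monicXnsubC // scale1r in Dp.
have rn1 : all n.-unity_root r by apply/allP => z; rewrite -root_prod_XsubC -Dp.
have sz_r : (n < (size r).+1)%N.
  by rewrite -(size_prod_XsubC r id) -Dp size_XnsubC.
have [|z] := hasP (has_prim_root n_gt0 rn1 _ sz_r); last by exists z.
by rewrite -separable_prod_XsubC -Dp separable_Xn_sub_1 // pnatr_eq0 -lt0n.
Qed.

Context (N : nat) (om : R[i]) (om_prim : N.-primitive_root om).

Lemma cm_prim_root j : cm (om ^+ j) = 1.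
Proof.
have N0 := prim_order_gt0 om_prim.
have h : cm om ^+ N = 1 by rewrite -cmX (prim_expr_order om_prim) cm1.
rewrite cmX; suff -> : cm om = 1 by rewrite expr1n.
by apply/eqP; rewrite -(@pexpr_eq1 _ _ N) ?cm_ge0 // h.
Qed.

Lemma sum_prim_root m : \sum_(j < N) om ^+ (j * m) = if (N %| m)%N then N%:R else 0.
Proof.
case: ifP => [/dvdnP[q ->]|].
  under eq_bigr => j _ do
    rewrite mulnA mulnC exprM (prim_expr_order om_prim) expr1n.
  by rewrite sumr_const card_ord.
rewrite (prim_order_dvd om_prim) => hm.
have h1 : om ^+ m - 1 != 0 by rewrite subr_eq0 hm.
apply: (mulfI h1); rewrite mulr0.
under eq_bigr => j _ do rewrite mulnC exprM.
rewrite -subrX1 -exprM mulnC exprM (prim_expr_order om_prim) expr1n.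
by rewrite subrr.
Qed.

(** Discrete Cauchy formula. The weight [om ^+ (j * (N - n))] stands for om^(-jn), and [K <= N]
    excludes aliasing: the k-th term survives only if N divides N - n + k. *)
Lemma prim_root_coef (V : lmodType R[i]) (a : nat -> V) (r : R[i]) n K :
  (n < K)%N -> (K <= N)%N ->
  \sum_(j < N) om ^+ (j * (N - n)) *: \sum_(k < K) (r * om ^+ j) ^+ k *: a k
  = (N%:R * r ^+ n) *: a n.
Proof.
move=> nK KN.
under eq_bigr => j _ do rewrite scaler_sumr.
rewrite exchange_big /=.
transitivity (\sum_(k < K) (r ^+ k * \sum_(j < N) om ^+ (j * (N - n + k))) *: a k).
  apply: eq_bigr => k _; rewrite mulr_sumr scaler_suml; apply: eq_bigr => j _.
  rewrite scalerA; congr (_ *: _).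
  by rewrite exprMn -!exprM mulrCA -exprD -mulnDr.
rewrite (bigD1 (Ordinal nK)) //= [X in _ + X]big1 ?addr0.
  rewrite sum_prim_root subnK ?dvdnn; last by rewrite ltnW // (leq_trans nK).
  by rewrite mulrC.
move=> k hk; rewrite sum_prim_root; case: ifP => [|_]; last by rewrite mulr0 scale0r.
move=> /dvdnP[q hq]; have kK := ltn_ord k.
have kn : nat_of_ord k <> n by move=> h; move/eqP: hk; apply; apply: val_inj.
(* N - n + k lies strictly between 0 and 2N, so that q = 1 and k = n. *)
by exfalso; case: q hq => [|[|q]]; nia.
Qed.

(** |1 - w|^-2 is (2 Re (1 - w)^-1 - 1)/(1 - r^2), the Poisson kernel up to a factor, and the (1 -
    w_j)^-1 sum exactly to N/(1 - r^N) <= 2N; the 3 is 2 * 2 - 1. This gains a factor 1 - r over the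
    trivial bound N/(1 - r)^2. *)
Lemma poisson_sum (r : R) : 0 < r < 1 -> r ^+ N <= 2^-1 ->
  \sum_(j < N) (cm (1 - r%:C * om ^+ j) ^+ 2)^-1 <= 3 * N%:R / (1 - r).
Proof.
move=> /andP[r0 r1] rN; set w := fun j : nat => r%:C * om ^+ j.
have cw j : cm (w j) = r by rewrite cmM cm_prim_root mulr1 cmR gtr0_norm.
have nz j : 1 - w j != 0.
  by apply/eqP => /eqP; rewrite subr_eq0 => /eqP /(congr1 cm); rewrite cw cm1; lra.
have N0 := prim_order_gt0 om_prim.
have wN j : w j ^+ N = (r ^+ N)%:C.
  by rewrite exprMn -exprM mulnC exprM (prim_expr_order om_prim) expr1n mulr1 rmorphXn.
pose s := \sum_(j < N) (1 - w j)^-1.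
(* (1 - w^N)/(1 - w) is the sum of w^k over k < N, and only k = 0 survives the summation over the
   roots of unity. *)
have hs : s * (1 - (r ^+ N)%:C) = N%:R.
  have := @prim_root_coef (R[i]^o) (fun=> 1) r%:C 0 N N0 (leqnn _).
  rewrite subn0 expr0 mulr1.
  under eq_bigr => j _ do
    rewrite mulnC exprM (prim_expr_order om_prim) expr1n scale1r.
  have -> : N%:R *: (1 : R[i]^o) = N%:R by rewrite /GRing.scale /= mulr1.
  move=> <-; rewrite /s mulr_suml; apply: eq_bigr => j _.
  rewrite -(wN j); apply: (mulfI (nz j)); rewrite mulrA divff // mul1r.
  have := subrX1 (w j) N; rewrite -[X in X = _]opprB => /(congr1 -%R).
  rewrite opprK => ->; rewrite -mulNr opprB; congr (_ * _).
  by apply: eq_bigr => k _; rewrite /GRing.scale /= mulr1.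
have res : ReC s = N%:R / (1 - r ^+ N).
  have -> : s = (N%:R / (1 - r ^+ N))%:C; last by [].
  have hn : (1 - (r ^+ N)%:C) != 0 :> R[i].
    by rewrite -(rmorph1 (real_complex R)) -rmorphB /= eq_complex /= negb_and; apply/orP; left; apply/eqP; lra.
  apply: (mulIf hn); rewrite hs -(rmorph1 (real_complex R)) -rmorphB -rmorphM /=.
  by rewrite divfK ?rmorph_nat //; apply/eqP; lra.
have pk j : (cm (1 - w j) ^+ 2)^-1 = (2 * ReC (1 - w j)^-1 - 1) / (1 - r ^+ 2).
  have h2 := sqr_cm (w j); rewrite cw in h2.
  have h3 := sqr_cm (1 - w j).
  have h4 : cm (1 - w j) ^+ 2 != 0 by rewrite expf_neq0 // gt_eqF // cm_gt0.
  move: h2 h3 h4; move: (nz j); case: (w j) => a b /= _ h2 h3 h4.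
  rewrite h3 in h4 *; rewrite add0r in h4 *.
  rewrite h2; field; rewrite h4 andbT; apply/eqP => h; nra.
under eq_bigr => j _ do rewrite pk.
rewrite -mulr_suml sumrB sumr_const card_ord -mulr_sumr.
have -> : \sum_(j < N) ReC (1 - w j)^-1 = ReC s by rewrite /s raddf_sum.
rewrite res ler_pdivrMr; last by nra.
have h1 : N%:R / (1 - r ^+ N) <= 2 * N%:R.
  rewrite ler_pdivrMr; last by lra.
  have : 0 <= N%:R :> R by rewrite ler0n.
  by nra.
have -> : 3 * N%:R / (1 - r) * (1 - r ^+ 2) = 3 * N%:R * (1 + r).
  by field; apply/eqP; lra.
rewrite -[1 *+ N]/(N%:R : R).
have : 0 <= N%:R :> R by rewrite ler0n.
by nra.
Qed.

End RootsOfUnity.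

(** If q (1 + d)^3 <= 1, then q^K <= (1 + d)^(-3K) <= ((K + 1) d)^-3, one power more than the square
    that has to be beaten. The 7 in [d] comes from (1 + d)^3 <= 1 + 7 d for d <= 1. *)
Lemma geometric_decay2 (R : realType) (q e : R) : 0 < q < 1 -> 0 < e ->
  exists N, forall K, (N <= K)%N -> q ^+ K * K.+1%:R ^+ 2 <= e.
Proof.
move=> /andP[q0 q1] e0.
pose d := Num.min 1 ((q^-1 - 1) / 7).
have qi : 1 < q^-1 by rewrite invf_gt1.
have d0 : 0 < d by rewrite lt_min ltr01 /=; apply: divr_gt0; lra.
have [d1 d7] : d <= 1 /\ d <= (q^-1 - 1) / 7 by rewrite !ge_min !lexx /= orbT.
have qd : q * (1 + d) ^+ 3 <= 1.
  rewrite -ler_pdivlMl // mulr1.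
  apply: (@le_trans _ _ (1 + 7 * d)); last by lra.
  have : d ^+ 2 <= d by rewrite expr2; nra.
  have : d ^+ 3 <= d by rewrite exprS expr2; nra.
  by lra.
exists (Num.truncn (e^-1 / d ^+ 3)).+1 => K NK.
have h1 : K.+1%:R * d <= (1 + d) ^+ K.
  elim: K {NK} => [|K IH]; first by rewrite expr0 mul1r.
  have : 1 <= (1 + d) ^+ K by rewrite exprn_ege1 //; lra.
  rewrite exprS [K.+2%:R]mulrS; nra.
have h2 : q ^+ K * (K.+1%:R * d) ^+ 3 <= 1.
  apply: le_trans (_ : q ^+ K * ((1 + d) ^+ K) ^+ 3 <= 1).
    rewrite ler_pM2l ?exprn_gt0 // lerXn2r ?nnegrE //.
      by apply: mulr_ge0; rewrite ?ler0n ?ltW.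
    by apply: exprn_ge0; lra.
  rewrite -exprM mulnC exprM -exprMn exprn_ile1 //.
  by apply: mulr_ge0; [exact: ltW | apply: exprn_ge0; lra].
have Ke : e^-1 / d ^+ 3 <= K.+1%:R.
  by apply/ltW; apply: lt_trans (truncnS_gt _) _; rewrite ltr_nat ltnS.
have d30 : 0 < d ^+ 3 by rewrite exprn_gt0.
move: Ke; rewrite ler_pdivrMr // -(ler_pM2l e0) divff ?gt_eqF // => Ke.
have q2 : 0 <= q ^+ K * K.+1%:R ^+ 2.
  by apply: mulr_ge0; apply: exprn_ge0; rewrite ?ler0n ?ltW.
apply: le_trans (_ : q ^+ K * K.+1%:R ^+ 2 * (e * (K.+1%:R * d ^+ 3)) <= e).
  by rewrite ler_peMr.
rewrite (_ : _ * _ = e * (q ^+ K * (K.+1%:R * d) ^+ 3)); last by ring.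
by rewrite ger_pMr.
Qed.

(** * Power bounds from a resolvent estimate on the unit disc *)

Section Iterates.
Context {R : realType} {V : normedModType R[i]}.
Implicit Types (f : {linear V -> V}) (x y : V).

Lemma iter_linD f n x y : iter n f (x + y) = iter n f x + iter n f y.
Proof. by elim: n => //= n ->; rewrite linearD. Qed.

Lemma iter_linZ f n (c : R[i]) x : iter n f (c *: x) = c *: iter n f x.
Proof. by elim: n => //= n ->; rewrite linearZ. Qed.

Lemma iter_comm f (g : V -> V) n x :
  (forall y, g (f y) = f (g y)) -> g (iter n f x) = iter n f (g x).
Proof. by move=> h; elim: n => //= n <-. Qed.

Lemma iter_bound f (b : R) n x : 0 <= b -> (forall y, nr (f y) <= b * nr y) ->
  nr (iter n f x) <= b ^+ n * nr x.
Proof.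
move=> b0 h; elim: n => [|n IH] /=; first by rewrite mul1r.
by apply: le_trans (h _) _; rewrite exprS -mulrA ler_wpM2l.
Qed.

(* If Y = (1 - w f)^-1, this is the expansion of Y^3 in powers of w with its
   remainder. *)
Lemma cube_expansion f (Y : V -> V) (w : R[i]) x K :
  (forall x, Y x = x + w *: f (Y x)) ->
  Y (Y (Y x)) = \sum_(k < K) (w ^+ k * 'C(k.+2, 2)%:R) *: iter k f x +
    w ^+ K *: iter K f
      (Y (Y (Y x)) + K%:R *: Y (Y x) + 'C(K.+1, 2)%:R *: Y x).
Proof.
move=> hY; elim: K => [|K IH].
  by rewrite big_ord0 add0r expr0 scale1r /= !scale0r !addr0.
rewrite big_ord_recr /= [LHS]IH -[RHS]addrA; congr (_ + _).
set a := _ + _ + _; set b := (X in _ = _ + _ *: f (iter K f X)).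
(* As each [Y] equals its argument plus w f Y, passing from K to K + 1 peels off one coefficient, by
   Pascal's rule for 'C(K + 2, 2). *)
suff -> : a = 'C(K.+2, 2)%:R *: x + w *: f b.
  rewrite -iterS iterSr iter_linD !iter_linZ scalerDr !scalerA.
  by rewrite exprSr.
have fZ (d : R[i]) u : f (d *: u) = d *: f u by exact: linearZ.
rewrite /a /b 2!(linearD f) 2!fZ.
have -> : 'C(K.+2, 2) = ('C(K.+1, 2) + K.+1)%N by rewrite binS bin1.
move: (hY (Y (Y x))) (hY (Y x)) (hY x).
move: (f (Y x)) (f (Y (Y x))) (f (Y (Y (Y x)))) => u1 u2 u3 -> -> ->.
move: 'C(K.+1, 2) => c; rewrite natrD mulrS.
by vring.
Qed.

End Iterates.

Section PowerBounds.
Context {R : realType} {V : normedModType R[i]}.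
Variables (f : {linear V -> V}) (Y : R[i] -> V -> V).
Implicit Types (x : V) (w : R[i]).

(* Cauchy's estimate for the coefficient of w^n in E (1 - w f)^-3, the contour
   integral being replaced by the mean over the N-th roots of unity. *)
Lemma cube_coef_bound (E : {linear V -> V}) (r s m c b e : R) :
  0 < r < 1 -> r < s ->
  (forall k x, s ^+ k * nr (iter k f x) <= m * nr x) ->
  (forall w, cm w = r -> forall x, Y w x = x + w *: f (Y w x)) ->
  (forall w, cm w = r -> forall x, nr (Y w x) <= c * nr x) ->
  (forall w, cm w = r -> forall x,
     nr (E (Y w (Y w (Y w x)))) <= b / cm (1 - w) ^+ 2 * nr x) ->
  (forall x, nr (E x) <= e * nr x) ->
  0 <= c -> 0 <= e -> 0 <= m -> 0 <= b ->
  forall n x, r ^+ n * 'C(n.+2, 2)%:R * nr (E (iter n f x)) <= 3 * b / (1 - r) * nr x.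
Proof.
move=> r01 rs hm hY hc hb he c0 e0 m0 b0 n x; have /andP[r0 r1] := r01.
apply/ler_addgt0Pr => d d0.
pose C0 := e * m * (c ^+ 3 + c ^+ 2 + c) * nr x.
have C00 : 0 <= C0.
  apply: mulr_ge0 (nr_ge0 _); apply: mulr_ge0; first exact: mulr_ge0.
  by rewrite !addr_ge0 ?exprn_ge0.
(* N is sent to infinity: the remainder of the expansion decays like (r/s)^N (N + 1)^2, which is
   where the a priori bound at the larger radius s is used. Hence [m] enters only the choice of N
   and not the conclusion; the continuation argument for [geom_bounded] rests on this. *)
have [N1 hN1] := @geometric_decay2 R (r / s) (d / (C0 + 1))
  ltac:(apply/andP; split; [apply: divr_gt0 | rewrite ltr_pdivrMr ?mul1r]; clear -V f Y r0 rs; lra)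
  ltac:(apply: divr_gt0; clear -V f Y C00 d0; lra).
have [N2 hN2] := @geometric_decay2 R r (2^-1) r01 ltac:(lra).
have [N [nN N1N N2N]] : exists N, [/\ (n < N)%N, (N1 <= N)%N & (N2 <= N)%N].
  exists (maxn n (maxn N1 N2)).+1; split; first by rewrite ltnS leq_maxl.
    by rewrite ltnW // ltnS !leq_max leqnn orbT.
  by rewrite ltnW // ltnS !leq_max leqnn !orbT.
have N0 : 0 < N%:R :> R by rewrite ltr0n (leq_ltn_trans _ nN).
have [om om_prim] := @prim_root_exists R N (leq_ltn_trans (leq0n n) nN).
have rN : r ^+ N <= 2^-1.
  apply: le_trans (hN2 _ N2N); rewrite ler_peMr ?exprn_ge0 ?(ltW r0) //.
  by rewrite exprn_ege1 // ler1n.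
pose w (j : nat) := r%:C * om ^+ j.
have cw j : cm (w j) = r by rewrite cmM (cm_prim_root om_prim) mulr1 cmR gtr0_norm.
pose y3 j := Y (w j) (Y (w j) (Y (w j) x)).
pose rem j := w j ^+ N *: E (iter N f
  (y3 j + N%:R *: Y (w j) (Y (w j) x) + 'C(N.+1, 2)%:R *: Y (w j) x)).
have hexp j : \sum_(k < N) w j ^+ k *: ('C(k.+2, 2)%:R *: E (iter k f x))
    = E (y3 j) - rem j.
  rewrite [E (y3 j)](congr1 E (cube_expansion x N (hY _ (cw j)))).
  rewrite linearD linear_sum linearZ -/(rem j) addrK; apply: eq_bigr => k _.
  by rewrite scalerA; exact/esym/linearZ.
have hrem j : nr (rem j) <= d.
  rewrite nrZ cmX cw.
  have hy1 : nr (Y (w j) x) <= c * nr x by exact: hc.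
  have hy2 : nr (Y (w j) (Y (w j) x)) <= c ^+ 2 * nr x.
    by rewrite expr2 -mulrA; apply: le_trans (hc _ (cw j) _) _; rewrite ler_wpM2l.
  have hy3 : nr (y3 j) <= c ^+ 3 * nr x.
    by rewrite exprS -mulrA; apply: le_trans (hc _ (cw j) _) _; rewrite ler_wpM2l.
  set v := _ + _ + _.
  have hv : nr v <= (c ^+ 3 + c ^+ 2 + c) * nr x * N.+1%:R ^+ 2.
    have hN : N%:R <= N.+1%:R ^+ 2 :> R by rewrite -natrX ler_nat expnS expn1 (leq_trans (leqnSn N)) // leq_pmulr.
    have hB : 'C(N.+1, 2)%:R <= N.+1%:R ^+ 2 :> R.
      by rewrite -natrX ler_nat bin2 /= -divn2 (leq_trans (leq_div _ _)) // expnS expn1 leq_mul2l leqnSn orbT.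
    have h1 : 1 <= N.+1%:R ^+ 2 :> R by rewrite -natrX ler1n expn_gt0.
    apply: le_trans (nrD _ _) _; apply: le_trans (lerD (nrD _ _) (lexx _)) _.
    rewrite !nrZ !cmn mulrDl mulrDl 2!mulrDl.
    apply: lerD; first apply: lerD.
    - by apply: le_trans hy3 _; rewrite ler_peMr // mulr_ge0 ?exprn_ge0 ?nr_ge0.
    - by rewrite mulrC ler_pM ?ler0n ?nr_ge0.
    - by rewrite mulrC ler_pM ?ler0n ?nr_ge0.
  have h := hm N v.
  have sN : 0 < s ^+ N by rewrite exprn_gt0 //; clear -V f Y r0 rs; lra.
  apply: le_trans (_ : r ^+ N * (e * nr (iter N f v)) <= d).
    by rewrite ler_wpM2l ?exprn_ge0 ?(ltW r0).
  have -> : r ^+ N = (r / s) ^+ N * s ^+ N.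
    by rewrite expr_div_n divfK // gt_eqF.
  have q0 : 0 <= (r / s) ^+ N by rewrite exprn_ge0 // divr_ge0 //; clear -V f Y r0 rs; lra.
  rewrite (_ : _ * _ = (r / s) ^+ N * (e * (s ^+ N * nr (iter N f v)))); last by ring.
  apply: le_trans (_ : (r / s) ^+ N * (e * (m * nr v)) <= d).
    by do 2 apply: ler_wpM2l => //.
  apply: le_trans (_ : (r / s) ^+ N * (e * (m *
    ((c ^+ 3 + c ^+ 2 + c) * nr x * N.+1%:R ^+ 2))) <= d).
    by do 3 apply: ler_wpM2l => //.
  rewrite (_ : _ * _ = (r / s) ^+ N * N.+1%:R ^+ 2 * C0); last by rewrite /C0; ring.
  apply: le_trans (_ : d / (C0 + 1) * C0 <= d).
    by rewrite ler_wpM2r ?hN1.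
  rewrite mulrAC ler_pdivrMr; clear -V f Y C00 d0; nra.
have key := prim_root_coef om_prim
  (fun k => 'C(k.+2, 2)%:R *: E (iter k f x)) r%:C nN (leqnn N).
have {key} key : (N%:R * (r ^+ n * 'C(n.+2, 2)%:R)) * nr (E (iter n f x)) =
    nr (\sum_(j < N) om ^+ (j * (N - n)) *: (E (y3 j) - rem j)).
  under [in RHS]eq_bigr => j _ do rewrite -hexp.
  rewrite key !nrZ !cmM !cmX !cmn cmR gtr0_norm //; ring.
have {key} : N%:R * (r ^+ n * 'C(n.+2, 2)%:R * nr (E (iter n f x))) <=
    N%:R * (3 * b / (1 - r) * nr x + d).
  rewrite mulrA key; apply: le_trans (nr_sum _ _ _) _.
  apply: (@le_trans _ _ (\sum_(j < N) (b * nr x * (cm (1 - w j) ^+ 2)^-1 + d))).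
    apply: ler_sum => j _; rewrite nrZ (cm_prim_root om_prim) mul1r.
    apply: le_trans (nrB _ _) (lerD _ (hrem _)).
    by apply: le_trans (hb _ (cw j) _) _; rewrite mulrAC.
  rewrite big_split /= sumr_const card_ord -mulr_sumr -[d *+ N]mulr_natl [X in _ <= X]mulrDr lerD2r.
  apply: (@le_trans _ _ (b * nr x * (3 * N%:R / (1 - r)))).
    by rewrite ler_wpM2l ?mulr_ge0 ?nr_ge0 // (poisson_sum om_prim).
  by rewrite le_eqVlt; apply/orP; left; apply/eqP; ring.
by rewrite ler_pM2l.
Qed.

End PowerBounds.

(** With i = 1/(2(n + 1)), Bernoulli's inequality gives (1 - i)^n >= 1 - n i >= 1/2. The radius 1 -
    i thus has distance of order 1/n from the unit circle, while its n-th power stays bounded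
    below. *)
Lemma bernoulli_half (R : realType) n : exists i : R,
  [/\ 0 < i, i <= 2^-1, i^-1 = 2 * n.+1%:R & 2^-1 <= (1 - i) ^+ n].
Proof.
have h : forall (a : R) k, 0 <= a <= 1 -> 1 - k%:R * a <= (1 - a) ^+ k.
  move=> a k /andP[a0 a1]; elim: k => [|k IH]; first by rewrite expr0; lra.
  rewrite exprS mulrS.
  have p0 : 0 <= (1 - a) ^+ k by apply: exprn_ge0; lra.
  have k0 : 0 <= k%:R :> R by rewrite ler0n.
  have [h|h] := lerP 0 (1 - k%:R * a).
    have : 0 <= k%:R * a by apply: mulr_ge0.
    by nra.
  have : 0 <= (1 - a) * (1 - a) ^+ k by apply: mulr_ge0 => //; lra.
  by nra.
have n0 : 0 < n.+1%:R :> R by rewrite ltr0n.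
exists (2 * n.+1%:R)^-1; rewrite invrK; split => //.
- rewrite lef_pV2 ?posrE ?mulr_gt0 //.
  by rewrite -[X in X <= _]mulr1 ler_pM2l // ler1n.
apply: (@le_trans _ _ (1 - n%:R * (2 * n.+1%:R)^-1)); last apply: h.
  have : n%:R * (2 * n.+1%:R)^-1 <= 2^-1 :> R.
    by rewrite ler_pdivrMr ?mulr_gt0 // mulKf // ler_nat leqnSn.
  by set z := _ * _; lra.
apply/andP; split; first by rewrite invr_ge0 mulr_ge0 // ler0n.
by rewrite invf_le1 ?mulr_gt0 // -natrM ler1n.
Qed.

Section RittBounds.
Context {R : realType} {V : normedModType R[i]}.
Variables (f : {linear V -> V}) (Y : R[i] -> V -> V) (C : R).
Hypothesis C1 : 1 <= C.
Hypothesis f_bound : forall x, nr (f x) <= C * nr x.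
Hypothesis Y_eq : forall w, cm w < 1 -> forall x, Y w x = x + w *: f (Y w x).
Hypothesis Y_bound : forall w, cm w < 1 -> forall x,
  nr (Y w x) <= C / cm (1 - w) * nr x.

Let cm1B (w : R[i]) (r : R) : cm w = r -> 1 - r <= cm (1 - w) <= 1 + r.
Proof.
move=> <-; have := cmB 1 w; have := cmD (1 - w) w; rewrite subrK cm1.
by move=> ? ?; apply/andP; split; lra.
Qed.

Let Y_bound_le (w : R[i]) (r : R) x : cm w = r -> r < 1 ->
  nr (Y w x) <= C / (1 - r) * nr x.
Proof.
have hC := C1.
move=> wr r1; have /andP[h1 _] := cm1B wr.
apply: le_trans (Y_bound _ _) _; first by rewrite wr.
by rewrite ler_wpM2r ?nr_ge0 // ler_wpM2l ?lef_pV2 ?posrE //; lra.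
Qed.

(** The a priori bound at radius [s] that Cauchy's estimate requires. For all s < 1 together it says
    that the spectral radius of [f] is at most 1; only the existence of [m] matters. *)
Definition geom_bounded (s : R) : Prop :=
  exists2 m : R, 0 <= m & forall k x, s ^+ k * nr (iter k f x) <= m * nr x.

(** Cauchy's estimate just inside radius s gives s^n (n + 1) |f^n x| <= 2 K0 |x| with K0 depending
    on r and C only. A fixed power of s f therefore has norm at most 1/2, which leaves room to
    enlarge s by a factor that is the same for every s <= r. *)
Lemma geom_bounded_step (r : R) : 0 < r < 1 ->
  exists2 q : R, 1 < q &
    forall s : R, 0 < s <= r -> geom_bounded s -> geom_bounded (q * s).
Proof.
have hC := C1.
move=> /andP[r0 r1]; pose c := C / (1 - r); pose K0 := 12 * c ^+ 3 / (1 - r).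
have c0 : 0 <= c by apply: divr_ge0; lra.
have K00 : 0 <= K0.
  by apply: divr_ge0; [apply: mulr_ge0 => //; apply: exprn_ge0 | lra].
have hdecay (s : R) : 0 < s <= r -> geom_bounded s -> forall n x,
    s ^+ n * n.+1%:R * nr (iter n f x) <= 2 * K0 * nr x.
  move=> /andP[s0 sr] [m m0 hm] n x.
  (* The smaller radius t = s (1 - i) costs at most a factor 2 in the n-th power. *)
  have [i [i0 i1 _ hb]] := bernoulli_half R n.
  pose t : R := s * (1 - i).
  have ts : t < s by rewrite /t; nra.
  have t0 : 0 < t by rewrite /t; nra.
  have tle1 : t < 1 by lra.
  have := @cube_coef_bound _ _ f Y idfun t s m c (4 * c ^+ 3) 1
    ltac:(apply/andP; split; lra) ts hm.
  have Yc w : cm w = t -> forall x, nr (Y w x) <= c * nr x.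
    move=> wt y; apply: le_trans (Y_bound_le _ wt tle1) _.
    by rewrite ler_wpM2r ?nr_ge0 // ler_wpM2l ?lef_pV2 ?posrE //; lra.
  move=> /(_ (fun w wt => Y_eq (eq_ind_r (fun u => u < 1) tle1 wt)) Yc).
  move=> /(_ _ _ c0 ler01 m0 _ n x) h.
  have {}h : t ^+ n * 'C(n.+2, 2)%:R * nr (iter n f x) <=
      3 * (4 * c ^+ 3) / (1 - t) * nr x.
    (* With [E] the identity, |Y^3 y| <= c^3 |y|, and |1 - w| <= 2 brings this into the required
       form with b = 4 c^3. *)
    apply: h => [w wt y|y|]; last by apply: mulr_ge0 => //; exact: exprn_ge0.
      apply: (@le_trans _ _ (c ^+ 3 * nr y)).
        apply: le_trans (Yc _ wt _) _; rewrite exprS -mulrA ler_wpM2l //.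
        apply: le_trans (Yc _ wt _) _; rewrite exprS expr1 -mulrA ler_wpM2l //.
        exact: Yc.
      rewrite ler_wpM2r ?nr_ge0 //; have /andP[h1 h2] := cm1B wt.
      have h3 : 0 < cm (1 - w) by lra.
      rewrite ler_pdivlMr ?exprn_gt0 // mulrC ler_wpM2r ?exprn_ge0 //.
      by rewrite expr2; nra.
    by rewrite mul1r.
  have -> : 2 * K0 * nr x = 2 * (K0 * nr x) by ring.
  have h2 : t ^+ n * 'C(n.+2, 2)%:R * nr (iter n f x) <= K0 * nr x.
    apply: le_trans h _; rewrite ler_wpM2r ?nr_ge0 // /K0.
    rewrite ler_pdivlMr; last by lra.
    rewrite mulrAC ler_pdivrMr; last by lra.
    rewrite (_ : 3 * _ = 12 * c ^+ 3); last by ring.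
    by rewrite ler_wpM2l //; [apply: mulr_ge0 => //; exact: exprn_ge0 | lra].
  have h3 : s ^+ n * n.+1%:R <= 2 * (t ^+ n * 'C(n.+2, 2)%:R).
    rewrite /t exprMn.
    have h4 : n.+1%:R <= 'C(n.+2, 2)%:R :> R.
      by rewrite ler_nat binS bin1 leq_addl.
    have h5 : 0 <= s ^+ n by rewrite exprn_ge0 // ltW.
    have : 0 <= s ^+ n * ('C(n.+2, 2)%:R * ((1 - i) ^+ n - 2^-1)).
      by apply: mulr_ge0 => //; apply: mulr_ge0; rewrite ?ler0n // subr_ge0.
    by nra.
  apply: le_trans (_ : 2 * (t ^+ n * 'C(n.+2, 2)%:R) * nr (iter n f x) <= _).
    by rewrite ler_wpM2r ?nr_ge0.
  by rewrite -mulrA ler_wpM2l.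
pose n0 := (Num.truncn (4 * K0)).
have hn0 : 4 * K0 <= n0.+1%:R by apply/ltW; rewrite truncnS_gt.
clearbody n0.
have n00 : 0 < n0.+1%:R :> R by rewrite ltr0n.
have [i [i0 i1 _ hb]] := bernoulli_half R n0.+1.
pose p := 1 - i : R.
have p0 : 0 < p by rewrite /p; lra.
exists p^-1; first by rewrite invf_gt1 // /p; lra.
move=> s hs hsb; have /andP[s0 sr] := hs.
pose t := p^-1 * s; have t0 : 0 < t by rewrite mulr_gt0 ?invr_gt0.
(* By the choice of [n0] the power (s f)^(n0 + 1) has norm at most 1/2, and p^(n0 + 1) >= 1/2
   absorbs the enlargement of the radius. The other powers follow by division with remainder. *)
have hcontr x : t ^+ n0.+1 * nr (iter n0.+1 f x) <= nr x.
  have h := hdecay s hs hsb n0.+1 x.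
  have pn0 : 0 < p ^+ n0.+1 by rewrite exprn_gt0.
  rewrite /t exprMn exprVn -mulrA mulrC ler_pdivrMr //.
  have sn0 : 0 <= s ^+ n0.+1 * nr (iter n0.+1 f x).
    by rewrite mulr_ge0 ?nr_ge0 // exprn_ge0 // ltW.
  have hx := nr_ge0 x.
  have h1 : n0.+1%:R * (s ^+ n0.+1 * nr (iter n0.+1 f x)) <= 2 * K0 * nr x.
    apply: le_trans h; rewrite mulrA [_ * s ^+ _]mulrC.
    rewrite ler_wpM2r ?nr_ge0 // ler_wpM2l ?ler_nat //.
    by rewrite exprn_ge0 // ltW.
  have h2 : n0.+1%:R * (s ^+ n0.+1 * nr (iter n0.+1 f x)) <= n0.+1%:R * (nr x / 2).
    by apply: le_trans h1 _; nra.
  rewrite ler_pM2l // in h2.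
  apply: le_trans h2 _.
  by rewrite ler_wpM2l.
rewrite -/t; clearbody t; have tC : 0 <= t * C by apply: mulr_ge0; lra.
exists ((1 + t * C) ^+ n0.+1); first by apply: exprn_ge0; lra.
move=> k; have [m km] := ubnP k; elim: m k km => // m IH k km x.
have [kn|kn] := ltnP k n0.+1.
  apply: le_trans (_ : t ^+ k * (C ^+ k * nr x) <= _).
    by rewrite ler_wpM2l ?exprn_ge0 ?(ltW t0) // iter_bound //; lra.
  rewrite mulrA ler_wpM2r ?nr_ge0 // -exprMn.
  apply: (@le_trans _ _ ((1 + t * C) ^+ k)).
    by rewrite lerXn2r ?nnegrE //; lra.
  by apply: ler_weXn2l; [lra | exact: ltnW].
rewrite -(subnKC kn) iterD exprD -mulrA mulrCA.
apply: le_trans (_ : t ^+ (k - n0.+1) * nr (iter (k - n0.+1) f x) <= _).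
  by rewrite ler_wpM2l ?exprn_ge0 ?(ltW t0).
by apply: IH; rewrite ltn_subLR // addSn ltnS (leq_trans _ (leq_addl _ _)) // -ltnS.
Qed.

(** The bound is trivial for s <= 1/C, as |f x| <= C |x|, and finitely many enlargements by the
    factor q reach any r < 1. This continuation stands in for the holomorphy of the resolvent. *)
Lemma geom_bounded_lt1 (r : R) : 0 < r < 1 -> geom_bounded r.
Proof.
have hC := C1.
move=> r01; have /andP[r0 r1] := r01.
have [q q1 hq] := geom_bounded_step r01.
have hj j (s : R) : 0 < s <= r -> s <= C^-1 * q ^+ j -> geom_bounded s.
  elim: j s => [|j IH] s /andP[s0 sr] sj.
    exists 1 => // k x; rewrite mul1r.
    apply: le_trans (_ : s ^+ k * (C ^+ k * nr x) <= _).
      by rewrite ler_wpM2l ?exprn_ge0 ?(ltW s0) // iter_bound //; lra.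
    rewrite mulrA ler_piMl ?nr_ge0 // -exprMn exprn_ile1 //.
      by rewrite mulr_ge0 //; lra.
    by rewrite -ler_pdivlMr ?mul1r //; [rewrite expr0 mulr1 in sj | lra].
  have qs : s / q < s by rewrite ltr_pdivrMr; nra.
  rewrite (_ : s = q * (s / q)); last by rewrite mulrC divfK //; apply/eqP; lra.
  apply: hq; first by rewrite divr_gt0 //=; lra.
  apply: IH; first by rewrite divr_gt0 //=; lra.
  by rewrite ler_pdivrMr -?mulrA -?exprSr //; lra.
pose j := Num.truncn (C / (q - 1)).
apply: (hj j.+1); first by rewrite r0 lexx.
have hB : 1 + j.+1%:R * (q - 1) <= q ^+ j.+1.
  elim: j.+1 => [|m IH]; first by rewrite expr0; lra.
  have m0 : 0 <= m%:R :> R by rewrite ler0n.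
  have := mulr_ge0 m0 (sqr_ge0 (q - 1)); rewrite expr2 => h.
  rewrite exprS [m.+1%:R]mulrS; apply: (@le_trans _ _ (q * (1 + m%:R * (q - 1)))).
    by nra.
  by rewrite ler_wpM2l //; lra.
have : C / (q - 1) < j.+1%:R by exact: truncnS_gt.
rewrite ltr_pdivrMr; last by lra.
move=> h; rewrite mulrC ler_pdivlMr; last by lra.
by nra.
Qed.

(* Taking r = 1 - 1/(2(n+1)) in Cauchy's estimate; for the first bound E = 1
   and for the second E = f - 1. *)
Lemma ritt_power_bound n x :
  nr (iter n f x) <= 96 * C ^+ 3 * nr x /\
  n.+1%:R * nr (f (iter n f x) - iter n f x) <= 96 * C ^+ 3 * nr x.
Proof.
have hC := C1.
have n0 : 0 < n.+1%:R :> R by rewrite ltr0n.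
have [i [i0 i1 iE hb]] := bernoulli_half R n.
pose r := 1 - i; have r01 : 0 < r < 1 by rewrite /r; apply/andP; split; lra.
have /andP[r0 r1] := r01; have r2 : 2^-1 <= r by rewrite /r; lra.
have hr : 1 - r = i by rewrite /r; lra.
have [m m0 hm] : geom_bounded ((1 + r) / 2).
  by apply: geom_bounded_lt1; apply/andP; split; lra.
have rs : r < (1 + r) / 2 by lra.
have Yr w : cm w = r -> forall x, Y w x = x + w *: f (Y w x).
  by move=> wr; apply: Y_eq; rewrite wr.
have Yc w : cm w = r -> forall x, nr (Y w x) <= C / i * nr x.
  by move=> wr y; have := Y_bound_le y wr r1; rewrite hr.
have C0 : 0 <= C := le_trans ler01 C1.
have c0 : 0 <= C / i by rewrite divr_ge0 // ltW.
have hpos w : cm w = r -> 0 < cm (1 - w).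
  by move=> /cm1B /andP[h _]; lra.
have Y2 w y : cm w = r -> nr (Y w (Y w y)) <= C ^+ 2 / cm (1 - w) ^+ 2 * nr y.
  move=> wr; have hw := hpos w wr; have w1 : cm w < 1 by rewrite wr.
  rewrite -expr_div_n expr2 -[X in _ <= X]mulrA.
  apply: le_trans (Y_bound w1 _) _; rewrite ler_wpM2l ?Y_bound //.
  by rewrite divr_ge0 // ltW.
rewrite -/r in hb.
have hbin : 'C(n.+2, 2)%:R * 2 = n.+1%:R * n.+2%:R :> R.
  by rewrite -!natrM mulnC -(mul_bin_diag n.+2 1) bin1 mulnC.
(* 24 = 3 * 2 * 2 * 2, the factors 2 coming from r^n >= 1/2, from 1/(1 - r) = 2 (n + 1) and from
   'C(n + 2, 2) = (n + 1)(n + 2)/2. *)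
have conc (E : {linear V -> V}) (b : R) : 0 <= b ->
    (r ^+ n * 'C(n.+2, 2)%:R * nr (E (iter n f x)) <= 3 * b / (1 - r) * nr x) ->
    n.+2%:R * nr (E (iter n f x)) <= 24 * b * nr x.
  move=> b0; rewrite hr iE => h.
  have h1 : 2^-1 * 'C(n.+2, 2)%:R * nr (E (iter n f x)) <= 3 * b * (2 * n.+1%:R) * nr x.
    by apply: le_trans h; rewrite ler_wpM2r ?nr_ge0 // ler_wpM2r ?ler0n.
  rewrite -(ler_pM2l n0) mulrA -hbin; nra.
have C30 : 0 <= C ^+ 3 by exact: exprn_ge0.
have C20 : 0 <= C ^+ 2 by exact: exprn_ge0.
have n20 : 0 < n.+2%:R :> R by rewrite ltr0n.
have xn := nr_ge0 x.
split.
(* Two factors [Y] are estimated by C/|1 - w|, the third by C/(1 - r) = C/i. *)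
- have b0 : 0 <= C ^+ 3 / i by rewrite divr_ge0 // ltW.
  have h := conc idfun _ b0 (@cube_coef_bound _ _ f Y idfun r _ m (C / i) (C ^+ 3 / i)
    1 r01 rs hm Yr Yc _ _ c0 ler01 m0 b0 n x).
  rewrite -(ler_pM2l n20); apply: le_trans (h _ _) _ => [w wr y|y|].
  + rewrite (_ : _ / _ / _ = C / i * (C ^+ 2 / cm (1 - w) ^+ 2)); last by ring.
    by rewrite -mulrA; apply: le_trans (Yc _ wr _) _; rewrite ler_wpM2l ?Y2.
  + by rewrite mul1r.
  rewrite iE (_ : 24 * _ * _ = 48 * (C ^+ 3 * nr x) * n.+1%:R); last by ring.
  have h0 : 0 <= C ^+ 3 * nr x by exact: mulr_ge0.
  rewrite (_ : n.+2%:R * _ = 48 * (C ^+ 3 * nr x) * (2 * n.+2%:R)); last by ring.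
  by rewrite ler_wpM2l ?mulr_ge0 // -natrM ler_nat (leq_trans (leqnSn _)) // leq_pmull.
- pose E : {linear V -> V} := f \- idfun.
  have e0 : 0 <= C + 1 by exact: addr_ge0.
  have b0 : 0 <= 2 * (C + 1) * C ^+ 2 by rewrite !mulr_ge0.
  have h := conc E _ b0 (@cube_coef_bound _ _ f Y E r _ m (C / i) _
    (C + 1) r01 rs hm Yr Yc _ _ c0 e0 m0 b0 n x).
  apply: le_trans (_ : n.+2%:R * nr (E (iter n f x)) <= _).
    by rewrite ler_wpM2r ?nr_ge0 // ler_nat.
  apply: le_trans (h _ _) _ => [w wr y|y|].
  + have h1 u : nr (E (Y w u)) <= 2 * (C + 1) * nr u.
      have w1 : cm w < 1 by rewrite wr.
      (* w (f - 1) (1 - w f)^-1 = (1 - w) (1 - w f)^-1 - 1 is bounded uniformly in w: [E] cancels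
         the singularity of the third factor, which gains a factor n. *)
      have hE : w *: E (Y w u) = (1 - w) *: Y w u - u.
        have := Y_eq w1 u; rewrite /E /= => hY.
        rewrite scalerBr [X in _ = _ *: X - _]hY.
        have {}hY : w *: f (Y w u) = Y w u - u by rewrite [in RHS]hY addrC addKr.
        rewrite hY; set y0 := Y w u; vring.
      have h2 : nr (w *: E (Y w u)) <= (C + 1) * nr u.
        rewrite hE mulrDl mul1r; apply: le_trans (nrB _ _) _; rewrite lerD2r nrZ.
        have h3 := hpos w wr; have := Y_bound w1 u.
        by rewrite mulrAC ler_pdivlMr // mulrC.
      rewrite nrZ wr in h2; rewrite -mulrA -ler_pdivrMl //.
      by apply: le_trans h2; rewrite ler_wpM2r ?nr_ge0.
    apply: le_trans (h1 _) _.
    have -> : 2 * (C + 1) * C ^+ 2 / cm (1 - w) ^+ 2 * nr y =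
      2 * (C + 1) * (C ^+ 2 / cm (1 - w) ^+ 2 * nr y) by rewrite !mulrA.
    by rewrite ler_wpM2l ?Y2 // mulr_ge0.
  + by rewrite /E /=; apply: le_trans (nrB _ _) _; rewrite mulrDl mul1r lerD2r.
  rewrite ler_wpM2r //; rewrite (_ : 24 * _ = 48 * (C + 1) * C ^+ 2); last by ring.
  by rewrite [C ^+ 3]exprS mulrA ler_wpM2r // (_ : 96 * C = 48 * (C + C)) ?ler_wpM2l ?lerD2l //; ring.
Qed.

End RittBounds.

(** * Sectorial operators and powers of their resolvents *)

Section Contraction.
Context {R : realType} {V : normedModType R[i]}.

Lemma geometric_cauchy (u : nat -> V) (a : R) : 0 <= a ->
  (forall n, nr (u n.+1 - u n) <= a / 2 ^+ n) -> seq_cauchy u.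
Proof.
move=> a0 h.
have hd n m : nr (u (n + m)%N - u n) <= 2 * a / 2 ^+ n - 2 * a / 2 ^+ (n + m).
  elim: m => [|m IH]; first by rewrite addn0 !subrr nr0.
  rewrite addnS; have := nr_triangle (u (n + m).+1) (u (n + m)%N) (u n).
  move: (h (n + m)%N); rewrite exprS invfM; lra.
have p0 n : 0 < 2 ^+ n :> R by rewrite exprn_gt0.
have hd' n m : (n <= m)%N -> nr (u m - u n) <= 2 * a / 2 ^+ n.
  move=> nm; rewrite -(subnKC nm); apply: le_trans (hd _ _) _.
  by rewrite gerBl divr_ge0 // ?mulr_ge0 // ltW.
move=> e e0; exists (Num.truncn (4 * a / e)).+1 => n m nN mN.
set N := (Num.truncn _).+1 in nN mN.
have hN : 4 * a / e < N%:R by exact: truncnS_gt.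
have N2 : N%:R <= 2 ^+ N :> R by rewrite -natrX ler_nat ltnW // ltn_expl.
have key : 4 * a / 2 ^+ N <= e.
  rewrite ler_pdivrMr //; rewrite ltr_pdivrMr // in hN; nra.
have := nr_triangle (u n) (u N) (u m); rewrite (nrBC (u N)).
have := hd' _ _ nN; have := hd' _ _ mN; lra.
Qed.

Lemma contraction_fixpoint (G : V -> V) :
  (forall u : nat -> V, seq_cauchy u -> exists x, seq_lim u x) ->
  (forall x y, nr (G x - G y) <= nr (x - y) / 2) -> exists x, G x = x.
Proof.
move=> Vc hG; pose u n := iter n G 0.
have hu n : nr (u n.+1 - u n) <= nr (u 1%N - u 0%N) / 2 ^+ n.
  elim: n => [|n IH]; first by rewrite expr0 divr1.
  apply: le_trans (hG _ _) _.
  by rewrite exprS invfM [2^-1 * _]mulrC mulrA ler_wpM2r.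
have [x hx] := Vc u (geometric_cauchy (nr_ge0 _) hu).
exists x; apply: (seq_lim_uniq _ (seq_limS hx)).
move=> e e0; have [N hN] := hx e e0; exists N => n /hN h.
by apply: le_trans (hG _ _) _; have := nr_ge0 (u n - x); lra.
Qed.

End Contraction.

Section Sector.
Context {R : realType}.
Implicit Types (k t : R) (z w : R[i]).

Lemma sector_gt0 k z : 0 < k -> sector k z -> 0 < ReC z.
Proof.
move=> k0; rewrite /sector /= => h.
by rewrite -(pmulr_rgt0 _ k0) (le_lt_trans _ h).
Qed.

Lemma sectorD k z w : sector k z -> sector k w -> sector k (z + w).
Proof.
case: z w => [a b] [c d]; rewrite /sector /= => h1 h2.
by apply: le_lt_trans (ler_normD _ _) _; rewrite mulrDr ltrD.
Qed.

Lemma sectorZ k t z : 0 < t -> sector k z -> sector k (t%:C * z).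
Proof.
move=> t0; case: z => a b; rewrite /sector /= => h.
by rewrite !mul0r subr0 addr0 normrM gtr0_norm // mulrCA ltr_pM2l.
Qed.

Lemma sector_real k t : 0 < k -> 0 < t -> sector k t%:C.
Proof. by move=> k0 t0; rewrite /sector /= normr0 mulr_gt0. Qed.

Lemma sectorW k k' z : 0 < k -> k <= k' -> sector k z -> sector k' z.
Proof.
move=> k0 kk h; have r0 := sector_gt0 k0 h; move: h; rewrite /sector /=.
by move=> h; apply: lt_le_trans h _; rewrite ler_wpM2r // ltW.
Qed.

End Sector.

Section SectorialOperator.
Context {R : realType} {K : normedModType R[i]}.
Hypothesis Kc : forall u : nat -> K, seq_cauchy u -> exists x, seq_lim u x.
Variables (T : set (K * K)) (M : R).
Hypothesis T_lin : forall (c : R[i]) x x' y y',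
  T (x, y) -> T (x', y') -> T (c *: x + x', c *: y + y').
Hypothesis M0 : 0 <= M.
Hypothesis T_onto : forall z : R[i], 0 < ReC z -> forall y,
  exists x x', T (x, x') /\ z *: x - x' = y.
Hypothesis T_est : forall z : R[i], 0 < ReC z -> forall x x', T (x, x') ->
  cm z * nr x <= M * nr (z *: x - x').

Let k0 : R := (2 * (M + 1))^-1.

Let T_sub x x' y y' : T (x, y) -> T (x', y') -> T (x - x', y - y').
Proof.
by move=> h h'; have := T_lin (-1) h' h; rewrite !scaleN1r !(addrC (- _)).
Qed.

Let T_estR (z : R[i]) (a : R) x x' : 0 < ReC z -> 0 < a -> T (x, x') ->
  cm z * nr x <= M * nr (z *: x - a%:C *: x').
Proof.
move=> z0 a0 h.
have aC : a%:C != 0 :> R[i] by rewrite eq_complex /= eqxx andbT gt_eqF.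
have za : 0 < ReC ((a^-1)%:C * z).
  by case: z z0 => u v /= u0; rewrite mul0r subr0 mulr_gt0 ?invr_gt0.
have := T_est za h; rewrite cmM cmR gtr0_norm ?invr_gt0 //.
have -> : z *: x - a%:C *: x' = a%:C *: (((a^-1)%:C * z) *: x - x').
  by rewrite scalerBr scalerA mulrA fmorphV mulfV // mul1r.
rewrite nrZ cmR gtr0_norm // => h1.
rewrite -mulrA mulrC ler_pdivrMr // in h1.
by apply: le_trans h1 _; rewrite [a * _]mulrC mulrA.
Qed.

(* Neumann series around the positive real direction: for z = a + i b with
   |b| (M + 1) <= a / 2, z T is a small perturbation of a T. *)
Lemma sector_est (z w : R[i]) x x' : sector k0 z -> 0 < ReC w -> T (x, x') ->
  cm w * nr x <= 2 * M * nr (w *: x - z *: x').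
Proof.
have hM := M0; have k00 : 0 < k0 by rewrite invr_gt0; lra.
move=> zk w0 h; have a0 := sector_gt0 k00 zk; move: zk a0.
case: z => a b; rewrite /sector /= => hb a0.
have h1 := T_estR w0 a0 h.
have hb' : `|b| * (M + 1) <= a / 2.
  rewrite -ler_pdivlMr; last by lra.
  apply/ltW; apply: lt_le_trans hb _; rewrite /k0 invfM.
  by rewrite mulrC mulrA.
set g := w *: x - a%:C *: x' in h1 *.
have -> : w *: x - (a +i* b) *: x' = g - ('i * b%:C) *: x'.
  by rewrite /g [a +i* b]complexE /=; vring.
have hx' : a * nr x' <= (M + 1) * nr g.
  have -> : a * nr x' = nr (a%:C *: x') by rewrite nrZ cmR gtr0_norm.
  have -> : a%:C *: x' = w *: x - g by rewrite /g; vring.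
  by apply: le_trans (nrB _ _) _; rewrite nrZ; lra.
have hp : nr (('i * b%:C) *: x') <= nr g / 2.
  rewrite nrZ cmM cmR.
  have -> : cm ('i : R[i]) = 1.
    by rewrite /cm normc_def /= expr0n /= add0r expr1n sqrtr1.
  rewrite mul1r -(ler_pM2l a0).
  have := nr_ge0 x'; have := nr_ge0 g; have := normr_ge0 b; nra.
have := nr_triangle g (('i * b%:C) *: x') 0; rewrite !subr0 => h2.
by apply: le_trans h1 _; nra.
Qed.

(** For z = a + i b the equation is equivalent to g = y + i b T (w - a T)^-1 g, and |b| (M + 1) <=
    a/2 makes the right-hand side a contraction with ratio 1/2. *)
Lemma sector_onto (z w : R[i]) y : sector k0 z -> 0 < ReC w ->
  exists x x', T (x, x') /\ w *: x - z *: x' = y.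
Proof.
have hM := M0; have k00 : 0 < k0 by rewrite invr_gt0; lra.
move=> zk w0; have a0 := sector_gt0 k00 zk; move: zk a0.
case: z => a b; rewrite /sector /= => hb a0.
have hb' : `|b| * (M + 1) <= a / 2.
  rewrite -ler_pdivlMr; last by lra.
  apply/ltW; apply: lt_le_trans hb _; rewrite /k0 invfM.
  by rewrite mulrC mulrA.
have hsol g : exists p : K * K, T p /\ w *: p.1 - a%:C *: p.2 = g.
  have wa : 0 < ReC ((a^-1)%:C * w).
    by case: w w0 => u v /= u0; rewrite mul0r subr0 mulr_gt0 ?invr_gt0.
  have [x [x' [h hx]]] := T_onto wa ((a^-1)%:C *: g); exists (x, x').
  split => //=.
  have -> : g = a%:C *: ((a^-1)%:C *: g).
    by rewrite scalerA -rmorphM /= mulfV ?gt_eqF // scale1r.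
  by rewrite -hx scalerBr !scalerA mulrA -rmorphM /= mulfV ?gt_eqF // mul1r.
have [B hB] := choice hsol.
have hBB g g' : a * nr ((B g).2 - (B g').2) <= (M + 1) * nr (g - g').
  have [h1 e1] := hB g; have [h2 e2] := hB g'.
  move: (B g) (B g') h1 e1 h2 e2 => [x x'] [v v'] /= h1 e1 h2 e2.
  have h := T_estR w0 a0 (T_sub h1 h2).
  have -> : a * nr (x' - v') = nr (a%:C *: (x' - v')).
    by rewrite nrZ cmR gtr0_norm.
  have eg : w *: (x - v) - a%:C *: (x' - v') = g - g'.
    by rewrite -e1 -e2; vring.
  rewrite eg in h.
  have -> : a%:C *: (x' - v') = w *: (x - v) - (g - g') by rewrite -eg; vring.
  by apply: le_trans (nrB _ _) _; rewrite nrZ; lra.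
have [|g hg] := @contraction_fixpoint _ _ (fun g => y + ('i * b%:C) *: (B g).2) Kc.
  move=> g g'; rewrite (_ : _ - _ = ('i * b%:C) *: ((B g).2 - (B g').2)); last by vring.
  rewrite nrZ cmM cmR.
  have -> : cm ('i : R[i]) = 1.
    by rewrite /cm normc_def /= expr0n /= add0r expr1n sqrtr1.
  rewrite mul1r -(ler_pM2l a0).
  have := hBB g g'; have := nr_ge0 ((B g).2 - (B g').2).
  have := nr_ge0 (g - g'); have := normr_ge0 b; nra.
have [h1 e1] := hB g; exists (B g).1, (B g).2; split; first by case: (B g) h1.
rewrite [a +i* b]complexE /=.
by rewrite -[y](addrK (('i * b%:C) *: (B g).2)) hg -[X in _ = X - _]e1; vring.
Qed.

(** [V z] is (1 - z T)^-1, the implicit Euler step of length z, whose powers will approximate the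
    semigroup. *)
Lemma sector_resolvent : exists V : R[i] -> {linear K -> K},
  (forall z y, sector k0 z -> exists y', T (V z y, y') /\ V z y - z *: y' = y) /\
  (forall z x x', sector k0 z -> T (x, x') -> V z (x - z *: x') = x).
Proof.
have uniq z x x' : sector k0 z -> T (x, x') -> x - z *: x' = 0 -> x = 0.
  move=> zk h e; have := @sector_est z 1 x x' zk ltac:(exact: ltr01) h.
  rewrite scale1r e nr0 mulr0 cm1 mul1r => h0.
  by apply: nr_eq0; apply/eqP; rewrite eq_le h0 nr_ge0.
suff H z : exists f : {linear K -> K}, sector k0 z ->
    (forall y, exists y', T (f y, y') /\ f y - z *: y' = y) /\
    (forall x x', T (x, x') -> f (x - z *: x') = x).
  have [V hV] := choice H; exists V; split.
    by move=> z y zk; have [h _] := hV z zk.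
  by move=> z x x' zk; have [_ h] := hV z zk; exact: h.
(* Outside the sector the zero map serves as default value. *)
have [zk|zk] := pselect (sector k0 z); last by exists \0.
have hsol y : exists p : K * K, T p /\ p.1 - z *: p.2 = y.
  have [x [x' [h e]]] := @sector_onto z 1 y zk ltac:(exact: ltr01).
  by exists (x, x'); rewrite -e scale1r.
have [B hB] := choice hsol.
have BE x x' : T (x, x') -> (B (x - z *: x')).1 = x.
  move=> h; have [h1 e1] := hB (x - z *: x').
  move: (B _) h1 e1 => [v v'] /= h1 e1.
  apply/eqP; rewrite -subr_eq0; apply/eqP.
  apply: (uniq z _ _ zk (T_sub h1 h)).
  have -> : (v - x) - z *: (v' - x') = (v - z *: v') - (x - z *: x') by vring.
  by rewrite e1 subrr.
pose f y := (B y).1.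
have f_lin : linear f.
  move=> c u v; have [h1 e1] := hB u; have [h2 e2] := hB v.
  rewrite /f; move: (B u) (B v) h1 e1 h2 e2 => [x x'] [y y'] /= h1 e1 h2 e2.
  rewrite -(BE _ _ (T_lin c h1 h2)); congr (B _).1.
  by rewrite -e1 -e2; vring.
pose fL := HB.pack_for {linear K -> K} f (GRing.isLinear.Build _ _ _ _ f f_lin).
exists fL => _; split => [y|x x' h]; last exact: BE.
by have [h e] := hB y; exists (B y).2; split => //; rewrite /= /f; case: (B y) h.
Qed.

(** For V = (1 - z T)^-1 one has (1 - w V)^-1 = 1 + w (1 - w - z T)^-1. As |w| < 1 implies Re (1 -
    w) > 0, the sectorial estimate bounds this by (2 M + 2)/|1 - w|, the first 2 from the estimate
    in the sector and the second from |1 - w| <= 2. *)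
Lemma sector_power_bound (V : R[i] -> {linear K -> K}) :
  (forall z x x', sector k0 z -> T (x, x') -> V z (x - z *: x') = x) ->
  forall z n x, sector k0 z ->
  nr (iter n (V z) x) <= 96 * (2 * M + 2) ^+ 3 * nr x /\
  n.+1%:R * nr (V z (iter n (V z) x) - iter n (V z) x) <=
    96 * (2 * M + 2) ^+ 3 * nr x.
Proof.
move=> VK z n x zk; have hM := M0.
have Re1B (w : R[i]) : cm w < 1 -> 0 < ReC (1 - w).
  move=> w1; have := ler_Re_cm w; rewrite ler_norml => /andP[_].
  by rewrite raddfB /=; lra.
have hsol (p : R[i] * K) : exists q : K * K, cm p.1 < 1 ->
    T q /\ (1 - p.1) *: q.1 - z *: q.2 = p.2.
  have [w1|w1] := pselect (cm p.1 < 1); last by exists 0.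
  have [q [q' [h e]]] := sector_onto p.2 zk (Re1B _ w1).
  by exists (q, q').
have [B hB] := choice hsol.
have VB (w : R[i]) y : cm w < 1 ->
    V z (y + w *: (B (w, y)).1) = (B (w, y)).1.
  move=> w1; have [h e] := hB (w, y) w1.
  move: (B (w, y)) h e => [q q'] /= h e; rewrite -[RHS](VK z q q' zk h) -e.
  by congr (V z _); vring.
have VB0 y : V z y = (B (0, y)).1.
  have := @VB 0 y; rewrite cm0 scale0r addr0; apply; exact: ltr01.
have Best (w : R[i]) y : cm w < 1 ->
    cm (1 - w) * nr (B (w, y)).1 <= 2 * M * nr y.
  move=> w1; have [h e] := hB (w, y) w1.
  move: (B (w, y)) h e => [q q'] /= h e.
  by rewrite -e; apply: sector_est zk (Re1B _ w1) h.
apply: (@ritt_power_bound _ _ (V z) (fun w y => y + w *: (B (w, y)).1)).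
- by lra.
- move=> y; rewrite VB0; have := @Best 0 y; rewrite cm0 => /(_ ltr01).
  by rewrite subr0 cm1 mul1r; have := nr_ge0 y; nra.
- by move=> w w1 y; rewrite VB.
move=> w w1 y; have h := Best w y w1.
have d0 : 0 < cm (1 - w) by apply: lt_le_trans (ler_Re_cm _); rewrite normr_gt0 gt_eqF ?Re1B.
have d2 : cm (1 - w) <= 2 by have := cmB 1 w; rewrite cm1; lra.
rewrite mulrAC ler_pdivlMr //.
have := nrD y (w *: (B (w, y)).1); rewrite nrZ.
have := nr_ge0 y; have := nr_ge0 (B (w, y)).1; have := cm_ge0 w.
set b := nr (B _).1 in h *; set a := nr y in h *; set s := nr (_ + _).
move: (cm (1 - w)) (cm w) w1 h d0 d2 => d c c1 h d0 d2 c0 b0 a0 hs.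
apply: (@le_trans _ _ ((a + c * b) * d)); first by rewrite ler_wpM2r // ltW.
have : a * d <= a * 2 by rewrite ler_wpM2l.
have : c * (d * b) <= d * b by rewrite ler_piMl ?mulr_ge0 // ltW.
by nra.
Qed.

End SectorialOperator.

(** * The exponential formula and the semigroup it defines *)

Section Telescope.
Context {R : realType} {K : normedModType R[i]}.
Implicit Types (f g : {linear K -> K}).

Lemma iter_telescope f (g : K -> K) n x : iter n f x - iter n g x =
  \sum_(k < n) iter k f (f (iter (n.-1 - k) g x) - g (iter (n.-1 - k) g x)).
Proof.
elim: n => [|n IH]; first by rewrite big_ord0 subrr.
rewrite big_ord_recl /= subn0 -[LHS](subrKA (f (iter n g x))) -linearB IH addrC.
congr (_ + _); rewrite linear_sum; apply: eq_bigr => k _ /=.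
by rewrite /bump /= subnDA subn1.
Qed.

Lemma iter_telescope_le f (g : K -> K) n x (b : R) :
  (forall k m, (k + m).+1 = n ->
    nr (iter k f (f (iter m g x) - g (iter m g x))) <= b) ->
  nr (iter n f x - iter n g x) <= n%:R * b.
Proof.
move=> h; rewrite iter_telescope; apply: le_trans (nr_sum _ _ _) _.
rewrite mulr_natl -[X in _ *+ X]card_ord -sumr_const; apply: ler_sum => k _.
apply: h; case: n k => [[]//|n] k /=.
by rewrite subnKC // -ltnS.
Qed.

Lemma iter_linB f n x y : iter n f (x - y) = iter n f x - iter n f y.
Proof. by elim: n => //= n ->; rewrite linearB. Qed.

Lemma iter_compE f g n x : (forall y, f (g y) = g (f y)) ->
  iter n (f \o g) x = iter n f (iter n g x).
Proof.
move=> fg; elim: n => //= n ->; congr (f _).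
by apply: iter_comm => y; rewrite fg.
Qed.

End Telescope.

Section SemigroupConstruction.
Context {R : realType} {K : normedModType R[i]}.
Hypothesis Kc : forall u : nat -> K, seq_cauchy u -> exists x, seq_lim u x.
Variables (T : set (K * K)) (k C : R) (V : R[i] -> {linear K -> K}).
Hypothesis T_lin : forall (c : R[i]) x x' y y',
  T (x, y) -> T (x', y') -> T (c *: x + x', c *: y + y').
Hypothesis T_dense : forall x (e : R), 0 < e ->
  exists x' y, T (x', y) /\ nr (x - x') <= e.
Hypothesis k_gt0 : 0 < k.
Hypothesis C_ge0 : 0 <= C.
Hypothesis VT : forall z y, sector k z ->
  exists y', T (V z y, y') /\ V z y - z *: y' = y.
Hypothesis VK : forall z x x', sector k z -> T (x, x') -> V z (x - z *: x') = x.
Hypothesis V_bound : forall z n x, sector k z -> nr (iter n (V z) x) <= C * nr x.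
Hypothesis V_smooth : forall z n x, sector k z ->
  n.+1%:R * nr (V z (iter n (V z) x) - iter n (V z) x) <= C * nr x.

Implicit Types (a b z w : R[i]) (x y : K).

Let sector_neq0 a : sector k a -> a != 0.
Proof. by move/(sector_gt0 k_gt0); apply: contraTneq => ->; rewrite ltxx. Qed.

Let sector1 : sector k 1. Proof. exact: (sector_real k_gt0 ltr01). Qed.

Let VE a x y : sector k a -> T (x, y) -> V a x = x + a *: V a y.
Proof.
move=> ak h; have := VK ak h; rewrite linearB linearZ /= => {2}<-.
by vring.
Qed.

Let TV a x y : sector k a -> T (x, y) -> T (V a x, V a y).
Proof.
move=> ak h; have [y' [h' e]] := VT x ak; suff <- : y' = V a y by [].
apply: (scalerI (sector_neq0 ak)).
by move: e; rewrite (VE ak h) => /eqP; rewrite subr_eq => /eqP /addrI.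
Qed.

Let V_comm a b x : sector k a -> sector k b -> V a (V b x) = V b (V a x).
Proof.
move=> ak bk; have [p' [h e]] := VT x bk.
by rewrite -[in RHS]e linearB linearZ /= (VK bk (TV ak h)).
Qed.

Let iterTV a n x y : sector k a -> T (x, y) ->
  T (iter n (V a) x, iter n (V a) y).
Proof. by move=> ak h; elim: n => //= n IH; apply: TV. Qed.

Let V_diff a b x y : sector k a -> sector k b -> T (x, y) ->
  V a x - V b x = (a - b) *: V a (V b y).
Proof.
move=> ak bk h; have h1 := VE ak (TV bk h); have h2 := VE bk (TV ak h).
rewrite -(V_comm x ak bk) h1 -(V_comm y ak bk) in h2.
rewrite -[V a x](addrK (b *: V a (V b y))) -h2; vring.
Qed.

(** (1 - a T)(1 - b T) exceeds 1 - (a + b) T by a b T^2. This error, quadratic in the step, serves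
    both for the convergence, with a = b, and for the semigroup law. *)
Let V_trotter a b x y y2 : sector k a -> sector k b -> T (x, y) -> T (y, y2) ->
  V a (V b x) - V (a + b) x = - (a * b) *: V a (V b (V (a + b) y2)).
Proof.
move=> ak bk h h2; have ck := sectorD ak bk.
have hu := TV ck h; have hu' := TV ck h2; have := VE ck h.
move: (V (a + b) x) (V (a + b) y) (V (a + b) y2) hu hu' => u u' u'' hu hu' e.
have -> : x = (u - b *: u') - a *: u'.
  by rewrite -[x](addrK ((a + b) *: u')) -e; vring.
have -> : V b (u - b *: u' - a *: u') = u - a *: V b u'.
  by rewrite linearB (VK bk hu) linearZ.
rewrite (VE bk hu') (_ : u - _ = (u - a *: u') - (a * b) *: V b u''); last by vring.
by rewrite linearB (VK ak hu) linearZ /=; vring.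
Qed.

Let V_iter_comm p q a b x : sector k a -> sector k b ->
  iter p (V a) (iter q (V b) x) = iter q (V b) (iter p (V a) x).
Proof.
move=> ak bk; apply/esym/iter_comm => y; apply/esym/iter_comm => v.
exact: V_comm.
Qed.

Let V_bound1 z x : sector k z -> nr (V z x) <= C * nr x.
Proof. exact: (@V_bound z 1). Qed.

Let C2 a b n m x : sector k a -> sector k b ->
  nr (iter n (V a) (iter m (V b) x)) <= C ^+ 2 * nr x.
Proof.
move=> ak bk; apply: le_trans (V_bound _ _ ak) _.
by rewrite expr2 -mulrA ler_wpM2l // V_bound.
Qed.

Lemma resolvent_pow_diff a b n x y : sector k a -> sector k b -> T (x, y) ->
  nr (iter n (V a) x - iter n (V b) x) <= n%:R * (cm (a - b) * (C ^+ 2 * nr y)).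
Proof.
move=> ak bk h; apply: iter_telescope_le => i m _.
rewrite (V_diff ak bk (iterTV m bk h)) iter_linZ nrZ ler_wpM2l ?cm_ge0 //.
by rewrite -iterSr -iterS C2.
Qed.

Lemma resolvent_pow_sub a n x y : sector k a -> T (x, y) ->
  nr (iter n (V a) x - x) <= n%:R * (cm a * (C * nr y)).
Proof.
move=> ak h; rewrite -[X in _ - X](_ : iter n idfun x = x); last by elim: n => //= n ->.
apply: iter_telescope_le => i m _.
have -> : iter m idfun x = x by elim: m => //= m ->.
rewrite (VE ak h) addrC addKr iter_linZ nrZ ler_wpM2l ?cm_ge0 //.
by rewrite -iterSr V_bound.
Qed.

Lemma resolvent_pow_trotter a b n x y y2 : sector k a -> sector k b ->
  T (x, y) -> T (y, y2) ->
  nr (iter n (V a \o V b) x - iter n (V (a + b)) x) <=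
    n%:R * (cm a * cm b * (C ^+ 3 * nr y2)).
Proof.
move=> ak bk h h2; have ck := sectorD ak bk.
have ab u : V a (V b u) = V b (V a u) by exact: V_comm.
apply: iter_telescope_le => i m _.
rewrite /= (V_trotter ak bk (iterTV m ck h) (iterTV m ck h2)) iter_linZ nrZ.
rewrite cmN cmM ler_wpM2l ?mulr_ge0 ?cm_ge0 //.
rewrite -iterS -[V a _]/((V a \o V b) _) -iterSr iter_compE //.
apply: le_trans (C2 _ _ _ ak bk) _; rewrite [C ^+ 3]exprSr -mulrA ler_wpM2l ?exprn_ge0 //.
exact: V_bound.
Qed.

(** First-order Taylor formula for the n-th power of the resolvent. In each telescoping term,
    replacing powers of [V a] costs n |a - b|, and a surplus factor [V b] costs |b|. With steps of
    order 1/n the latter disappears in the limit. *)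
Lemma resolvent_pow_derive a b n x y y2 : sector k a -> sector k b ->
  T (x, y) -> T (y, y2) ->
  nr (iter n (V a) x - iter n (V b) x - (n%:R * (a - b)) *: iter n (V b) y) <=
    n%:R * (cm (a - b) * (C ^+ 3 * (cm b + n%:R * cm (a - b)) * nr y2)).
Proof.
move=> ak bk h h2; rewrite iter_telescope.
have -> : (n%:R * (a - b)) *: iter n (V b) y =
    \sum_(i < n) (a - b) *: iter n (V b) y.
  by rewrite sumr_const card_ord -[RHS]scaler_nat scalerA.
rewrite -sumrB; apply: le_trans (nr_sum _ _ _) _.
rewrite mulr_natl -[X in _ *+ X]card_ord -sumr_const; apply: ler_sum => i _.
have hi : (n = i.+1 + (n.-1 - i))%N.
  by case: n i => [[]//|n] i /=; rewrite addSn subnKC // -ltnS.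
move: (n.-1 - i)%N hi => m; move: (nat_of_ord i) => {}i hi.
rewrite (V_diff ak bk (iterTV m bk h)) iter_linZ -scalerBr nrZ ler_wpM2l ?cm_ge0 //.
have -> : iter n (V b) y = iter m (V b) (iter i.+1 (V b) y) by rewrite hi addnC iterD.
have -> : iter i (V a) (V a (V b (iter m (V b) y))) =
    iter m (V b) (iter i.+1 (V a) (V b y)).
  by rewrite -iterSr -iterS (iterSr m) V_iter_comm.
rewrite -iter_linB; apply: le_trans (V_bound _ _ bk) _.
have in1 : i.+1%:R <= n%:R :> R by rewrite ler_nat hi leq_addr.
rewrite (_ : C ^+ 3 * _ * _ = C * (C ^+ 2 * cm b * nr y2 +
  n%:R * (cm (a - b) * (C ^+ 2 * nr y2)))); last by ring.
rewrite ler_wpM2l //; apply: le_trans (nr_triangle _ (iter i.+1 (V a) y) _) _.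
apply: lerD; last first.
  apply: le_trans (resolvent_pow_diff _ ak bk h2) _.
  by rewrite ler_wpM2r // !mulr_ge0 ?cm_ge0 ?exprn_ge0 ?nr_ge0.
rewrite -iter_linB; apply: le_trans (V_bound _ _ ak) _.
rewrite (VE bk h2) addrC addKr nrZ expr2 -!mulrA ler_wpM2l //.
by rewrite mulrCA ler_wpM2l ?cm_ge0 // V_bound1.
Qed.

(** [y] need not lie in the domain of [T], hence the auxiliary [y1], later taken close to [y]. *)
Lemma resolvent_pow_generator a n x y y1 y1' : sector k a -> T (x, y) ->
  T (y1, y1') ->
  nr (iter n (V a) x - x - (n%:R * a) *: y) <=
    n%:R * (cm a * ((C + 1) * nr (y - y1) + n%:R * (cm a * (C * nr y1')))).
Proof.
move=> ak h h1.
have e m (u : K) : iter m idfun u = u by elim: m => //= m ->.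
rewrite -{2}(e n x) iter_telescope.
have -> : (n%:R * a) *: y = \sum_(i < n) a *: y.
  by rewrite sumr_const card_ord -[RHS]scaler_nat scalerA.
rewrite -sumrB; apply: le_trans (nr_sum _ _ _) _.
rewrite mulr_natl -[X in _ *+ X]card_ord -sumr_const; apply: ler_sum => i _.
rewrite !e /= (VE ak h) addrC [x + _]addrC addrK iter_linZ -iterSr addrC -scalerBr.
rewrite nrZ ler_wpM2l ?cm_ge0 //.
have -> : iter i.+1 (V a) y - y = iter i.+1 (V a) (y - y1) - (y - y1) +
    (iter i.+1 (V a) y1 - y1).
  by rewrite iter_linB; vring.
apply: le_trans (nrD _ _) (lerD _ _).
  apply: le_trans (nrB _ _) _; rewrite mulrDl mul1r lerD2r.
  exact: V_bound.
apply: le_trans (resolvent_pow_sub _ ak h1) _.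
by rewrite ler_wpM2r ?ler_nat // !mulr_ge0 ?cm_ge0 ?nr_ge0.
Qed.

Definition dyadic_step j : R := (2 ^+ j)^-1.
Local Notation h := dyadic_step.

Let h_gt0 j : 0 < h j. Proof. by rewrite invr_gt0 exprn_gt0. Qed.

Let two_h j : (2 ^ j)%:R * h j = 1 :> R.
Proof. by rewrite natrX mulfV // expf_neq0. Qed.

Let hk j z : sector k z -> sector k ((h j)%:C * z).
Proof. exact: sectorZ. Qed.

Let cm_h j z : (2 ^ j)%:R * cm ((h j)%:C * z) = cm z.
Proof. by rewrite cmM cmR gtr0_norm // mulrA two_h mul1r. Qed.

Let two_hC j z : (2 ^ j)%:R * ((h j)%:C * z) = z.
Proof.
rewrite mulrA -(rmorph_nat (real_complex R)) -rmorphM /=.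
by rewrite two_h mul1r.
Qed.

Let hle j : h j <= j.+1%:R^-1.
Proof.
by rewrite lef_pV2 ?posrE ?exprn_gt0 // -natrX ler_nat ltn_expl.
Qed.

(* The exponential formula, along dyadic step sizes. *)
Definition euler_power j z x := iter (2 ^ j) (V ((h j)%:C * z)) x.
Local Notation F := euler_power.

Let D2 x := exists y y2, T (x, y) /\ T (y, y2).

(** [V 1] is bounded and maps the domain of [T] into that of T^2. So x1 = V 1 (x1 - T x1) is
    approximated by V 1 u, with u in the domain close to x1 - T x1. *)
Let D2_dense x (e : R) : 0 < e -> exists2 x', D2 x' & nr (x - x') <= e.
Proof.
move=> e0; have hC := C_ge0.
have [x1 [y1 [h1 d1]]] := T_dense x (e := e / 2) ltac:(lra).
have e1 : 0 < e / 2 / (C + 1) by apply: divr_gt0; lra.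
have [u [v [hu du]]] := T_dense (x1 - y1) e1.
have x1E : V 1 (x1 - y1) = x1 by have := VK sector1 h1; rewrite scale1r.
exists (V 1 u).
  have [w [hw ew]] := VT u sector1; rewrite scale1r in ew.
  have ew' : w = V 1 u - u by rewrite -{2}ew; vring.
  exists w, (V 1 v - v); split; first exact: hw.
  rewrite ew'.
  have := T_lin (-1) hu (TV sector1 hu); rewrite !scaleN1r.
  by rewrite addrC [- v + _]addrC.
apply: le_trans (nr_triangle _ x1 _) _.
have : nr (x1 - V 1 u) <= e / 2; last by lra.
rewrite -{1}x1E -linearB; apply: le_trans (V_bound1 _ sector1) _.
rewrite ler_pdivlMr in du; last by lra.
by have := nr_ge0 (x1 - y1 - u); nra.
Qed.

Let F_linB j z x y : F j z (x - y) = F j z x - F j z y.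
Proof. exact: iter_linB. Qed.

Let F_bound j z x : sector k z -> nr (F j z x) <= C * nr x.
Proof. by move=> zk; apply: V_bound; apply: hk. Qed.

Let lim0_dense (G : nat -> K -> K) (B : R) : 0 <= B ->
  (forall j x y, G j (x - y) = G j x - G j y) ->
  (forall j x, nr (G j x) <= B * nr x) ->
  (forall x, D2 x -> seq_lim (fun j => G j x) 0) ->
  forall x, seq_lim (fun j => G j x) 0.
Proof.
move=> B0 GB Gb GD x e e0.
have [x' hx' dx] := D2_dense x (e := e / 2 / (B + 1)) ltac:(by apply: divr_gt0; lra).
have [N hN] := GD x' hx' (e / 2) ltac:(lra).
exists N => n /hN; rewrite !subr0 => h1.
rewrite ler_pdivlMr in dx; last by lra.
have := nr_triangle (G n x) (G n x') 0; rewrite !subr0 -GB.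
by have := Gb n (x - x'); have := nr_ge0 (x - x'); nra.
Qed.

(** Halving the step h replaces each [V] at h z by the square of [V] at h z / 2. On D(T^2) the 2^j
    replacements cost O(h^2) each, in total O(2^-j), which is summable; density and the uniform
    bound do the rest. *)
Let F_cauchy z x : sector k z -> seq_cauchy (fun j => F j z x).
Proof.
move=> zk.
have hD u : D2 u -> seq_cauchy (fun j => F j z u).
  move=> [y [y2 [h1 h2]]].
  apply: (@geometric_cauchy _ _ _ (cm z ^+ 2 * (C ^+ 3 * nr y2))).
    by rewrite !mulr_ge0 ?exprn_ge0 ?cm_ge0 ?nr_ge0.
  move=> j; have ak := hk j.+1 zk.
  have hh : h j.+1 = h j / 2 by rewrite /h exprS invfM mulrC.
  have a2 : (h j.+1)%:C * z + (h j.+1)%:C * z = (h j)%:C * z.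
    by rewrite -mulrDl -rmorphD /= hh; congr (_%:C * z); field.
  rewrite /F expnSr iterM.
  have -> : iter (2 ^ j) (iter 2 (V ((h j.+1)%:C * z))) u =
      iter (2 ^ j) (V ((h j.+1)%:C * z) \o V ((h j.+1)%:C * z)) u by [].
  rewrite -a2; apply: le_trans (resolvent_pow_trotter _ ak ak h1 h2) _.
  rewrite cmM cmR gtr0_norm // -/(h j) hh.
  have P0 : 0 <= cm z ^+ 2 * (C ^+ 3 * nr y2).
    by rewrite !mulr_ge0 ?exprn_ge0 ?cm_ge0 ?nr_ge0.
  rewrite (_ : _%:R * _ = (2 ^ j)%:R * h j * (cm z ^+ 2 * (C ^+ 3 * nr y2) * h j / 4)).
    by rewrite two_h mul1r ler_pdivrMr // ler_peMr ?ler1n // mulr_ge0 // ltW.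
  by field.
move=> e e0; have hC := C_ge0.
have [x' hx' dx] := D2_dense x (e := e / 4 / (C + 1)) ltac:(by apply: divr_gt0; lra).
have [N hN] := hD x' hx' (e / 2) ltac:(lra).
exists N => n m nN mN; have h1 := hN n m nN mN.
rewrite ler_pdivlMr in dx; last by lra.
have := nr_triangle (F n z x) (F n z x') (F m z x).
have := nr_triangle (F n z x') (F m z x') (F m z x).
rewrite [nr (F m z x' - _)]nrBC -!F_linB.
have := F_bound n (x - x') zk; have := F_bound m (x - x') zk.
by have := nr_ge0 (x - x'); nra.
Qed.



Definition sg z x : K := xget 0 [set l | seq_lim (fun j => F j z x) l].

Let sg_lim z x : sector k z -> seq_lim (fun j => F j z x) (sg z x).
Proof.
move=> zk; have [l hl] := Kc (F_cauchy x zk).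
exact: (xgetPex 0 (ex_intro (fun l => seq_lim (fun j => F j z x) l) l hl)).
Qed.

Let seq_lim_bounded (f : nat -> K -> K) (b : R) (u : nat -> K) x l : 0 <= b ->
  (forall j y y', f j (y - y') = f j y - f j y') ->
  (forall j y, nr (f j y) <= b * nr y) ->
  seq_lim u x -> seq_lim (f^~ x) l -> seq_lim (fun j => f j (u j)) l.
Proof.
move=> b0 fB fb ux fl; apply: (seq_lim_near fl) => e e0.
have [N hN] := ux (e / (b + 1)) ltac:(apply: divr_gt0; lra).
exists N => n /hN; rewrite ler_pdivlMr; last by lra.
rewrite subr0 -fB; have := fb n (u n - x); have := nr_ge0 (u n - x); nra.
Qed.

Lemma sg_lin z c x y : sector k z -> sg z (c *: x + y) = c *: sg z x + sg z y.
Proof.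
move=> zk; apply: (seq_lim_uniq (sg_lim _ zk)).
have := seq_limD (seq_limZ c (sg_lim x zk)) (sg_lim y zk).
by congr seq_lim; apply/funext => j; rewrite /euler_power iter_linD iter_linZ.
Qed.

Let sgB z x y : sector k z -> sg z (x - y) = sg z x - sg z y.
Proof.
by move=> zk; rewrite -scaleN1r addrC sg_lin // scaleN1r addrC.
Qed.

Lemma sg_bound z x : sector k z -> nr (sg z x) <= C * nr x.
Proof.
move=> zk; apply: (seq_lim_nr (sg_lim x zk)).
by exists 0%N => j _; apply: F_bound.
Qed.

Lemma sg_add z w x : sector k z -> sector k w -> sg (z + w) x = sg z (sg w x).
Proof.
move=> zk wk; have zwk := sectorD zk wk.
apply: (seq_lim_uniq (sg_lim _ zwk)).
have h1 : seq_lim (fun j => F j z (F j w x)) (sg z (sg w x)).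
  exact: (seq_lim_bounded C_ge0 (f := fun j => F j z)
    (fun j y y' => F_linB j z y y') (fun j y => F_bound j y zk)
    (sg_lim x wk) (sg_lim _ zk)).
apply: (seq_lim_near h1).
have C20 : 0 <= C ^+ 2 + C by rewrite addr_ge0 ?exprn_ge0.
apply: (lim0_dense (G := fun j x => F j (z + w) x - F j z (F j w x)) C20) =>
  [j u v|j u|u [y [y2 [hy hy2]]]].
- by rewrite !F_linB; vring.
- apply: le_trans (nrB _ _) _; rewrite addrC mulrDl lerD ?F_bound //.
  apply: le_trans (F_bound _ _ zk) _.
  by rewrite expr2 -mulrA ler_wpM2l // F_bound.
apply: (@seq_lim_le _ _ _ _ (cm z * cm w * (C ^+ 3 * nr y2)) 0).
  by rewrite !mulr_ge0 ?exprn_ge0 ?cm_ge0 ?nr_ge0.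
move=> j _; rewrite subr0 nrBC /euler_power mulrDr.
rewrite -iter_compE; last by move=> v; apply: V_comm; exact: hk.
apply: le_trans (resolvent_pow_trotter _ (hk j zk) (hk j wk) hy hy2) _.
have -> : (2 ^ j)%:R * (cm ((h j)%:C * z) * cm ((h j)%:C * w) * (C ^+ 3 * nr y2)) =
    (2 ^ j)%:R * cm ((h j)%:C * z) * cm w * (C ^+ 3 * nr y2) * h j.
  by rewrite [cm (_ * w)]cmM cmR gtr0_norm //; ring.
by rewrite cm_h ler_wpM2l // !mulr_ge0 ?exprn_ge0 ?cm_ge0 ?nr_ge0.
Qed.

Let sg_near z x y : sector k z -> T (x, y) -> nr (sg z x - x) <= cm z * (C * nr y).
Proof.
move=> zk hx; apply: (seq_lim_nr (seq_limB (sg_lim x zk) (seq_lim_cst x))).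
exists 0%N => j _; apply: le_trans (resolvent_pow_sub _ (hk j zk) hx) _.
by rewrite mulrA cm_h.
Qed.

Lemma sg_cont0 x (e : R) : 0 < e -> exists2 d : R, 0 < d &
  forall z, sector k z -> cm z <= d -> nr (sg z x - x) <= e.
Proof.
move=> e0; have hC := C_ge0.
have [x' [y [hx dx]]] := T_dense x (e := e / 2 / (C + 1)) ltac:(by apply: divr_gt0; lra).
have y0 := nr_ge0 y; have Cy : 0 <= C * nr y by exact: mulr_ge0.
exists (e / 2 / (C * nr y + 1)); first by apply: divr_gt0; lra.
move=> z zk; rewrite ler_pdivlMr; last by lra.
move=> zd; rewrite ler_pdivlMr in dx; last by lra.
have -> : sg z x - x = sg z (x - x') - (x - x') + (sg z x' - x').
  by rewrite sgB //; vring.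
have := nrD (sg z (x - x') - (x - x')) (sg z x' - x').
have := nrB (sg z (x - x')) (x - x').
have := sg_bound (x - x') zk; have := sg_near zk hx; have := cm_ge0 z.
by nra.
Qed.

(** [T] is 1 minus the inverse of the bounded, everywhere defined operator [V 1]. *)
Let T_closed (u v : nat -> K) x y : (forall j, T (u j, v j)) ->
  seq_lim u x -> seq_lim v y -> T (x, y).
Proof.
move=> huv ux vy.
have e1 : V 1 (x - y) = x.
  apply: (seq_lim_uniq _ ux).
  have h2 := seq_lim_bounded C_ge0 (f := fun=> V 1) (fun _ => linearB (V 1))
    (fun _ q => V_bound1 q sector1) (seq_limB ux vy) (seq_lim_cst _).
  move: h2; congr seq_lim; apply/funext => j.
  by have := VK sector1 (huv j); rewrite scale1r.
have [y' [h1 e2]] := VT (x - y) sector1.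
rewrite e1 scale1r in h1 e2; suff <- : y' = y by [].
by move: e2 => /addrI /oppr_inj.
Qed.

Let sg_T z x y : sector k z -> T (x, y) -> T (sg z x, sg z y).
Proof.
move=> zk hx; apply: (T_closed _ (sg_lim x zk) (sg_lim y zk)) => j.
by apply: iterTV => //; exact: hk.
Qed.

(** For V = [V a], V^(n + 1) x - V^n x = a V^(n + 1) T x. With n + 1 = 2^j and (n + 1) a = z the
    hypothesis [V_smooth] passes to the limit. *)
Let sg_smooth z x y : sector k z -> T (x, y) -> cm z * nr (sg z y) <= C * nr x.
Proof.
move=> zk hx; rewrite -nrZ.
apply: (seq_lim_nr (seq_limZ z (sg_lim y zk))); exists 0%N => j _.
have ak := hk j zk; rewrite /euler_power.
have [n hn] : exists n, (2 ^ j)%N = n.+1 by case: (2 ^ j)%N (expn_gt0 2 j) => // n; exists n.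
rewrite -{1}(two_hC j z) -scalerA nrZ cmn hn.
apply: le_trans (V_smooth n x ak); rewrite ler_wpM2l ?ler0n //.
move: ((h j)%:C * z) ak => a ak.
rewrite -[V a (iter n (V a) x)]iterS [iter n.+1 (V a) x]iterSr (VE ak hx).
by rewrite iter_linD iter_linZ -iterSr [X in _ <= nr (X - _)]addrC addrK.
Qed.

(** For x_j in the domain tending to x, the vectors T (sg z x_j) = sg z (T x_j) form a Cauchy
    sequence by [sg_smooth], and [T] is closed. *)
Lemma sg_dom z x : sector k z -> exists y, T (sg z x, y).
Proof.
move=> zk; have z0 : 0 < cm z by rewrite cm_gt0 sector_neq0.
have hsol j : exists p : K * K, T p /\ nr (x - p.1) <= 1 / j.+1%:R.
  have [x' [y [h1 h2]]] := T_dense x (e := 1 / j.+1%:R) ltac:(by apply: divr_gt0).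
  by exists (x', y).
have [p hp] := choice hsol.
have hT j : T ((p j).1, (p j).2) by have [h1 _] := hp j; case: (p j) h1.
have px : seq_lim (fun j => (p j).1) x.
  apply: (@seq_lim_le _ _ _ _ 1 0) => // j _.
  by have [_ h2] := hp j; rewrite nrBC.
have [l hl] : exists l, seq_lim (fun j => sg z (p j).2) l.
  apply: Kc => e e0; have hC := C_ge0.
  have [N hN] := seq_lim_cauchy px (e := e * cm z / (C + 1))
    ltac:(by apply: divr_gt0; [exact: mulr_gt0 | lra]).
  exists N => n m nN mN; have := hN n m nN mN.
  rewrite ler_pdivlMr; last by lra.
  have hTB : T ((p n).1 - (p m).1, (p n).2 - (p m).2).
    by have := T_lin (-1) (hT m) (hT n); rewrite !scaleN1r ![- _ + _]addrC.
  have := sg_smooth zk hTB; rewrite sgB // => h1 h2.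
  rewrite -(ler_pM2l z0) [cm z * e]mulrC.
  by have := nr_ge0 ((p n).1 - (p m).1); nra.
exists l; apply: (@T_closed (fun j => sg z (p j).1) _ _ _ _ _ hl) => [j|].
  exact: sg_T.
exact: (seq_lim_bounded C_ge0 (fun _ y y' => sgB y y' zk)
  (fun _ y => sg_bound y zk) px (seq_lim_cst _)).
Qed.

Let sg_half z x : sector k z -> sg z x = sg (2^-1%:C * z) (sg (2^-1%:C * z) x).
Proof.
move=> zk; have zk2 : sector k (2^-1%:C * z) by exact: sectorZ.
rewrite -sg_add // -mulrDl -rmorphD /= (_ : 2^-1 + 2^-1 = 1) ?mul1r //.
by field.
Qed.

Let sg_D2 z x : sector k z -> D2 (sg z x).
Proof.
move=> zk; have zk2 : sector k (2^-1%:C * z) by exact: sectorZ.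
have [y hy] := sg_dom x zk2; have [y2 hy2] := sg_dom y zk2.
by exists (sg (2^-1%:C * z) y), y2; rewrite sg_half //; split => //; exact: sg_T.
Qed.

Let sg_derive_D2 w d x y y2 : sector k w -> sector k (w + d) ->
  T (x, y) -> T (y, y2) ->
  nr (sg (w + d) x - sg w x - d *: sg w y) <= cm d * (C ^+ 3 * cm d * nr y2).
Proof.
move=> wk wdk hx hy; apply/ler_addgt0Pr => e e0.
apply: (seq_lim_nr (seq_limB (seq_limB (sg_lim x wdk) (sg_lim x wk))
  (seq_limZ d (sg_lim y wk)))).
pose Q := cm d * (C ^+ 3 * cm w * nr y2).
have Q0 : 0 <= Q by rewrite !mulr_ge0 ?exprn_ge0 ?cm_ge0 ?nr_ge0.
have [N hN] := archimedean_inv Q0 e0; exists N => j /hN hj.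
have hd : (h j)%:C * (w + d) - (h j)%:C * w = (h j)%:C * d by ring.
have := resolvent_pow_derive (2 ^ j) (hk j wdk) (hk j wk) hx hy.
rewrite hd two_hC mulrA cm_h => hh; apply: le_trans hh _.
rewrite cmM cmR gtr0_norm //.
have hQ : Q * h j <= e by apply: le_trans hj; rewrite ler_wpM2l.
have -> : cm d * (C ^+ 3 * (h j * cm w + cm d) * nr y2) =
  cm d * (C ^+ 3 * cm d * nr y2) + Q * h j by rewrite /Q; ring.
by rewrite lerD2l.
Qed.

(** Factoring sg z as the square of sg (z/2) puts the base vector sg (z/2) x into D(T^2), where the
    Taylor estimate is available; hence the condition that z/2 + d stay in the sector. *)
Lemma sg_derive z x : sector k z -> exists l, exists2 B : R, 0 <= B &
  forall d, sector k (2^-1%:C * z + d) ->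
    nr (sg (z + d) x - sg z x - d *: l) <= B * cm d ^+ 2.
Proof.
move=> zk; have wk : sector k (2^-1%:C * z) by exact: sectorZ.
have [y [y2 [hy hy2]]] := sg_D2 x wk.
exists (sg (2^-1%:C * z) y), (C ^+ 3 * nr y2).
  by rewrite mulr_ge0 ?exprn_ge0 ?nr_ge0.
move=> d dk; have hz : 2^-1%:C * z + 2^-1%:C * z = z.
  rewrite -mulrDl -rmorphD /= (_ : 2^-1 + 2^-1 = 1) ?mul1r //; by field.
have -> : sg (z + d) x = sg (2^-1%:C * z + d) (sg (2^-1%:C * z) x).
  rewrite -sg_add //; congr (sg _ x); by rewrite -{1}hz addrAC.
rewrite (sg_half x zk); apply: le_trans (sg_derive_D2 wk dk hy hy2) _.
by rewrite le_eqVlt; apply/orP; left; apply/eqP; ring.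
Qed.

Lemma sg_generator x y : T (x, y) -> forall e : R, 0 < e -> exists2 d : R, 0 < d &
  forall t : R, 0 < t <= d -> nr (sg t%:C x - x - t%:C *: y) <= e * t.
Proof.
move=> hx e e0; have hC := C_ge0.
have [y1 [y1' [hy1 dy]]] := T_dense y (e := e / 2 / (C + 1)) ltac:(by apply: divr_gt0; lra).
have y0 := nr_ge0 y1'; have Cy : 0 <= C * nr y1' by exact: mulr_ge0.
exists (e / 2 / (C * nr y1' + 1)); first by apply: divr_gt0; lra.
move=> t /andP[t0]; rewrite ler_pdivlMr; last by lra.
move=> td; rewrite ler_pdivlMr in dy; last by lra.
have tk := sector_real k_gt0 t0.
apply: (@le_trans _ _ (t * ((C + 1) * nr (y - y1) + t * (C * nr y1')))); last by nra.
apply: (seq_lim_nr (seq_limB (seq_limB (sg_lim x tk) (seq_lim_cst x))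
  (seq_lim_cst (t%:C *: y)))).
exists 0%N => j _.
have := resolvent_pow_generator (2 ^ j) (hk j tk) hx hy1.
by rewrite two_hC !(mulrA (2 ^ j)%:R) cm_h cmR gtr0_norm.
Qed.

(** [V 1] commutes with the semigroup, so differentiating sg t (V 1 x) at 0 in two ways gives T (V 1
    x) = V 1 y. Then x = V 1 (x - y) lies in the domain and T x = y. *)
Lemma sg_generator_sub x y :
  (forall e : R, 0 < e -> exists2 d : R, 0 < d & forall t : R, 0 < t <= d ->
     nr (sg t%:C x - x - t%:C *: y) <= e * t) -> T (x, y).
Proof.
move=> hxy; have hC := C_ge0; have [u' [hu eu]] := VT x sector1.
rewrite scale1r in eu.
have V_sg t : 0 < t -> V 1 (sg t%:C x) = sg t%:C (V 1 x).
  move=> t0; have tk := sector_real k_gt0 t0.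
  apply: (seq_lim_uniq _ (sg_lim _ tk)).
  have := seq_lim_bounded C_ge0 (f := fun=> V 1) (fun _ => linearB (V 1))
    (fun _ q => V_bound1 q sector1) (sg_lim x tk) (seq_lim_cst _).
  congr seq_lim; apply/funext => j; rewrite /euler_power.
  by apply: iter_comm => v; apply: V_comm => //; exact: hk.
have e1 : u' = V 1 y.
  apply/eqP; rewrite -subr_eq0; apply/eqP/nr_small_eq0 => e e0.
  have e20 : 0 < e / (C + 1) by apply: divr_gt0; lra.
  have [d1 d10 h1] := hxy _ e20; have [d2 d20 h2] := sg_generator hu e20.
  pose t := Num.min d1 d2; have t0 : 0 < t by rewrite lt_min d10.
  have {}h1 := h1 t; have {}h2 := h2 t.
  rewrite t0 !ge_min !lexx /= ?orbT in h1 h2.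
  have {}h1 := h1 isT; have {}h2 := h2 isT.
  have := V_bound1 (sg t%:C x - x - t%:C *: y) sector1.
  rewrite !linearB linearZ /= V_sg // => h3.
  set a := sg t%:C (V 1 x) in h2 h3.
  have := nr_triangle (a - V 1 x - t%:C *: V 1 y) 0 (a - V 1 x - t%:C *: u').
  rewrite sub0r nrN subr0.
  have -> : a - V 1 x - t%:C *: V 1 y - (a - V 1 x - t%:C *: u') =
     t%:C *: (u' - V 1 y) by vring.
  rewrite nrZ cmR gtr0_norm // => h4.
  have eC : e / (C + 1) * (C + 1) = e by rewrite divfK // gt_eqF //; lra.
  move: (e / (C + 1)) eC h1 h2 => q qe h1 h2.
  rewrite -(ler_pM2l t0); have h5 : C * nr (sg t%:C x - x - t%:C *: y) <= C * (q * t).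
    by rewrite ler_wpM2l.
  by rewrite -qe; nra.
have e2 : V 1 (x - y) = x by rewrite linearB -e1.
have [y' [h1 e3]] := VT (x - y) sector1.
rewrite e2 scale1r in h1 e3; suff <- : y' = y by [].
by move: e3 => /addrI /oppr_inj.
Qed.

End SemigroupConstruction.

(** * From filters to sequences; closed subspaces as complete normed spaces *)

Section Topology.
Context {R : realType}.

Lemma nbhs_nrP {V : normedModType R[i]} (x : V) (A : set V) :
  nbhs x A <-> exists2 e : R, 0 < e & forall y, nr (x - y) < e -> A y.
Proof.
rewrite -nbhs_ballE; split=> [[e /= e0 h]|[e e0 h]].
  have eC : e = (ReC e)%:C by rewrite RRe_real // gtr0_real.
  exists (ReC e); first by rewrite -ltcR -eC.
  by move=> y xy; apply: h; rewrite -ball_normE /= eC nrE ltcR.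
exists e%:C => /=; first by rewrite ltcR.
by move=> y; rewrite -ball_normE /= nrE ltcR; exact: h.
Qed.

Lemma cvg_nrP {V : normedModType R[i]} {S : Type} (F : set_system S)
    (FF : Filter F) (f : S -> V) (x : V) :
  f @ F --> x <-> forall e : R, 0 < e -> \forall s \near F, nr (f s - x) <= e.
Proof.
split=> [h e e0|h].
  have hF : F (f @^-1` [set y | nr (x - y) < e]).
    by apply: h; apply/nbhs_nrP; exists e.
  by apply: filterS hF => s /= /ltW; rewrite nrBC.
move=> A /nbhs_nrP[e e0 hA].
have e20 : 0 < e / 2 by lra.
apply: filterS (h _ e20) => s hs /=; apply: hA; rewrite nrBC; lra.
Qed.

Lemma nbhs_cmP (z : R[i]) (A : set (R[i])) :
  nbhs (z : R[i]^o) A <-> exists2 e : R, 0 < e & forall w, cm (z - w) < e -> A w.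
Proof. exact: (@nbhs_nrP (R[i]^o)). Qed.

Lemma closureP {V : normedModType R[i]} (A : set V) (x : V) :
  closure A x <-> forall e : R, 0 < e -> exists2 a, A a & nr (x - a) <= e.
Proof.
split=> [h e e0|h B /nbhs_nrP[e e0 hB]].
  have [a [Aa ha]] := h [set y | nr (x - y) < e] ltac:(by apply/nbhs_nrP; exists e).
  by exists a => //; exact: ltW.
have [a Aa ha] := h (e / 2) ltac:(lra).
by exists a; split => //; apply: hB; lra.
Qed.

Lemma closed_seq_lim {V : normedModType R[i]} (A : set V) (u : nat -> V) x :
  closed A -> (forall n, A (u n)) -> seq_lim u x -> A x.
Proof.
move=> cA hu ux; rewrite (closure_id A).1 //; apply/closureP => e e0.
by have [N hN] := ux e e0; exists (u N) => //; rewrite nrBC hN.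
Qed.

Lemma seq_complete {V : completeNormedModType R[i]} (u : nat -> V) :
  seq_cauchy u -> exists x, seq_lim u x.
Proof.
move=> hu; have : cauchy (u @ \oo).
  apply/cauchy_ballP => e e0.
  have eC : e = (ReC e)%:C by rewrite RRe_real // gtr0_real.
  have Re0 : 0 < ReC e by rewrite -ltcR -eC.
  have [N hN] := hu (ReC e / 2) ltac:(lra).
  exists (u @` [set n | (N <= n)%N], u @` [set n | (N <= n)%N]) => /=.
    by split; exists N => // n /= Nn; exists n.
  move=> [_ _] [/= [n Nn <-] [m Nm <-]]; rewrite -ball_normE /= eC nrE ltcR.
  by have := hN _ _ Nn Nm; lra.
move/cauchy_cvg => /cvg_ex[x hx]; exists x => e e0.
have /cvg_nrP/(_ e e0)[N _ hN] := hx.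
by exists N => n Nn; apply: hN.
Qed.

Lemma near_rightP (P : R -> Prop) :
  (\forall t \near 0^'+, P t) <->
  exists2 d : R, 0 < d & forall t, 0 < t <= d -> P t.
Proof.
split=> [[d /= d0 h]|[d d0 h]].
  exists (d / 2); first by lra.
  move=> t /andP[t0 td]; apply: h => //=.
  have : `|(0 : R) - t| < d by rewrite sub0r normrN gtr0_norm //; lra.
  by [].
exists d => //= t td t0; have {}td : `|(0 : R) - t| < d by [].
rewrite sub0r normrN in td; apply: h.
by rewrite t0 -[t]gtr0_norm // ltW.
Qed.

Lemma sector_open (k : R) (z : R[i]) : 0 < k -> sector k z ->
  exists2 e : R, 0 < e & forall d, cm d <= e -> sector k (z + d).
Proof.
move=> k0; rewrite /sector /= => zk.
exists ((k * ReC z - `|ImC z|) / (2 * (k + 1))); first by apply: divr_gt0; lra.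
move=> d; rewrite ler_pdivlMr; last by lra.
have hI := ler_Im_cm d; have := ler_Re_cm d; rewrite ler_norml => /andP[hR _] hd.
rewrite !raddfD /=; apply: le_lt_trans (ler_normD _ _) _.
have := cm_ge0 d; nra.
Qed.

End Topology.

Section SubspaceType.
Context {R : realType} {H : completeNormedModType R[i]} {L : set H}.
Hypothesis hL : linear_subspace L.

(** Carrying the proof of linearity as an argument lets closure under linear combinations be
    registered as an instance for the predicate. *)
Definition sub_pred (_ : linear_subspace L) : {pred H} := fun x => `[< L x >].

Fact sub_pred_closed : submod_closed (sub_pred hL).
Proof.
have [h0 hc] := hL; split; first exact/asboolP.
by move=> c x y /asboolP Lx /asboolP Ly; apply/asboolP; exact: hc.
Qed.

HB.instance Definition _ := GRing.isSubmodClosed.Build R[i] H (sub_pred hL)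
  sub_pred_closed.

Record sub_type : Type := SubType { sub_val : H; _ : sub_val \in sub_pred hL }.

HB.instance Definition _ := [isSub for sub_val].
HB.instance Definition _ := [Choice of sub_type by <:].
HB.instance Definition _ := [SubChoice_isSubLmodule of sub_type by <:].

Fact sub_normD (x y : sub_type) : `|sub_val (x + y)| <= `|sub_val x| + `|sub_val y|.
Proof. exact: ler_normD. Qed.
Fact sub_normZ (c : R[i]) (x : sub_type) : `|sub_val (c *: x)| = `|c| * `|sub_val x|.
Proof. exact: normrZ. Qed.
Fact sub_norm_eq0 (x : sub_type) : `|sub_val x| = 0 -> x = 0.
Proof. by move/normr0_eq0 => h; apply: val_inj. Qed.

HB.instance Definition _ := Lmodule_isNormed.Build R[i] sub_type
  sub_normD sub_normZ sub_norm_eq0.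

Lemma sub_valP (x : sub_type) : L (sub_val x).
Proof. by case: x => x Px; exact/asboolP. Qed.

Lemma sub_nr (x : sub_type) : nr x = nr (sub_val x).
Proof. by []. Qed.

Lemma sub_mk x : L x -> exists x' : sub_type, sub_val x' = x.
Proof.
move=> Lx; have Px : x \in sub_pred hL by exact/asboolP.
by exists (SubType Px).
Qed.

Lemma sub_complete (u : nat -> sub_type) : closed L -> seq_cauchy u ->
  exists x, seq_lim u x.
Proof.
move=> cL hu; have [x hx] := @seq_complete _ H (fun n => sub_val (u n)) hu.
have [x' hx'] := sub_mk (closed_seq_lim cL (fun n => sub_valP (u n)) hx).
by exists x' => e /hx[N hN]; exists N => n /hN; rewrite -hx'.
Qed.

End SubspaceType.

(** * Sectorial operators generate holomorphic semigroups *)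

Section Generation.
Context {R : realType} {H : completeNormedModType R[i]}.

Lemma sectorial_generates (L : set H) (T : set (H * H)) (M : R) :
  closed_subspace L -> linear_operator L L T -> densely_defined L T -> 0 <= M ->
  (forall z : R[i], 0 < ReC z -> forall y, L y ->
     exists x x', T (x, x') /\ z *: x - x' = y) ->
  (forall z : R[i], 0 < ReC z -> forall x x', T (x, x') ->
     cm z * nr x <= M * nr (z *: x - x')) ->
  generates_holomorphic L T.
Proof.
move=> [hL cL] [TL T0 Tlin Tfun] Td M0 Tonto Test.
pose K : normedModType R[i] := sub_type hL; pose v : K -> H := sub_val (hL := hL).
pose TK : set (K * K) := [set p | T (v p.1, v p.2)].
have Kc (u : nat -> K) : seq_cauchy u -> exists x, seq_lim u x.
  exact: sub_complete.
have TKlin (c : R[i]) (x x' y y' : K) :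
    TK (x, y) -> TK (x', y') -> TK (c *: x + x', c *: y + y').
  exact: Tlin.
have TKfun (x y y' : K) : TK (x, y) -> TK (x, y') -> y = y'.
  by move=> h1 h2; apply: val_inj; exact: Tfun h1 h2.
have TKdense (x : K) (e : R) : 0 < e -> exists x' y, TK (x', y) /\ nr (x - x') <= e.
  move=> e0; have /closureP/(_ e e0)[a [[a1 a2] /= h <-] ha] := Td _ (sub_valP x).
  have [La1 La2] := TL _ _ h; have [b1 e1] := sub_mk hL La1; have [b2 e2] := sub_mk hL La2.
  exists b1, b2; rewrite /TK /= /v e1 e2; split => //.
  by rewrite sub_nr /= e1.
have TKonto (z : R[i]) : 0 < ReC z -> forall y : K,
    exists x x', TK (x, x') /\ z *: x - x' = y.
  move=> z0 y; have [x [x' [h e]]] := Tonto z z0 _ (sub_valP y).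
  have [La1 La2] := TL _ _ h; have [b1 e1] := sub_mk hL La1; have [b2 e2] := sub_mk hL La2.
  exists b1, b2; rewrite /TK /= /v e1 e2; split => //.
  by apply: val_inj; rewrite /= e1 e2.
have TKest (z : R[i]) : 0 < ReC z -> forall x x' : K, TK (x, x') ->
    cm z * nr x <= M * nr (z *: x - x').
  by move=> z0 x x' h; exact: Test.
pose k : R := (2 * (M + 1))^-1.
have k0 : 0 < k by rewrite invr_gt0; lra.
have [V [VT VK]] := sector_resolvent Kc TKlin M0 TKonto TKest.
have Vpow := sector_power_bound Kc TKlin M0 TKonto TKest VK.
have C0 : 0 <= 96 * (2 * M + 2) ^+ 3 by rewrite mulr_ge0 // exprn_ge0 //; lra.
move: (96 * (2 * M + 2) ^+ 3) C0 Vpow => C C0 Vpow.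
have Vb z n (x : K) : sector k z -> nr (iter n (V z) x) <= C * nr x.
  by move=> zk; have [] := Vpow z n x zk.
have Vs z n (x : K) : sector k z ->
    n.+1%:R * nr (V z (iter n (V z) x) - iter n (V z) x) <= C * nr x.
  by move=> zk; have [] := Vpow z n x zk.
(* [p] inverts the inclusion on [L], with arbitrary values off [L]; it carries the semigroup on the
   type [K] over to maps on [H]. *)
have [p pP] : exists p : H -> K, forall x, L x -> v (p x) = x.
  have [p hp] : {p : H -> K & forall x, L x -> v (p x) = x}.
    apply: (@choice _ _ (fun x y => L x -> v y = x)) => x.
    have [Lx|Lx] := pselect (L x); last by exists 0.
    by have [x' hx'] := sub_mk hL Lx; exists x'.
  by exists p.
have pv (x : K) : p (v x) = x by apply: val_inj; apply: pP; exact: sub_valP.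
pose U z x := v (sg V z (p x)).
have vB (x y : K) : v (x - y) = v x - v y by [].
have vZ c (x : K) : v (c *: x) = c *: v x by [].
have vS (h : R[i]) (a l : K) : h != 0 ->
    h^-1 *: v a - v l = h^-1 *: v (a - h *: l).
  by move=> h0; rewrite vB vZ scalerBr scalerA mulVf // scale1r.
have Sbound := sg_bound Kc TKlin TKdense k0 C0 VT VK Vb.
exists k, U; split; [exact: k0|split|].
- by move=> z x _ _; exact: sub_valP.
- move=> z c x y zk Lx Ly; rewrite /U.
  have -> : p (c *: x + y) = c *: p x + p y.
    apply: val_inj => /=; rewrite -/v pP; first by rewrite !pP.
    by have [_ hc] := hL; exact: hc.
  by rewrite (sg_lin Kc TKlin TKdense k0 C0 VT VK Vb).
- move=> z w x zk wk Lx; rewrite /U pv.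
  by rewrite (sg_add Kc TKlin TKdense k0 C0 VT VK Vb).
- move=> x z Lx zk.
  have [l [B B0 hB]] := sg_derive Kc TKlin TKdense k0 C0 VT VK Vb Vs (p x) zk.
  have zk2 : sector k (2^-1%:C * z) by exact: sectorZ.
  have [e e0 he] := sector_open k0 zk2.
  apply/cvg_ex; exists (v l); apply/cvg_nrP => d d0.
  have q0 : 0 < Num.min e (d / (B + 1)).
    by rewrite lt_min e0 /= divr_gt0 //; lra.
  apply/nbhs_cmP; exists (Num.min e (d / (B + 1))) => // h.
  rewrite sub0r cmN lt_min => /andP[/ltW he1]; rewrite ltr_pdivlMr; last by lra.
  move=> hd h0; rewrite /= /U -vB.
  have -> : h *: (1 : R[i]^o) + z = z + h by rewrite /GRing.scale /= mulr1 addrC.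
  rewrite (vS _ _ _ h0) nrZ cmV -sub_nr.
  rewrite mulrC ler_pdivrMr ?cm_gt0 //.
  apply: le_trans (hB h (he _ he1)) _.
  have := cm_ge0 h; nra.
- move=> k' /andP[k'0 k'k]; split.
    exists C => z x zk Lx; rewrite !nrE -rmorphM /= lecR /U -sub_nr.
    have := Sbound _ (p x) (sectorW k'0 (ltW k'k) zk).
    by rewrite [nr (p x)]sub_nr -/(v _) pP.
  move=> x Lx; apply/cvg_nrP => e e0.
  have [d d0 hd] := sg_cont0 Kc TKlin TKdense k0 C0 VT VK Vb (p x) e0.
  apply/nbhs_cmP; exists d => // z; rewrite sub0r cmN => zd zk.
  rewrite /U -{2}(pP _ Lx) -vB -sub_nr; apply: hd; last exact: ltW.
  exact: sectorW (ltW k'k) zk.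
apply/seteqP; split=> [[x y] /= [Lx Ly]|[x y] hT].
  move=> /cvg_nrP hxy.
  have : TK (p x, p y); last by rewrite /TK /= !pP.
  apply: (sg_generator_sub Kc TKlin TKdense k0 C0 VT VK Vb) => e e0.
  have /near_rightP[d d0 hd] := hxy e e0; exists d => // t td.
  have /andP[t0 _] := td.
  have tC : t%:C != 0 :> R[i] by rewrite eq_complex /= eqxx andbT gt_eqF.
  have := hd t td; rewrite /U -{2}(pP _ Lx) -{1}(pP _ Ly) -vB.
  rewrite (vS _ _ _ tC) nrZ cmV cmR gtr0_norm // -sub_nr.
  by rewrite mulrC ler_pdivrMr.
have [Lx Ly] := TL _ _ hT; split => //; apply/cvg_nrP => e e0; apply/near_rightP.
have hTK : TK (p x, p y) by rewrite /TK /= !pP.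
have [d d0 hd] := sg_generator Kc TKlin TKdense k0 C0 VT VK Vb hTK e0.
exists d => // t td; have /andP[t0 _] := td.
have tC : t%:C != 0 :> R[i] by rewrite eq_complex /= eqxx andbT gt_eqF.
rewrite /= /U -{2}(pP _ Lx) -{1}(pP _ Ly) -vB.
rewrite (vS _ _ _ tC) nrZ cmV cmR gtr0_norm // -sub_nr.
by rewrite mulrC ler_pdivrMr //; exact: hd.
Qed.

End Generation.


(** * The resolvent estimate for a generator *)

Section GeneratorEstimate.
Context {R : realType} {H : completeNormedModType R[i]}.

(* Discrete form of x = int_0^oo e^(-z t) U(t) (z - T) x dt. *)
Lemma power_bounded_est (W : set H) (E : H -> H) (B : R) (q : R[i]) (w : H) :
  1 < cm q -> linear_subspace W -> (forall x, W x -> W (E x)) ->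
  (forall c x y, W x -> W y -> E (c *: x + y) = c *: E x + E y) ->
  (forall n x, W x -> nr (iter n E x) <= B * nr x) -> W w ->
  (cm q - 1) * nr w <= B * nr (q *: w - E w).
Proof.
move=> q1 [W0 WL] WE EL EB Ww; set g := q *: w - E w.
have Wqw : W (q *: w) by rewrite -[_ *: w]addr0; exact: WL.
have Wg : W g by rewrite /g addrC -scaleN1r; apply: (WL); [exact: WE|].
have iW n x : W x -> W (iter n E x) by move=> Wx; elim: n => //= n; exact: WE.
have iL n c x y : W x -> W y ->
    iter n E (c *: x + y) = c *: iter n E x + iter n E y.
  by move=> Wx Wy; elim: n => //= n ->; rewrite EL //; exact: iW.
have B0 : 0 <= B * nr w by have := EB 0%N w Ww; have := nr_ge0 w; rewrite /=; lra.
have Bg0 : 0 <= B * nr g by have := EB 0%N g Wg; have := nr_ge0 g; rewrite /=; lra.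
(* q^n w - E^n w is the sum of q^(n - 1 - k) E^k g over k < n, whence a geometric series in |q|. *)
have hd n : (cm q - 1) * nr (q ^+ n *: w - iter n E w) <= B * nr g * (cm q ^+ n - 1).
  elim: n => [|n IH]; first by rewrite expr0 scale1r /= subrr nr0 mulr0 subrr mulr0.
  have -> : q ^+ n.+1 *: w - iter n.+1 E w =
      q *: (q ^+ n *: w - iter n E w) + iter n E g.
    have -> : iter n E g = q *: iter n E w - iter n.+1 E w.
      have -> : g = (-1) *: E w + q *: w by rewrite /g scaleN1r addrC.
      have Ln : iter n E (q *: w) = q *: iter n E w.
        have i0 : iter n E 0 = 0.
          have := iL n (-1) w w Ww Ww.
          by rewrite !scaleN1r !addNr.
        by rewrite -[q *: w]addr0 iL // i0 addr0.
      by rewrite iL ?Ln; [rewrite iterSr scaleN1r addrC | exact: WE | ].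
    rewrite exprS; vring.
  have := nrD (q *: (q ^+ n *: w - iter n E w)) (iter n E g).
  rewrite nrZ exprS => h1; have h2 := EB n g Wg.
  set a := nr (_ + _) in h1 *; set b := nr (_ - _) in IH h1.
  set p := cm q ^+ n in IH *.
  have h3 : cm q * ((cm q - 1) * b) <= cm q * (B * nr g * (p - 1)).
    by rewrite ler_wpM2l // cm_ge0.
  have h4 : (cm q - 1) * a <= (cm q - 1) * (cm q * b + B * nr g).
    by rewrite ler_wpM2l //; lra.
  by lra.
have hq n : n.+1%:R * (cm q - 1) <= cm q ^+ n.+1.
  elim: n => [|n IH]; first by rewrite mul1r expr1; lra.
  have n0 : 0 <= n.+1%:R :> R by [].
  have q0 : 0 <= cm q ^+ n.+1 by rewrite exprn_ge0 // cm_ge0.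
  have p1 : 1 <= cm q ^+ n.+1 by rewrite exprn_ege1 // ltW.
  rewrite exprS [n.+2%:R]mulrS; nra.
(* After division by |q|^(N + 1), which grows at least linearly in N, the contribution B |w| of the
   power of [E] is negligible. *)
apply/ler_addgt0Pr => e e0.
have [N hN] := archimedean_inv B0 e0; have {}hN := hN N (leqnn N).
have N0 : 0 < N.+1%:R :> R by [].
rewrite ler_pdivrMr // in hN.
set Q := cm q ^+ N.+1; have {}hq : N.+1%:R * (cm q - 1) <= Q := hq N.
have Q0 : 0 < Q by rewrite exprn_gt0 //; lra.
rewrite -(ler_pM2l Q0).
have h1 := hd N.+1; rewrite -/Q in h1.
have h2 := EB N.+1 w Ww.
have := nrD (q ^+ N.+1 *: w - iter N.+1 E w) (iter N.+1 E w).
rewrite subrK nrZ cmX -/Q => h3.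
have h4 : (cm q - 1) * (Q * nr w) <=
    (cm q - 1) * (nr (q ^+ N.+1 *: w - iter N.+1 E w) + B * nr w).
  by rewrite ler_wpM2l //; lra.
have h5 : (cm q - 1) * (B * nr w) <= Q * e.
  apply: le_trans (_ : (cm q - 1) * (e * N.+1%:R) <= _).
    by rewrite ler_wpM2l //; lra.
  by rewrite mulrCA [Q * e]mulrC ler_wpM2l ?(ltW e0) // mulrC.
by lra.
Qed.

(** The generator describes [U] at 0 only along real t, while a derivative in the direction tau is
    needed. So the estimate is first proved for U(s) x with s > 0, where [U] is complex
    differentiable, by applying the discrete estimate to U(h tau) with small h; then s tends to 0.
    One factor B bounds the powers of U(h tau), the other U(s). *)
Lemma generator_est (W : set H) (T : set (H * H)) :
  linear_subspace W -> generates_holomorphic W T ->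
  exists2 C : R, 0 <= C & forall z : R[i], 0 < ReC z -> forall x y, T (x, y) ->
    cm z * nr x <= C * nr (z *: x - y).
Proof.
move=> hW [k [U [k0 [UW UL UD Ud Uc] <-]]].
have [W0 WL] := hW.
have WB x y : W x -> W y -> W (x - y).
  by move=> Wx Wy; rewrite -scaleN1r addrC; exact: WL.
have WZ c x : W x -> W (c *: x) by move=> Wx; rewrite -[_ *: x]addr0; exact: WL.
have [[M hM] Uc0] := Uc (k / 2) ltac:(apply/andP; split; lra).
pose q := k / 4; have q0 : 0 < q by rewrite /q; lra.
pose B := Num.max M 1; have [MB B1] : M <= B /\ 1 <= B by rewrite !le_max !lexx orbT.
have UB z x : sector (k / 2) z -> W x -> nr (U z x) <= B * nr x.
  move=> zk Wx; have := hM z x zk Wx; rewrite !nrE -rmorphM lecR => h.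
  by apply: le_trans h _; rewrite ler_wpM2r // nr_ge0.
have k2 : 0 < k / 2 by lra.
have kk z : sector (k / 2) z -> sector k z.
  by move=> h; apply: sectorW h => //; lra.
have UB' z x y : sector k z -> W x -> W y -> U z (x - y) = U z x - U z y.
  by move=> zk Wx Wy; rewrite -scaleN1r addrC UL // scaleN1r addrC.
have UZ z c x : sector k z -> W x -> U z (c *: x) = c *: U z x.
  move=> zk Wx; have U0 : U z 0 = 0 by have := UB' z 0 0 zk W0 W0; rewrite !subrr.
  by rewrite -[c *: x]addr0 UL // U0 addr0.
exists (B ^+ 2 * (1 + q) / Num.min 1 q).
  apply: divr_ge0; last by rewrite le_min ler01 ltW.
  by rewrite mulr_ge0 ?exprn_ge0 //; lra.
move=> z z0 x y [Wx Wy /= /cvg_nrP hxy].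
(* The sign opposite to that of Im z gives Re (z tau) = Re z + q |Im z|, and q = k/4 keeps tau in
   the sector [k / 2], where [U] is bounded. *)
pose tau : R[i] := 1 +i* (if 0 <= ImC z then - q else q).
have tauk : sector (k / 2) tau.
  by rewrite /sector /tau /=; case: ifP => _; rewrite ?normrN gtr0_norm // /q; lra.
have tau1 : cm tau <= 1 + q.
  apply: le_trans (cm_le_ReIm _) _; rewrite /tau /= normr1 lerD2l.
  by case: ifP => _; rewrite ?normrN gtr0_norm.
have Relam : Num.min 1 q * cm z <= ReC (z * tau).
  have h1 : Num.min 1 q <= 1 by rewrite ge_min lexx.
  have h2 : Num.min 1 q <= q by rewrite ge_min lexx orbT.
  have h0 : 0 < Num.min 1 q by rewrite lt_min ltr01.
  apply: le_trans (_ : Num.min 1 q * (`|ReC z| + `|ImC z|) <= _).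
    by rewrite ler_wpM2l ?cm_le_ReIm // ltW.
  have ReM (u v : R[i]) : ReC (u * v) = ReC u * ReC v - ImC u * ImC v.
    by case: u v => [a b] [c d].
  rewrite ReM /tau /= mulr1 [`|ReC z|]gtr0_norm //; case: ger0P => b0; nra.
have m0 : 0 < Num.min 1 q by rewrite lt_min ltr01.
rewrite mulrAC ler_pdivlMr // mulrC mulrA.
apply: le_trans (_ : ReC (z * tau) * nr x <= _); first by rewrite ler_wpM2r // nr_ge0.
have z1 : 0 < cm z by rewrite cm_gt0; apply: contraTneq z0 => ->; rewrite ltxx.
have lam0 : 0 < ReC (z * tau) by apply: lt_le_trans Relam; exact: mulr_gt0.
have hs s : 0 < s -> ReC (z * tau) * nr (U s%:C x) <= B ^+ 2 * (1 + q) * nr (z *: x - y).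
  move=> s0; have sk := sector_real k0 s0.
  have Wxs : W (U s%:C x) by exact: UW.
  have /cvg_ex[l /cvg_nrP hl] := Ud x s%:C Wx sk.
  have {}hl (e : R) : 0 < e -> exists2 d : R, 0 < d & forall h : R[i],
      cm h < d -> h != 0 -> nr (h^-1 *: (U (s%:C + h) x - U s%:C x) - l) <= e.
    move=> e0; have /nbhs_cmP[d d0 hd] := hl e e0; exists d => // h hh h0.
    have := hd h; rewrite sub0r cmN => /(_ hh h0) /=.
    have -> : h *: (1 : R[i]^o) + s%:C = s%:C + h.
      by rewrite /GRing.scale /= mulr1 addrC.
    by [].
  (* The complex derivative at s is evaluated along real increments, where the semigroup law reduces
     it to the generator. *)
  have le : l = U s%:C y.
    apply/eqP; rewrite -subr_eq0; apply/eqP/nr_small_eq0 => e e0.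
    have [d d0 hd] := hl (e / 2) ltac:(lra).
    have e2 : 0 < e / 2 / B by apply: divr_gt0; clear -H e0 B1; lra.
    have /near_rightP[d' d'0 hd'] := hxy _ e2.
    pose t := Num.min (d / 2) d'.
    have t0 : 0 < t by rewrite lt_min d'0 andbT; clear -H d0; lra.
    have td : t < d by rewrite gt_min; apply/orP; left; clear -H d0; lra.
    have td' : 0 < t <= d' by rewrite t0 ge_min lexx orbT.
    have tC : t%:C != 0 :> R[i] by rewrite eq_complex /= eqxx andbT gt_eqF.
    have := hd t%:C; rewrite cmR gtr0_norm // => /(_ td tC) h1.
    have h2 := hd' t td'.
    have tk := sector_real k0 t0.
    have sk2 := sector_real k2 s0.
    have WU := UW _ _ tk Wx.
    have h3 := UB _ _ sk2 (WB _ _ (WZ (t%:C)^-1 _ (WB _ _ WU Wx)) Wy).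
    rewrite (UB' _ _ _ sk (WZ _ _ (WB _ _ WU Wx)) Wy) in h3.
    rewrite (UZ _ _ _ sk (WB _ _ WU Wx)) (UB' _ _ _ sk WU Wx) -(UD _ _ _ sk tk Wx) in h3.
    set u := _ *: _ in h1 h3.
    have := nr_triangle l u (U s%:C y); rewrite (nrBC l u).
    have h4 : B * nr ((t%:C)^-1 *: (U t%:C x - x) - y) <= B * (e / 2 / B).
      by rewrite ler_wpM2l //; clear -H B1; lra.
    have h5 : B * (e / 2 / B) = e / 2.
      by rewrite mulrC divfK // gt_eqF //; clear -H B1; lra.
    clear -H h1 h3 h4 h5; lra.
  pose xs := U s%:C x; rewrite -/xs in hl Wxs *.
  have key (h : R) : 0 < h ->
      ReC (z * tau) * nr xs <= B * nr ((z * tau) *: xs -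
        (h%:C)^-1 *: (U (h%:C * tau) xs - xs)).
    move=> h0; have htk2 : sector (k / 2) (h%:C * tau) by exact: sectorZ.
    have htk := kk _ htk2.
    have hC : h%:C != 0 :> R[i] by rewrite eq_complex /= eqxx andbT gt_eqF.
    have iU n v : W v -> iter n.+1 (U (h%:C * tau)) v = U (n.+1%:R%:C * (h%:C * tau)) v.
      move=> Wv; elim: n => [|n IH]; first by rewrite mul1r.
      rewrite iterS IH -UD //; last by apply: sectorZ => //; rewrite ltr0n.
      by congr (U _ v); rewrite [n.+2%:R]mulrS rmorphD mulrDl mul1r.
    pose Q := 1 + h%:C * (z * tau).
    have ReQ : 1 + h * ReC (z * tau) <= cm Q.
      apply: le_trans (ler_Re_cm _); apply: le_trans (ler_norm _).
      by rewrite /Q; case: (z * tau) => a b /=; rewrite mul0r subr0.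
    have Q1 : 1 < cm Q by apply: lt_le_trans ReQ; rewrite ltrDl mulr_gt0.
    have := @power_bounded_est W (U (h%:C * tau)) B Q xs Q1 hW
      (fun v => UW _ v htk) (fun c u v => UL _ c u v htk).
    move=> /(_ _ Wxs) est; rewrite -(ler_pM2l h0).
    apply: le_trans (_ : (cm Q - 1) * nr xs <= _).
      by rewrite mulrA ler_wpM2r ?nr_ge0 //; clear -H ReQ; lra.
    apply: le_trans (est _) _.
      case=> [|n] v Wv; first by rewrite /= ler_peMl ?nr_ge0.
      by rewrite iU //; apply: UB => //; apply: sectorZ => //; rewrite ltr0n.
    rewrite mulrCA; have -> : h * nr ((z * tau) *: xs -
        (h%:C)^-1 *: (U (h%:C * tau) xs - xs)) = nr (h%:C *: ((z * tau) *: xs -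
        (h%:C)^-1 *: (U (h%:C * tau) xs - xs))) by rewrite nrZ cmR gtr0_norm.
    rewrite scalerBr scalerKV // le_eqVlt; apply/orP; left; apply/eqP.
    by congr (B * nr _); rewrite /Q; vring.
  have tk := kk _ tauk.
  have tau0 : 0 < cm tau by rewrite cm_gt0; apply/eqP => /(congr1 (@ReC R)) /=; apply/eqP; rewrite oner_eq0.
  apply/ler_addgt0Pr => e e0.
  have e2 : 0 < e / B / (1 + q).
    by apply: divr_gt0; [apply: divr_gt0|]; clear -H e0 B1 q0; lra.
  have [d d0 hd] := hl _ e2.
  pose h := d / 2 / cm tau; have h0 : 0 < h by rewrite !divr_gt0 //; clear -H d0; lra.
  have hC : h%:C != 0 :> R[i] by rewrite eq_complex /= eqxx andbT gt_eqF.
  have t0' : tau != 0 by rewrite -cm_gt0.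
  have := hd (h%:C * tau); rewrite cmM cmR gtr0_norm //.
  have -> : h * cm tau = d / 2 by rewrite divfK // gt_eqF.
  move=> /(_ ltac:(clear -H d0; lra)); rewrite mulf_neq0 // => /(_ isT).
  rewrite [s%:C + _]addrC UD //; last by exact: sectorZ.
  rewrite le -/xs => h1.
  apply: le_trans (key h h0) _.
  set u := (h%:C * tau)^-1 *: _ in h1.
  have -> : (h%:C)^-1 *: (U (h%:C * tau) xs - xs) = tau *: u.
    by rewrite /u scalerA invfM mulrCA mulfV // mulr1.
  have -> : (z * tau) *: xs - tau *: u =
      tau *: (z *: xs - U s%:C y) - tau *: (u - U s%:C y) by vring.
  have -> : z *: xs - U s%:C y = U s%:C (z *: x - y).
    by rewrite UB' ?UZ //; exact: WZ.
  have h2 := UB _ _ (sector_real k2 s0) (WB _ _ (WZ z _ Wx) Wy).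
  have := nrB (tau *: U s%:C (z *: x - y)) (tau *: (u - U s%:C y)).
  rewrite !nrZ => h3.
  have h4 : cm tau * nr (U s%:C (z *: x - y)) <= (1 + q) * (B * nr (z *: x - y)).
    by rewrite ler_pM ?nr_ge0 ?cm_ge0.
  have h5 : cm tau * nr (u - U s%:C y) <= (1 + q) * (e / B / (1 + q)).
    by rewrite ler_pM ?nr_ge0 ?cm_ge0.
  have h6 : (1 + q) * (e / B / (1 + q)) = e / B.
    by rewrite mulrC divfK // gt_eqF //; clear -H q0; lra.
  have h7 : B * (e / B) = e by rewrite mulrC divfK // gt_eqF //; clear -H B1; lra.
  rewrite h6 in h5.
  set v := nr (_ - _) in h3 *.
  apply: le_trans (_ : B * ((1 + q) * (B * nr (z *: x - y)) + e / B) <= _).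
    rewrite ler_wpM2l //; first by clear -H B1; lra.
    by move: h3 h4 h5; clear -H; lra.
  by rewrite mulrDr h7 expr2 lerD2r le_eqVlt; apply/orP; left; apply/eqP; ring.
apply/ler_addgt0Pr => e e0.
have e2 : 0 < e / ReC (z * tau) by exact: divr_gt0.
have /cvg_nrP/(_ _ e2)/nbhs_cmP[d d0 hd] := Uc0 x Wx.
have s0 : 0 < d / 2 by clear -H d0; lra.
have := hd (d / 2)%:C; rewrite sub0r cmN cmR gtr0_norm // => /(_ ltac:(clear -H d0; lra)).
move=> /(_ (sector_real k2 s0)) h1; have h2 := hs _ s0.
have := nr_triangle x (U (d / 2)%:C x) 0; rewrite !subr0 (nrBC x) => h3.
rewrite ler_pdivlMr // in h1.
apply: le_trans (_ : ReC (z * tau) * (nr (U (d / 2)%:C x - x) + nr (U (d / 2)%:C x)) <= _).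
  by rewrite ler_wpM2l // ltW.
by rewrite mulrDr addrC lerD // mulrC.
Qed.

End GeneratorEstimate.

(** * Hilbert space geometry and maximal dissipative operators *)

Section Hilbert.
Context {R : realType} {H : completeNormedModType R[i]}.
Variable dot : {dot H for @Num.conj R[i]}.
Hypothesis dot_norm : forall x, `|x| ^+ 2 = dot x x.

Lemma dotDl x y z : dot (x + y) z = dot x z + dot y z.
Proof. exact: linearDl. Qed.

Lemma dotZl c x y : dot (c *: x) y = c * dot x y.
Proof. exact: linearZl_LR. Qed.

Lemma dotC x y : dot y x = (dot x y)^*.
Proof. rewrite hermC expr0 mul1r. reflexivity. Qed.

Lemma dotDr x y z : dot x (y + z) = dot x y + dot x z.
Proof. by rewrite dotC dotDl rmorphD /= -!dotC. Qed.

Lemma dotZr c x y : dot x (c *: y) = c^* * dot x y.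
Proof. by rewrite dotC dotZl rmorphM /= -dotC. Qed.

Lemma dotNl x y : dot (- x) y = - dot x y.
Proof. by rewrite -scaleN1r dotZl mulN1r. Qed.

Lemma dotBl x y z : dot (x - y) z = dot x z - dot y z.
Proof. by rewrite dotDl dotNl. Qed.

Lemma dotxx x : dot x x = (nr x ^+ 2)%:C.
Proof. by rewrite -dot_norm nrE -rmorphXn. Qed.

Definition rdot x y : R := ReC (dot x y).

Lemma rdotC x y : rdot x y = rdot y x.
Proof. by rewrite /rdot dotC; case: (dot y x). Qed.

Lemma rdotDl x y z : rdot (x + y) z = rdot x z + rdot y z.
Proof. by rewrite /rdot dotDl raddfD. Qed.

Lemma rdotZl (t : R) x y : rdot (t%:C *: x) y = t * rdot x y.
Proof. by rewrite /rdot dotZl; case: (dot x y) => a b /=; rewrite mul0r subr0. Qed.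

Lemma rdotDr x y z : rdot x (y + z) = rdot x y + rdot x z.
Proof. by rewrite rdotC rdotDl !(rdotC x). Qed.

Lemma rdotZr (t : R) x y : rdot x (t%:C *: y) = t * rdot x y.
Proof. by rewrite rdotC rdotZl (rdotC x). Qed.

Lemma rdotxx x : rdot x x = nr x ^+ 2.
Proof. by rewrite /rdot dotxx. Qed.

Lemma rdotNl x y : rdot (- x) y = - rdot x y.
Proof. by rewrite /rdot dotNl raddfN. Qed.

Lemma rdotNr x y : rdot x (- y) = - rdot x y.
Proof. by rewrite rdotC rdotNl (rdotC x). Qed.

Lemma rdot_i x y : rdot x ('i *: y) = ImC (dot x y).
Proof.
by rewrite /rdot dotZr; case: (dot x y) => a b /=; rewrite mul0r sub0r mulN1r opprK.
Qed.

Lemma nr_sqrD x y : nr (x + y) ^+ 2 = nr x ^+ 2 + 2 * rdot x y + nr y ^+ 2.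
Proof.
rewrite -!rdotxx rdotDl !rdotDr (rdotC y x); ring.
Qed.

Lemma nr_sqrB x y : nr (x - y) ^+ 2 = nr x ^+ 2 - 2 * rdot x y + nr y ^+ 2.
Proof. by rewrite nr_sqrD rdotNr nrN; ring. Qed.

Lemma rdot_le x y : rdot x y <= nr x * nr y.
Proof.
have h : nr (x + y) ^+ 2 <= (nr x + nr y) ^+ 2.
  by rewrite lerXn2r ?nnegrE ?addr_ge0 ?nr_ge0 ?nrD.
rewrite nr_sqrD in h; nra.
Qed.

(** z n almost attains the infimum d n of the norm on K n. The d n increase and are bounded by B,
    and midpoints of z n and z m lie in K n for n <= m, so the parallelogram law makes z a Cauchy
    sequence. A constant family yields nearest points; a decreasing one replaces weak limits by
    strong limits of convex combinations. *)
Lemma nested_convex_cauchy (K : nat -> set H) (B : R) :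
  (forall n x y, K n x -> K n y -> K n (2^-1%:C *: (x + y))) ->
  (forall n m, (n <= m)%N -> K m `<=` K n) ->
  (forall n, exists2 x, K n x & nr x <= B) ->
  exists z : nat -> H, [/\ forall n, K n (z n), seq_cauchy z &
    forall n x, K n x -> nr (z n) <= nr x + n.+1%:R^-1].
Proof.
move=> Kconv Kdecr Kne.
pose N n := [set nr x | x in K n].
have N0 n : has_inf (N n).
  split; first by have [x Kx _] := Kne n; exists (nr x), x.
  by exists 0 => _ [x _ <-]; exact: nr_ge0.
pose d n := inf (N n).
have d_le n x : K n x -> d n <= nr x.
  by move=> Kx; apply: ge_inf; [case: (N0 n) | exists x].
have hsol n : exists x, K n x /\ nr x <= d n + n.+1%:R^-1.
  have i0 : 0 < n.+1%:R^-1 :> R by [].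
  have [_ [x Kx <-] hx] := inf_adherent i0 (N0 n).
  by exists x; split => //; exact: ltW.
have [z hz] := choice hsol.
exists z; split => [n||n x Kx].
- by have [] := hz n.
- have d0 n : 0 <= d n.
    by apply: lb_le_inf; [case: (N0 n) | move=> _ [x _ <-]; exact: nr_ge0].
  have dB n : d n <= B.
    by have [x Kx xB] := Kne n; apply: le_trans (d_le _ _ Kx) xB.
  have dmono n m : (n <= m)%N -> d n <= d m.
    move=> nm; apply: lb_le_inf; first by case: (N0 m).
    by move=> _ [x Kx <-]; apply: d_le; exact: (Kdecr _ _ nm).
  have Sd : has_sup (range d).
    by split; [exists (d 0%N), 0%N | exists B => _ [n _ <-]].
  move=> e e0; have B0 : 0 <= B := le_trans (d0 0%N) (dB 0%N).
  (* The parallelogram law will bound |z n - z m|^2 by 2 (d + eta)^2 + 2 (d + 2 eta)^2 - (2 d)^2 =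
     eta (12 d + 10 eta), where d = d n <= B. *)
  pose eta := Num.min 1 (e ^+ 2 / (16 * (B + 2))).
  have e2 : 0 < e ^+ 2 by rewrite exprn_gt0.
  have eta0 : 0 < eta by rewrite lt_min ltr01 /=; apply: divr_gt0; lra.
  have eta1 : eta <= 1 by rewrite ge_min lexx.
  have etaE : eta * (16 * (B + 2)) <= e ^+ 2.
    by rewrite -ler_pdivlMr ?ge_min ?lexx ?orbT //; lra.
  have [_ [N1 _ <-] hN1] := sup_adherent eta0 Sd.
  have [N2 hN2] := archimedean_inv ler01 eta0.
  have hd n : d n <= sup (range d) by apply: ub_le_sup; [case: Sd | exists n].
  have key n m : (n <= m)%N -> (maxn N1 N2 <= n)%N -> nr (z n - z m) <= e.
    move=> nm; rewrite geq_max => /andP[n1 n2].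
    have [Kn zn] := hz n; have [Km zm] := hz m.
    have h1 := d_le _ _ (Kconv _ _ _ Kn (Kdecr _ _ nm _ Km)).
    have i1 := hN2 n n2; have i2 := hN2 m (leq_trans n2 nm); rewrite !div1r in i1 i2.
    have dn := dmono _ _ n1; have dm := hd m; have dn0 := d0 n; have dmB := dB m.
    have dnB := dB n.
    have hp : nr (z n - z m) ^+ 2 + nr (z n + z m) ^+ 2 =
        2 * nr (z n) ^+ 2 + 2 * nr (z m) ^+ 2.
      by rewrite nr_sqrB nr_sqrD; ring.
    rewrite nrZ cmR gtr0_norm // in h1.
    have a0 := nr_ge0 (z n); have b0 := nr_ge0 (z m); have c0 := nr_ge0 (z n + z m).
    rewrite -(ler_pXn2r (n := 2)) ?nnegrE ?nr_ge0 //; last by exact: ltW.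
    move: (nr (z n)) (nr (z m)) (nr (z n + z m)) (nr (z n - z m)) (d n) (d m)
      (n.+1%:R^-1) (m.+1%:R^-1) (sup _) (d N1) h1 i1 i2 dn dm dn0 dmB dnB hp a0 b0 c0 zn zm hN1.
    move=> a b c s dn dm i j S D h1 i1 i2 hD dmS dn0 dmB dnB hp a0 b0 c0 hza hzb hS.
    have ha : a ^+ 2 <= (dn + eta) ^+ 2.
      by rewrite lerXn2r ?nnegrE //; lra.
    have hb : b ^+ 2 <= (dn + 2 * eta) ^+ 2.
      by rewrite lerXn2r ?nnegrE //; lra.
    have hc : (2 * dn) ^+ 2 <= c ^+ 2.
      by rewrite lerXn2r ?nnegrE //; lra.
    apply: (@le_trans _ _ (eta * (16 * (B + 2)))) => //.
    have h2 : s ^+ 2 <= 2 * (dn + eta) ^+ 2 + 2 * (dn + 2 * eta) ^+ 2 - (2 * dn) ^+ 2 by lra.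
    apply: le_trans h2 _.
    rewrite (_ : _ - _ = eta * (12 * dn + 10 * eta)); last by ring.
    by rewrite ler_wpM2l //; [exact: ltW | lra].
  exists (maxn N1 N2) => n m nN mN.
  have [nm|mn] := leqP n m; first exact: key.
  by rewrite nrBC; apply: key => //; exact: ltnW.
- have [_ h] := hz n; apply: le_trans h _.
  by rewrite lerD2r d_le.
Qed.

Lemma orthogonal_complement (M : set H) x0 : closed_subspace M -> ~ M x0 ->
  exists m, M m /\ x0 - m != 0 /\ forall y, M y -> dot y (x0 - m) = 0.
Proof.
move=> [[M0 ML] Mc] Mx0.
pose K (n : nat) : set H := [set v | M (x0 - v)].
have MZ c y : M y -> M (c *: y) by move=> My; rewrite -[_ *: y]addr0; exact: ML.
have Kconv n x y : K n x -> K n y -> K n (2^-1%:C *: (x + y)).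
  rewrite /K /= => hx hy.
  have hh : 2^-1%:C + 2^-1%:C = 1 :> R[i].
    by rewrite -rmorphD /= (_ : 2^-1 + 2^-1 = 1) //; field.
  have -> : x0 - 2^-1%:C *: (x + y) = 2^-1%:C *: (x0 - x) + 2^-1%:C *: (x0 - y).
    by rewrite -{1}[x0]scale1r -hh; vring.
  by apply: ML => //; exact: MZ.
have Kne n : exists2 x, K n x & nr x <= nr x0.
  by exists x0 => //; rewrite /K /= subrr.
have [z [Kz zc zmin]] := nested_convex_cauchy Kconv (fun n m _ x Kx => Kx) Kne.
have [v hv] := seq_complete zc.
have Kv : M (x0 - v).
  by apply: (closed_seq_lim Mc Kz); apply: seq_limB hv; exact: seq_lim_cst.
have vmin x : M (x0 - x) -> nr v <= nr x.
  move=> hx; apply/ler_addgt0Pr => e e0; apply: (seq_lim_nr hv).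
  have [N hN] := archimedean_inv ler01 e0; exists N => n /hN h.
  by apply: le_trans (zmin n x hx) _; rewrite lerD2l -div1r.
exists (x0 - v); split=> //; rewrite subKr; split.
  by apply/eqP => v0; apply: Mx0; rewrite v0 subr0 in Kv.
have rd0 y : M y -> rdot v y = 0.
  move=> My; set a := rdot v y.
  have b0 : 0 <= nr y ^+ 2 by rewrite exprn_ge0 ?nr_ge0.
  (* The optimal t would be a/|y|^2; the added 1 avoids a division by zero. *)
  pose t := a / (nr y ^+ 2 + 1).
  have h : nr v <= nr (v - t%:C *: y).
    apply: vmin; rewrite opprB addrCA addrC.
    rewrite (_ : _ + _ = t%:C *: y + (x0 - v)); last by vring.
    by apply: ML.
  have {}h : nr v ^+ 2 <= nr (v - t%:C *: y) ^+ 2.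
    by rewrite lerXn2r ?nnegrE ?nr_ge0.
  rewrite nr_sqrB rdotZr nrZ cmR exprMn real_normK ?num_real // -/a in h.
  have ta : t * (nr y ^+ 2 + 1) = a by rewrite /t divfK // gt_eqF //; lra.
  move: (nr y ^+ 2) b0 ta h => b b0 ta h.
  have t2 : t ^+ 2 * (b + 2) <= 0 by rewrite -ta in h; nra.
  have : t = 0.
    apply/eqP; rewrite -sqrf_eq0 eq_le sqr_ge0 andbT.
    have := sqr_ge0 t; nra.
  by move=> t0; rewrite -ta t0 mul0r.
move=> y My; rewrite dotC; have h1 := rd0 y My; have := rd0 _ (MZ 'i _ My).
rewrite rdot_i => h2; rewrite (_ : dot v y = 0) ?rmorph0 //.
by move: h1 h2; rewrite /rdot; case: (dot v y) => a b /= -> ->.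
Qed.

End Hilbert.

Section MaximalDissipative.
Context {R : realType} {H : completeNormedModType R[i]}.
Variable dot : {dot H for @Num.conj R[i]}.
Hypothesis dot_norm : forall x, `|x| ^+ 2 = dot x x.
Variables (W : set H) (T : set (H * H)).
Hypothesis hW : closed_subspace W.
Hypothesis hT : max_dissipative dot W T.

(** |y - l x|^2 = |y - (Re l) x|^2 - 2 Im l Im (y, x) + (Im l)^2 |x|^2, and all three terms are
    nonnegative. *)
Lemma dissipative_est (l : R[i]) x y : ImC l <= 0 -> 0 <= ImC (dot y x) ->
  - ImC l * nr x <= nr (y - l *: x).
Proof.
move=> l0 hyx; rewrite -(ler_pXn2r (n := 2)) ?nnegrE ?nr_ge0 //; last first.
  by rewrite mulr_ge0 ?nr_ge0 //; lra.
have -> : y - l *: x = (y - (ReC l)%:C *: x) - (ImC l)%:C *: ('i *: x).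
  by rewrite {1}[l]complexE; vring.
rewrite (nr_sqrB dot_norm) rdotZr // nrZ cmR !exprMn real_normK ?num_real //.
have -> : rdot dot (y - (ReC l)%:C *: x) ('i *: x) = ImC (dot y x).
  by rewrite rdotDl rdotNl rdotZl !rdot_i (dotxx dot_norm) /= mulr0 subr0.
have -> : nr ('i *: x) = nr x.
  rewrite nrZ (_ : cm 'i = 1) ?mul1r //.
  by rewrite /cm normc_def /= expr0n /= add0r expr1n sqrtr1.
have := nr_ge0 (y - (ReC l)%:C *: x); nra.
Qed.

Let diss x y : T (x, y) -> 0 <= ImC (dot y x).
Proof. by have [[_ _ h] _] := hT; exact: h. Qed.

Let dot_lim (u v : nat -> H) x y : seq_lim u x -> seq_lim v y ->
  (forall n, 0 <= ImC (dot (v n) (u n))) -> 0 <= ImC (dot y x).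
Proof.
move=> ux vy h; rewrite leNgt; apply/negP => hneg.
set e := - ImC (dot y x); have e0 : 0 < e by rewrite oppr_gt0.
have cI (w : H) : nr ('i *: w) = nr w.
  rewrite nrZ (_ : cm 'i = 1) ?mul1r //.
  by rewrite /cm normc_def /= expr0n /= add0r expr1n sqrtr1.
pose b := nr x + nr y + 1; have b1 : 1 <= b by rewrite /b; have := nr_ge0 x; have := nr_ge0 y; lra.
pose d := Num.min 1 (e / (4 * b)).
have d0 : 0 < d by rewrite lt_min ltr01 divr_gt0 //; lra.
have d1 : d <= 1 by rewrite ge_min lexx.
have db : d * (4 * b) <= e by rewrite -ler_pdivlMr ?ge_min ?lexx ?orbT //; lra.
have [N1 hN1] := ux d d0; have [N2 hN2] := vy d d0.
pose n := maxn N1 N2.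
have h1 := hN1 n (leq_maxl _ _); have h2 := hN2 n (leq_maxr _ _); have := h n.
have -> : ImC (dot (v n) (u n)) = ImC (dot y x) + rdot dot (v n - y) ('i *: u n)
    + rdot dot y ('i *: (u n - x)).
  have e1 : rdot dot (v n) ('i *: u n) =
      rdot dot (v n - y) ('i *: u n) + rdot dot y ('i *: u n).
    by rewrite -rdotDl subrK.
  have e2 : rdot dot y ('i *: u n) =
      rdot dot y ('i *: x) + rdot dot y ('i *: (u n - x)).
    by rewrite -rdotDr -scalerDr addrC subrK.
  by rewrite -!rdot_i e1 e2; ring.
have := rdot_le dot_norm (v n - y) ('i *: u n).
have := rdot_le dot_norm y ('i *: (u n - x)); rewrite !cI.
have := nr_triangle (u n) x 0; rewrite !subr0.
have := nr_ge0 (v n - y); have := nr_ge0 (u n - x); have := nr_ge0 (u n).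
have := nr_ge0 x; have := nr_ge0 y.
have -> : ImC (dot y x) = - e by rewrite opprK.
move: (nr (u n - x)) (nr (v n - y)) h1 h2 => p q h1 h2.
move: (nr (u n)) (rdot _ _ _) (rdot _ _ _) => a r1 r2.
rewrite /b in db b1; move: (nr x) (nr y) db b1 => X Y db b1.
move=> Y0 X0 a0 p0 q0 hap hr1 hr2.
have : Y * p <= Y * d by rewrite ler_wpM2l.
have : q * a <= d * (p + X) by rewrite ler_pM.
have : d * p <= d by rewrite ler_piMr ?(ltW d0) //; lra.
nra.
Qed.

(** The closure of [T] is dissipative by continuity of the inner product, so maximality applies once
    it is single-valued. If (0, b) belongs to it, adding multiples of (0, b) to pairs (a, a') of [T]
    keeps the imaginary part nonnegative, which forces (b, a) = 0 for a in a dense set. *)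
Lemma max_dissipative_closed (u v : nat -> H) x y :
  (forall n, T (u n, v n)) -> seq_lim u x -> seq_lim v y -> T (x, y).
Proof.
have [[[TW T0 Tlin Tfun] Tdense _] Tmax] := hT; have [[W0 WL] Wc] := hW.
pose T' : set (H * H) := [set p | exists u v, [/\ forall n, T (u n, v n),
  seq_lim u p.1 & seq_lim v p.2]].
move=> huv ux vy; suff <- : T' = T by exists u, v.
have TT' : T `<=` T'.
  move=> [a b] hab; exists (fun=> a), (fun=> b).
  by split => //; exact: seq_lim_cst.
have T'diss a b : T' (a, b) -> 0 <= ImC (dot b a).
  by move=> [f [g [h1 h2 h3]]]; apply: (dot_lim h2 h3) => n; exact: diss.
have T'lin (c : R[i]) a a' b b' :
    T' (a, b) -> T' (a', b') -> T' (c *: a + a', c *: b + b').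
  move=> [f [g [h1 h2 h3]]] [f' [g' [h1' h2' h3']]].
  exists (fun n => c *: f n + f' n), (fun n => c *: g n + g' n).
  split => [n||]; first exact: Tlin.
    exact: seq_limD (seq_limZ c h2) h2'.
  exact: seq_limD (seq_limZ c h3) h3'.
have T'W a b : T' (a, b) -> W a /\ W b.
  move=> [f [g [h1 h2 h3]]]; split.
    by apply: (closed_seq_lim Wc _ h2) => n; have [] := TW _ _ (h1 n).
  by apply: (closed_seq_lim Wc _ h3) => n; have [] := TW _ _ (h1 n).
have T'0 b : T' (0, b) -> b = 0.
  move=> hb.
  have orth a a' : T (a, a') -> dot b a = 0.
    move=> ha; have ha' : T' (a, a') := TT' _ ha.
    set p := dot b a.
    (* The multiple - t i conj(p) of b contributes exactly - t |p|^2. *)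
    have key (t : R) : 0 <= ImC (dot a' a) - t * cm p ^+ 2.
      have := T'diss _ _ (T'lin (- (t%:C * ('i * p^*))) _ _ _ _ hb ha').
      rewrite scaler0 add0r dotDl dotZl -/p raddfD /= addrC.
      have -> : - (t%:C * ('i * p^*)) * p = (- (t%:C * 'i)) * (p * p^*) by ring.
      rewrite -sqr_normc cmE -rmorphXn /=.
      by rewrite !(mul0r, mulr0, subr0, add0r, addr0, mulr1, mulNr, oppr0).
    have p0 := cm_ge0 p; apply/eqP; rewrite -[_ == 0]negbK -cm_gt0; apply/negP => pp.
    have := key ((ImC (dot a' a) + 1) / cm p ^+ 2).
    by rewrite divfK ?expf_neq0 ?gt_eqF //; lra.
  have [_ Wb] := T'W _ _ hb.
  apply: nr_small_eq0 => e e0.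
  have /closureP/(_ e e0)[a [[a1 a2] /= h <-] ha] := Tdense _ Wb.
  have o := orth _ _ h; apply: le_trans ha.
  rewrite -(ler_pXn2r (n := 2)) ?nnegrE ?nr_ge0 //.
  by rewrite (nr_sqrB dot_norm) /rdot o /= mulr0 subr0 lerDl exprn_ge0 // nr_ge0.
apply: (Tmax T' _ TT'); split; last exact: T'diss.
  split => //; first exact: TT'.
  move=> a b b' h h'; have := T'lin (-1) _ _ _ _ h' h.
  rewrite !scaleN1r addNr => /T'0 /eqP; rewrite addrC subr_eq0 => /eqP.
  exact.
move=> a Wa; apply: closureS (Tdense a Wa) => _ [p Tp <-].
by exists p => //; exact: TT'.
Qed.

(** By [dissipative_est] and closedness of [T], the range of T - l is closed. A nonzero v in [W]
    orthogonal to it would allow the proper dissipative extension that sends v to conj(l) v. *)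
Lemma max_dissipative_onto (l : R[i]) y : ImC l < 0 -> W y ->
  exists x x', T (x, x') /\ x' - l *: x = y.
Proof.
have [[[TW T0 Tlin Tfun] Tdense _] Tmax] := hT; have [[W0 WL] Wc] := hW.
move=> l0 Wy; pose M : set H := [set z | exists x x', T (x, x') /\ x' - l *: x = z].
suff : M y by [].
apply: contrapT => My.
have T_sub a a' b b' : T (a, a') -> T (b, b') -> T (a - b, a' - b').
  by move=> h h'; have := Tlin (-1) _ _ _ _ h' h; rewrite !scaleN1r !(addrC (- _)).
have M0 : closed_subspace M.
  split; first split.
  - by exists 0, 0; rewrite scaler0 subr0.
  - move=> c _ _ [a [a' [h <-]]] [b [b' [h' <-]]].
    by exists (c *: a + b), (c *: a' + b'); split; [exact: Tlin|vring].
  move=> z /closureP hz.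
  have hsol n : exists p : H * H, T p /\ nr (p.2 - l *: p.1 - z) <= 1 / n.+1%:R.
    have [_ [a [a' [h <-]]] ha] := hz (1 / n.+1%:R) ltac:(by apply: divr_gt0).
    by exists (a, a'); rewrite nrBC.
  have [p hp] := choice hsol.
  have hT' n : T ((p n).1, (p n).2) by have [] := hp n; case: (p n).
  have lz : seq_lim (fun n => (p n).2 - l *: (p n).1) z.
    by apply: (@seq_lim_le _ _ _ _ 1 0) => // n _; have [] := hp n.
  have [a ha] : exists a, seq_lim (fun n => (p n).1) a.
    apply: seq_complete => e e0.
    have el : 0 < e * - ImC l by rewrite mulr_gt0 // oppr_gt0.
    have [N hN] := seq_lim_cauchy lz el; exists N => n m nN mN.
    have h1 := dissipative_est (ltW l0) (diss (T_sub _ _ _ _ (hT' n) (hT' m))).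
    have := hN n m nN mN.
    have -> : (p n).2 - l *: (p n).1 - ((p m).2 - l *: (p m).1) =
      (p n).2 - (p m).2 - l *: ((p n).1 - (p m).1) by vring.
    move=> h2; rewrite -(ler_pM2r (_ : 0 < - ImC l)) ?oppr_gt0 //.
    by rewrite mulrC; apply: le_trans h1 h2.
  exists a, (z + l *: a); split; last by rewrite addrK.
  apply: (max_dissipative_closed hT' ha).
  have := seq_limD lz (seq_limZ l ha); congr seq_lim; apply/funext => n.
  by rewrite subrK.
have [m [Mm [v0 vorth]]] := orthogonal_complement dot_norm M0 My.
set v := y - m in v0 vorth.
have Wv : W v.
  have Wm : W m.
    have [a [a' [h <-]]] := Mm; have [Wa Wa'] := TW _ _ h.
    by rewrite addrC -scaleNr; exact: WL.
  by rewrite /v addrC -scaleN1r; exact: WL.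
clearbody v.
have vv : 0 < nr v ^+ 2.
  rewrite exprn_gt0 // lt_neqAle nr_ge0 andbT eq_sym.
  by apply: contra v0 => /eqP /nr_eq0 ->.
have dv a a' : T (a, a') -> dot a' v = l * dot a v.
  move=> h; have := vorth (a' - l *: a) (ex_intro _ a (ex_intro _ a' (conj h erefl))).
  by rewrite dotBl dotZl => /eqP; rewrite subr_eq0 => /eqP.
(* For c nonzero, (T (c v), c v) = l |c v|^2 would have negative imaginary part. So the extension is
   single-valued and proper. *)
have vdom c w : T (c *: v, w) -> c = 0.
  move=> h; apply/eqP; apply: contraT => c0; exfalso.
  have := diss h; rewrite dotZr (dv _ _ h) dotZl (dotxx dot_norm).
  have -> : c^* * (l * (c * (nr v ^+ 2)%:C)) = (c * c^*) * l * (nr v ^+ 2)%:C by ring.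
  rewrite -sqr_normc cmE -rmorphXn /=.
  have c2 : 0 < cm c ^+ 2 by rewrite exprn_gt0 // cm_gt0.
  case: (l) l0 => s t /= t0.
  rewrite !(mul0r, mulr0, subr0, add0r, addr0) leNgt => /negP; apply.
  by rewrite pmulr_llt0 // pmulr_rlt0.
pose T' : set (H * H) := [set p | exists a a' c, [/\ T (a, a'),
  p.1 = a + c *: v & p.2 = a' + (c * l^*) *: v]].
have TT' : T `<=` T'.
  move=> [a b] h; exists a, b, 0; split => //=.
    by rewrite scale0r addr0.
  by rewrite mul0r scale0r addr0.
suff TE : T' = T.
  have : T' (1 *: v, l^* *: v).
    exists 0, 0, 1; split => //=; first by rewrite add0r.
    by rewrite mul1r add0r.
  by rewrite TE => /vdom /eqP; rewrite oner_eq0.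
apply: Tmax => //; split.
- split.
  + move=> _ _ [a [a' [c [h /= -> ->]]]]; have [Wa Wa'] := TW _ _ h.
    by split; rewrite addrC; exact: WL.
  + exact: TT'.
  + move=> c _ _ _ _ [a [a' [s [h /= -> ->]]]] [b [b' [t [h' /= -> ->]]]].
    exists (c *: a + b), (c *: a' + b'), (c * s + t).
    by split => /=; [exact: Tlin | vring | vring].
  + move=> x _ _ [a [a' [s [h /= -> ->]]]] [b [b' [t [h' /= e ->]]]].
    have e' : a - b = (t - s) *: v.
      by rewrite -[a](addrK (s *: v)) e; vring.
    have ts : t - s = 0.
      by apply: (vdom _ (a' - b')); rewrite -e'; exact: T_sub.
    have st : s = t by apply/esym/eqP; rewrite -subr_eq0 ts.
    have ab : a = b by apply/eqP; rewrite -subr_eq0 e' ts scale0r.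
    by rewrite st; congr (_ + _); apply: Tfun h _; rewrite ab.
- move=> a Wa; apply: closureS (Tdense a Wa) => _ [p Tp <-].
  by exists p => //; exact: TT'.
move=> _ _ [a [a' [c [h /= -> ->]]]].
(* By orthogonality the two cross terms are complex conjugates, so only (a', a) and conj(l) |c v|^2
   contribute to the imaginary part. *)
rewrite dotDl !dotDr !dotZl !dotZr (dv _ _ h) (dotxx dot_norm) !raddfD /=.
have := diss h; have : dot v a = (dot a v)^* by exact: dotC.
move=> ->; rewrite [c * _ * (c^* * _)](_ : _ = (c * c^*) * l^* * (nr v ^+ 2)%:C); last by ring.
rewrite -sqr_normc cmE -rmorphXn /=.
move: (ImC (dot a' a)) (dot a v) => w p w0.
have c2 : 0 <= cm c ^+ 2 * (- ImC l * nr v ^+ 2).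
  by rewrite mulr_ge0 ?exprn_ge0 ?cm_ge0 // mulr_ge0 ?ltW // oppr_gt0.
move: (cm c ^+ 2) (nr v ^+ 2) c2 => C2 v2 c2.
case: (l) c2 c {vdom h} => s t; case: p => p1 p2 /= c2 [c1 c3] /=.
by lra.
Qed.

End MaximalDissipative.

(** * Consequences of compactness *)

Section Compactness.
Context {R : realType} {H : completeNormedModType R[i]}.

Lemma closure_prodP (A : set (H * H)) (p : H * H) :
  closure A p <-> forall e : R, 0 < e ->
    exists q, [/\ A q, nr (p.1 - q.1) <= e & nr (p.2 - q.2) <= e].
Proof.
split=> [h e e0|h B [[B1 B2] /= [/nbhs_nrP[e1 e10 h1] /nbhs_nrP[e2 e20 h2]] hB]].
  have [q [Aq [q1 q2]]] : A `&` ([set x | nr (p.1 - x) < e] `*` [set x | nr (p.2 - x) < e]) !=set0.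
    apply: h; exists ([set x | nr (p.1 - x) < e], [set x | nr (p.2 - x) < e]) => //=.
    by split; apply/nbhs_nrP; exists e.
  by exists q; split => //; apply/ltW.
have e0 : 0 < Num.min e1 e2 / 2 by rewrite divr_gt0 // lt_min e10.
have [q [Aq q1 q2]] := h _ e0; exists q; split => //; apply: hB.
have hlt : Num.min e1 e2 / 2 < Num.min e1 e2 by rewrite ltr_pdivrMr //; lra.
split => /=; [apply: h1|apply: h2].
  by apply: le_lt_trans q1 _; apply: lt_le_trans hlt _; rewrite ge_min lexx.
by apply: le_lt_trans q2 _; apply: lt_le_trans hlt _; rewrite ge_min lexx orbT.
Qed.

Lemma precompact_cluster (B : set H) (u : nat -> H) : precompact B ->
  (forall n, B (u n)) ->
  exists g, forall e : R, 0 < e -> forall N, exists2 n, (N <= n)%N & nr (u n - g) <= e.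
Proof.
rewrite precompactE => cB hu.
have cF : (u @ \oo) (closure B).
  by exists 0%N => // n _; apply: subset_closure; exact: hu.
have [g [_ hg]] := cB (u @ \oo) _ cF.
exists g => e e0 N.
have h1 : (u @ \oo) (u @` [set n | (N <= n)%N]) by exists N => // n /= Nn; exists n.
have h2 : nbhs g [set x | nr (g - x) < e] by apply/nbhs_nrP; exists e.
have [_ [[n Nn <-] hn]] := hg _ _ h1 h2.
by exists n => //; rewrite nrBC; exact: ltW.
Qed.

Lemma precompact_bounded (B : set H) : precompact B ->
  exists2 M : R, 0 <= M & forall x, B x -> nr x <= M.
Proof.
move=> cB; apply: contrapT => hn.
have hsol n : exists x, B x /\ n%:R < nr x.
  apply: contrapT => h; apply: hn; exists n%:R => // x Bx.
  by rewrite leNgt; apply/negP => hx; apply: h; exists x.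
have [u hu] := choice hsol.
have [g hg] := precompact_cluster cB (fun n => proj1 (hu n)).
have [n Nn hgn] := hg 1 ltr01 (Num.truncn (nr g + 1)).+1.
have [_ h1] := hu n; have := nr_triangle (u n) g 0; rewrite !subr0.
have : nr g + 1 < n%:R.
  by apply: lt_le_trans (truncnS_gt _) _; rewrite ler_nat.
lra.
Qed.

(** Compactness of the rectangle in near-covering form, with the filter of M tending to infinity: as
    [P] is monotone in M, the local bounds merge into one. *)
Lemma rectangle_bound (P : R -> R[i] -> Prop) (e r : R) :
  (forall M M' l, M <= M' -> P M l -> P M' l) ->
  (forall l, ImC l < 0 -> exists M (d : R), 0 < d /\
     forall l', cm (l - l') <= d -> P M l') ->
  0 < e -> exists M, forall l, ImC l <= - e -> cm l <= r -> P M l.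
Proof.
move=> Pmono Ploc e0.
pose K : set (R * R) := `[- r, r]%classic `*` `[- r, - e]%classic.
have Kc : compact K by apply: compact_setX; exact: segment_compact.
have /compact_near_coveringP hK := Kc.
have := hK R (pinfty_nbhs R) (fun M p => P M (p.1 +i* p.2)) _.
case.
  move=> [a b] [/= ha]; rewrite in_itv /= => /andP[_ hb].
  have [M [d [d0 hd]]] := Ploc (a +i* b) ltac:(rewrite /=; lra).
  exists ([set p : R * R | `|a - p.1| < d / 2 /\ `|b - p.2| < d / 2], [set M' | M < M']) => /=.
    split.
      exists ([set x | `|a - x| < d / 2], [set x | `|b - x| < d / 2]) => /=.
        split; apply/nbhs_ballP; exists (d / 2) => //=; lra.
      by move=> [x y] [].
    by exists M; split => //; exact: num_real.
  move=> [[x y] M'] [/= [hx hy] hM]; apply: Pmono (ltW hM) _.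
  apply: hd; apply: le_trans (cm_le_ReIm _) _ => /=; lra.
move=> M [_ hM]; exists (M + 1) => l hl lr.
have := hM (M + 1) ltac:(by rewrite ltrDl) (ReC l, ImC l).
rewrite /= [X in P _ X](_ : _ = l); last by case: (l).
apply; split => /=; rewrite in_itv /=.
  by rewrite -ler_norml (le_trans (ler_Re_cm _)).
have := le_trans (ler_Im_cm l) lr; rewrite ler_norml => /andP[h _].
by rewrite h hl.
Qed.

End Compactness.

(** * Block entries and the Schur complement *)

Section Projections.
Context {R : realType} {H : completeNormedModType R[i]}.
Variable dot : {dot H for @Num.conj R[i]}.
Hypothesis dot_norm : forall x, `|x| ^+ 2 = dot x x.
Variables (Pp Pm : {linear H -> H}).
Hypothesis hP : complementary_projections dot Pp Pm.

Lemma projC : complementary_projections dot Pm Pp.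
Proof. by have [h1 h2 h3] := hP; split => // x; rewrite addrC h3. Qed.

Lemma proj_idem x : Pp (Pp x) = Pp x.
Proof. by have [[h _] _ _] := hP; exact: h. Qed.

Lemma proj_range x : range Pp x <-> Pp x = x.
Proof. by split => [[y _ <-]|<-]; [exact: proj_idem | exists x]. Qed.

Lemma proj_compl0 x : Pp (Pm x) = 0.
Proof.
have [_ _ h] := hP; have := congr1 Pp (h x).
by rewrite linearD proj_idem => /(congr1 (fun v => - Pp x + v)); rewrite addKr addNr.
Qed.

Lemma proj_sqr x : nr (Pp x) ^+ 2 + nr (Pm x) ^+ 2 = nr x ^+ 2.
Proof.
have [[_ h1] _ h] := hP; rewrite -[in RHS](h x) (nr_sqrD dot_norm).
by rewrite /rdot h1 proj_compl0 dotC dotC /= linear0r mulr0 addr0.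
Qed.

Lemma nr_proj x : nr (Pp x) <= nr x.
Proof.
rewrite -(ler_pXn2r (n := 2)) ?nnegrE ?nr_ge0 // -(proj_sqr x).
by rewrite lerDl exprn_ge0 // nr_ge0.
Qed.

Lemma proj_lim (u : nat -> H) x : seq_lim u x -> seq_lim (fun n => Pp (u n)) (Pp x).
Proof.
move=> h e /h[N hN]; exists N => n /hN; rewrite -linearB.
exact: le_trans (nr_proj _).
Qed.

Lemma range_closed_subspace : closed_subspace (range Pp).
Proof.
split; first split.
- by apply/proj_range; rewrite linear0.
- by move=> c x y /proj_range hx /proj_range hy; apply/proj_range; rewrite linearP hx hy.
move=> x /closureP hx; apply/proj_range/eqP; rewrite -subr_eq0; apply/eqP.
apply: nr_small_eq0 => e e0; have [y /proj_range hy xy] := hx (e / 2) ltac:(lra).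
have -> : Pp x - x = Pp (x - y) - (x - y) by rewrite linearB hy; vring.
by apply: le_trans (nrB _ _) _; have := nr_proj (x - y); lra.
Qed.

End Projections.

Lemma ler_lincomb_approx (R : realFieldType) (a b p k w : R) :
  0 <= a -> 0 <= b ->
  (forall d, 0 < d -> exists p' k' w',
     [/\ p' <= p + d, k <= k' + d, w' <= w + d & k' <= a * p' + b * w']) ->
  k <= a * p + b * w.
Proof.
move=> a0 b0 h; apply/ler_addgt0Pr => d d0.
have s0 : 0 < 1 + a + b by lra.
have [p' [k' [w' [h1 h2 h3 h4]]]] := h _ (divr_gt0 d0 s0).
have dE : d / (1 + a + b) * (1 + a + b) = d by rewrite divfK // gt_eqF.
have := ler_wpM2l a0 h1; have := ler_wpM2l b0 h3.
by move: (d / _) dE h2 => r rE h2 h5 h6; lra.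
Qed.

Section Blocks.
Context {R : realType} {H : completeNormedModType R[i]}.
Variable dot : {dot H for @Num.conj R[i]}.
Hypothesis dot_norm : forall x, `|x| ^+ 2 = dot x x.
Variables (Pp Pm : {linear H -> H}) (A : set (H * H)).
Hypothesis hP : complementary_projections dot Pp Pm.
Hypothesis A_lin : linear_operator [set: H] [set: H] A.
Let Hp := range Pp.
Let Hm := range Pm.
Let A11 := op_block Pp A Hp.
Let A12 := op_block Pp A Hm.
Let A21 := op_block Pm A Hp.
Let A22 := op_block Pm A Hm.
Let F mu := op_comp (op_inv (op_shift A22 mu)) A21.
Let G mu := op_comp A12 (op_inv (op_shift A22 mu)).
Hypothesis A22_max : max_dissipative dot Hm (op_scale (- 1) A22).

Implicit Types (mu : R[i]) (x y : H).

Let PmZ (c : R[i]) x : Pm (c *: x) = c *: Pm x. Proof. exact: linearZ. Qed.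
Let PmD x y : Pm (x + y) = Pm x + Pm y. Proof. exact: linearD. Qed.
Let PpD x y : Pp (x + y) = Pp x + Pp y. Proof. exact: linearD. Qed.
Let PpZ (c : R[i]) x : Pp (c *: x) = c *: Pp x. Proof. exact: linearZ. Qed.

Lemma op_blockP (P : H -> H) (V : set H) x z :
  op_block P A V (x, z) <-> exists y, [/\ A (x, y), V x & z = P y].
Proof.
split=> [[[x' y] [/= h1 h2] [<- <-]]|[y [h1 h2 ->]]]; first by exists y.
by exists (x, y).
Qed.

Lemma op_shift_blockP (P : H -> H) (V : set H) mu w x :
  op_inv (op_shift (op_block P A V) mu) (w, x) <->
  exists y, [/\ A (x, y), V x & w = P y - mu *: x].
Proof.
split=> [[_ [[x' z] /op_blockP[y [h1 h2 ->]] <-] /= [<- <-]]|[y [h1 h2 ->]]].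
  by exists y.
by exists (x, P y - mu *: x) => //; exists (x, P y) => //; apply/op_blockP; exists y.
Qed.

Let Hm_sub : closed_subspace Hm. Proof. exact: (range_closed_subspace dot_norm (projC hP)). Qed.

Let HmL (c : R[i]) x y : Hm x -> Hm y -> Hm (c *: x + y).
Proof. by have [[_ h] _] := Hm_sub; exact: h. Qed.

Let HmB x y : Hm x -> Hm y -> Hm (x - y).
Proof. by move=> h1 h2; have := HmL (-1) h2 h1; rewrite scaleN1r addrC. Qed.

Let AL (c : R[i]) x x' y y' : A (x, y) -> A (x', y') -> A (c *: x + x', c *: y + y').
Proof. by have [_ _ h _] := A_lin; exact: h. Qed.

Let AB x x' y y' : A (x, y) -> A (x', y') -> A (x - x', y - y').
Proof. by move=> h1 h2; have := AL (-1) h2 h1; rewrite !scaleN1r !(addrC (- _)). Qed.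

Let AD x x' y y' : A (x, y) -> A (x', y') -> A (x + x', y + y').
Proof. by move=> h1 h2; have := AL 1 h1 h2; rewrite !scale1r. Qed.

Let HmD x y : Hm x -> Hm y -> Hm (x + y).
Proof. by move=> h1 h2; have := HmL 1 h1 h2; rewrite scale1r. Qed.

Let A22P x z : op_scale (- 1) A22 (x, z) <-> exists y, [/\ A (x, y), Hm x & z = - Pm y].
Proof.
split=> [[[x' z'] /op_blockP[y [h1 h2 ->]] /= [<- <-]]|[y [h1 h2 ->]]].
  by exists y; rewrite scaleN1r.
by exists (x, Pm y); [apply/op_blockP; exists y|rewrite /= scaleN1r].
Qed.

Lemma A22_onto mu w : 0 < ImC mu -> Hm w ->
  exists x y, [/\ A (x, y), Hm x & Pm y - mu *: x = w].
Proof.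
move=> mu0 hw.
have hw' : Hm (- w) by have := HmB (HmB hw hw) hw; rewrite subrr sub0r.
have l0 : ImC (- mu) < 0 by rewrite raddfN /= oppr_lt0.
have [x [x' [/A22P[y [h1 h2 ->]] e]]] := max_dissipative_onto dot_norm Hm_sub A22_max l0 hw'.
exists x, y; split => //; apply: oppr_inj; rewrite -e; vring.
Qed.

Lemma A22_est mu x y : 0 < ImC mu -> A (x, y) -> Hm x ->
  ImC mu * nr x <= nr (Pm y - mu *: x).
Proof.
move=> mu0 h1 h2; have [[_ _ h] _] := A22_max.
have hd : 0 <= ImC (dot (- Pm y) x) by apply: h; apply/A22P; exists y.
have l0 : ImC (- mu) <= 0 by rewrite raddfN /= oppr_le0 ltW.
have := dissipative_est dot_norm l0 hd.
by rewrite raddfN /= opprK -[nr (_ - _)]nrN; congr (_ <= nr _); vring.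
Qed.

Let A22_closed (u v : nat -> H) x z : (forall n, A (u n, v n)) ->
  (forall n, Hm (u n)) -> seq_lim u x -> seq_lim (fun n => Pm (v n)) z ->
  exists y, [/\ A (x, y), Hm x & z = Pm y].
Proof.
move=> h1 h2 h3 h4.
have := @max_dissipative_closed _ _ _ dot_norm _ _ Hm_sub A22_max u (fun n => - Pm (v n)) x (- z).
case/(_ _ h3 _)/A22P => [n||y [? ? /oppr_inj e]]; last by exists y.
  by apply/A22P; exists (v n).
have := seq_limZ (-1) h4; rewrite scaleN1r; congr seq_lim; apply/funext => n.
by rewrite scaleN1r.
Qed.

Let Hm_Pm x : Hm (Pm x). Proof. by exists x. Qed.

Variable mu0 : R[i].
Hypothesis mu0_gt0 : 0 < ImC mu0.
Hypothesis F_bounded : op_bounded (F mu0).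
Hypothesis G_compact : compact_operator Hm Hp (G mu0).

Let GP mu w g : G mu (w, g) <->
  exists x y, [/\ A (x, y), Hm x, w = Pm y - mu *: x & g = Pp y].
Proof.
have [_ _ _ Afun] := A_lin.
split=> [[x /= [/op_shift_blockP[y [h1 h2 h3]] /op_blockP[y' [h4 h5 h6]]]]|].
  by exists x, y; split => //; rewrite h6 (Afun _ _ _ h1 h4).
move=> [x [y [h1 h2 h3 h4]]]; exists x; split => /=.
  by apply/op_shift_blockP; exists y.
by apply/op_blockP; exists y.
Qed.

Let G0_bounded : exists2 M : R, 0 <= M & forall x y, A (x, y) -> Hm x ->
  nr (Pp y) <= M * nr (Pm y - mu0 *: x).
Proof.
have [_ _ /precompact_bounded[M M0 hM]] := G_compact.
exists M => // x y h1 h2; set w := Pm y - mu0 *: x.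
have [w0|w0] := eqVneq (nr w) 0.
  have x0 : x = 0.
    have := A22_est mu0_gt0 h1 h2; rewrite -/w w0 => h.
    apply: nr_eq0; apply/eqP; rewrite eq_le nr_ge0 andbT.
    by rewrite -(ler_pM2l mu0_gt0) mulr0.
  have [_ A0 _ Afun] := A_lin; rewrite x0 in h1.
  by rewrite (Afun _ _ _ h1 A0) linear0 nr0 mulr_ge0 ?nr_ge0.
have wp : 0 < nr w by rewrite lt_neqAle eq_sym w0 nr_ge0.
pose c : R[i] := ((nr w)^-1)%:C.
have cc : cm c = (nr w)^-1 by rewrite cmR ger0_norm // invr_ge0 nr_ge0.
have [_ A0 _ _] := A_lin.
have hm : nr (c *: Pp y) <= M.
  apply: hM; exists (c *: w); split.
    by rewrite nrE nrZ cc mulVf.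
  apply/GP; exists (c *: x), (c *: y); split.
  - by have := AL c h1 A0; rewrite !addr0.
  - by have [[Hm0 _] _] := Hm_sub; have := HmL c h2 Hm0; rewrite addr0.
  - by rewrite /w PmZ; vring.
  - by rewrite PpZ.
by move: hm; rewrite nrZ cc mulrC ler_pdivrMr.
Qed.

(** A22 - mu0 = (A22 - mu) + (mu - mu0), and (A22 - mu)^-1 has norm at most 1/Im mu because -A22 is
    dissipative. *)
Lemma G_bounded mu : 0 < ImC mu -> exists2 M : R, 0 <= M & forall x y,
  A (x, y) -> Hm x -> nr (Pp y) <= M * nr (Pm y - mu *: x).
Proof.
move=> mup; have [M M0 hM] := G0_bounded.
have c0 := cm_ge0 (mu - mu0).
exists (M * (1 + cm (mu - mu0) / ImC mu)).
  by rewrite mulr_ge0 // addr_ge0 // divr_ge0 // ltW.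
move=> x y h1 h2; apply: le_trans (hM _ _ h1 h2) _; rewrite -mulrA ler_wpM2l //.
rewrite (_ : Pm y - mu0 *: x = (Pm y - mu *: x) + (mu - mu0) *: x); last by vring.
apply: le_trans (nrD _ _) _; rewrite mulrDl mul1r lerD2l nrZ -mulrA ler_wpM2l //.
by rewrite mulrC ler_pdivlMr // mulrC A22_est.
Qed.

(* The resolvent factor (A22 - mu0)(A22 - mu)^-1 is bounded and tends weakly to
   0 as mu = i(n+1) goes to infinity; convex combinations make this strong. *)
Lemma G_small (gam : R) : 0 < gam -> exists2 mu, 0 < ImC mu & forall x y,
  A (x, y) -> Hm x -> nr (Pp y) <= gam * nr (Pm y - mu *: x).
Proof.
move=> gam0; apply: contrapT => hn.
have [_ A0 _ Afun] := A_lin; have [[Hm0 _] _] := Hm_sub.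
have [M M0 hM] := G0_bounded.
pose mu n : R[i] := 0 +i* n.+1%:R.
(* If the claim fails at mu n = i (n + 1), some x_n has |(A22 - mu n) x_n| = 1 and |P+ A x_n| >=
   gam; dissipativity then gives |x_n| <= 1/(n + 1). *)
have hsol n : exists p : H * H, [/\ A p, Hm p.1,
    nr (Pm p.2 - mu n *: p.1) = 1 & gam <= nr (Pp p.2)].
  have mun : 0 < ImC (mu n) by rewrite /= ltr0n.
  apply: contrapT => hp; apply: hn; exists (mu n) => // x y h1 h2.
  rewrite leNgt; apply/negP => hlt; apply: hp.
  set w := Pm y - mu n *: x in hlt.
  have wp : 0 < nr w.
    rewrite lt_neqAle nr_ge0 andbT eq_sym; apply/eqP => w0.
    have x0 : x = 0.
      have := A22_est mun h1 h2; rewrite -/w w0 => h.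
      apply: nr_eq0; apply/eqP; rewrite eq_le nr_ge0 andbT.
      by rewrite -(ler_pM2l mun) mulr0.
    by move: hlt; rewrite x0 in h1; rewrite (Afun _ _ _ h1 A0) linear0 nr0 w0 mulr0 ltxx.
  pose c : R[i] := ((nr w)^-1)%:C.
  have cc : cm c = (nr w)^-1 by rewrite cmR ger0_norm // invr_ge0 nr_ge0.
  exists (c *: x, c *: y); split => /=.
  - by have := AL c h1 A0; rewrite !addr0.
  - by have := HmL c h2 Hm0; rewrite addr0.
  - rewrite (_ : _ - _ = c *: w); last by rewrite /w PmZ; vring.
    by rewrite nrZ cc mulVf // gt_eqF.
  - by rewrite PpZ nrZ cc mulrC ler_pdivlMr // ltW.
have [p hp] := choice hsol.
have hA n : A ((p n).1, (p n).2) by have [h _ _ _] := hp n; case: (p n) h.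
have hH n : Hm (p n).1 by have [] := hp n.
have hx n : nr (p n).1 <= n.+1%:R^-1.
  have [_ _ h3 _] := hp n.
  have := @A22_est (mu n) _ _ ltac:(by rewrite /= ltr0n) (hA n) (hH n).
  by rewrite h3 /= mulrC -ler_pdivlMr // div1r.
(* (A22 - mu0) x_n has norm at most 1 + (n + 1 + |mu0|)/(n + 1) <= c, so compactness of G(mu0)
   applies to these vectors. *)
pose c := 2 + cm mu0; have c0 := cm_ge0 mu0.
have hz n : nr (Pm (p n).2 - mu0 *: (p n).1) <= c.
  have [_ _ h3 _] := hp n.
  rewrite (_ : _ - _ = (Pm (p n).2 - mu n *: (p n).1) + (mu n - mu0) *: (p n).1); last by vring.
  apply: le_trans (nrD _ _) _; rewrite h3 nrZ /c -[2]/(1 + 1) -addrA lerD2l.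
  have n0 : 0 < n.+1%:R :> R by [].
  have h4 := hx n; have h5 := cmB (mu n) mu0.
  have h6 : cm (mu n) <= n.+1%:R.
    by apply: le_trans (cm_le_ReIm _) _; rewrite /= normr0 add0r ger0_norm.
  apply: le_trans (_ : (n.+1%:R + cm mu0) * n.+1%:R^-1 <= _).
    by rewrite ler_pM ?cm_ge0 ?nr_ge0 //; lra.
  rewrite mulrDl mulfV ?gt_eqF // lerD2l ler_pdivrMr // ler_peMr // ler1n.
  done.
have c1 : 0 < c by rewrite /c; lra.
have [g hg] : exists g, forall e : R, 0 < e -> forall N,
    exists2 n, (N <= n)%N & nr (Pp (p n).2 - g) <= e.
  have [_ _ Gc] := G_compact.
  have [|g hg] := @precompact_cluster _ _ _ (fun n => (c^-1)%:C *: Pp (p n).2) Gc.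
    move=> n; exists ((c^-1)%:C *: (Pm (p n).2 - mu0 *: (p n).1)); split.
      rewrite nrE lecR nrZ cmR gtr0_norm ?invr_gt0 //.
      by rewrite mulrC ler_pdivrMr // mul1r.
    apply/GP; exists ((c^-1)%:C *: (p n).1), ((c^-1)%:C *: (p n).2); split.
    - by have := AL (c^-1)%:C (hA n) A0; rewrite !addr0.
    - by have := HmL (c^-1)%:C (hH n) Hm0; rewrite addr0.
    - by rewrite PmZ; vring.
    - by rewrite PpZ.
  exists (c%:C *: g) => e e0 N.
  have [n Nn hn'] := hg (e / c) ltac:(by apply: divr_gt0) N; exists n => //.
  have -> : Pp (p n).2 - c%:C *: g = c%:C *: ((c^-1)%:C *: Pp (p n).2 - g).
    by rewrite scalerBr scalerA -rmorphM /= mulfV ?gt_eqF // scale1r.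
  by rewrite nrZ cmR gtr0_norm // mulrC -ler_pdivlMr.
have gg : gam <= nr g.
  apply/ler_addgt0Pr => e e0; have [n _ h] := hg e e0 0%N.
  have [_ _ _ h4] := hp n.
  by have := nr_triangle (Pp (p n).2) g 0; rewrite !subr0; lra.
(* K n is convex and contains (A22 - mu0) x_m for some m >= n. Elements of almost minimal norm
   converge strongly; the corresponding x tend to 0 and A22 is closed, so the limit is 0.
   Boundedness of G(mu0) then contradicts |g| >= gam. *)
pose K n : set H := [set z | exists x y, [/\ A (x, y), Hm x, z = Pm y - mu0 *: x,
  nr x <= n.+1%:R^-1 & nr (Pp y - g) <= gam / 2]].
have Kconv n x y : K n x -> K n y -> K n (2^-1%:C *: (x + y)).
  move=> [x1 [y1 [a1 b1 -> d1 e1]]] [x2 [y2 [a2 b2 -> d2 e2]]].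
  exists (2^-1%:C *: (x1 + x2)), (2^-1%:C *: (y1 + y2)); split.
  - by have := AL (2^-1%:C) (AD a1 a2) A0; rewrite !addr0.
  - by have := HmL (2^-1%:C) (HmD b1 b2) Hm0; rewrite addr0.
  - by rewrite PmZ PmD; vring.
  - rewrite nrZ cmR gtr0_norm //; have := nrD x1 x2.
    by move: (n.+1%:R^-1) d1 d2 => q d1 d2; lra.
  - have hh : 2^-1%:C + 2^-1%:C = 1 :> R[i].
      by rewrite -rmorphD /= (_ : 2^-1 + 2^-1 = 1) //; field.
    rewrite PpZ PpD -[g]scale1r -hh.
    rewrite (_ : _ - _ = 2^-1%:C *: ((Pp y1 - g) + (Pp y2 - g))); last by vring.
    rewrite nrZ cmR gtr0_norm //; have := nrD (Pp y1 - g) (Pp y2 - g); lra.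
have inv_mono n m : (n <= m)%N -> m.+1%:R^-1 <= n.+1%:R^-1 :> R.
  by move=> nm; rewrite lef_pV2 ?posrE // ler_nat.
have Kdecr n m : (n <= m)%N -> K m `<=` K n.
  move=> nm z [x [y [h1 h2 h3 h4 h5]]]; exists x, y; split => //.
  exact: le_trans h4 (inv_mono _ _ nm).
have Kne n : exists2 z, K n z & nr z <= c.
  have [m nm hm] := hg (gam / 2) ltac:(lra) n.
  exists (Pm (p m).2 - mu0 *: (p m).1) => //.
  exists (p m).1, (p m).2; split => //.
  exact: le_trans (hx m) (inv_mono _ _ nm).
have [z [Kz zc _]] := nested_convex_cauchy dot_norm Kconv Kdecr Kne.
have [l hl] := seq_complete zc.
have hq n : exists q : H * H, [/\ A q, Hm q.1, z n = Pm q.2 - mu0 *: q.1,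
    nr q.1 <= n.+1%:R^-1 & nr (Pp q.2 - g) <= gam / 2].
  by have [x [y h]] := Kz n; exists (x, y).
have [q {}hq] := choice hq.
have qA n : A ((q n).1, (q n).2) by have [h _ _ _ _] := hq n; case: (q n) h.
have qH n : Hm (q n).1 by have [] := hq n.
have ql : seq_lim (fun n => (q n).1) 0.
  apply: (@seq_lim_le _ _ _ _ 1 0) => // n _; rewrite subr0 div1r.
  by have [] := hq n.
have qPm : seq_lim (fun n => Pm (q n).2) l.
  have := seq_limD hl (seq_limZ mu0 ql); rewrite scaler0 addr0.
  congr seq_lim; apply/funext => n; have [_ _ -> _ _] := hq n.
  by rewrite subrK.
have [y [hy _ ly]] := A22_closed qA qH ql qPm.
have l0 : l = 0 by rewrite ly (Afun _ _ _ hy A0) linear0.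
rewrite l0 in hl.
have [N hN] := hl (gam / 4 / (M + 1)) ltac:(by apply: divr_gt0; lra).
have := hN N (leqnn N); rewrite subr0 ler_pdivlMr; last by lra.
have [_ _ zE _ hgN] := hq N.
have := hM _ _ (qA N) (qH N); rewrite -zE.
have := nr_triangle g (Pp (q N).2) 0; rewrite !subr0 nrBC.
have := nr_ge0 (z N); nra.
Qed.

Let FP mu x f : F mu (x, f) <-> exists a c,
  [/\ A (x, a), Hp x, A (f, c), Hm f & Pm a = Pm c - mu *: f].
Proof.
split=> [[z /= [/op_blockP[a [h1 h2 ->]] /op_shift_blockP[c [h3 h4 h5]]]]|].
  by exists a, c.
move=> [a [c [h1 h2 h3 h4 h5]]]; exists (Pm a); split => /=.
  by apply/op_blockP; exists a.
by apply/op_shift_blockP; exists c.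
Qed.

(** By the resolvent identity, F(mu) x - F(mu0) x = (mu - mu0) (A22 - mu)^-1 F(mu0) x. *)
Lemma F_bounded_all mu : 0 < ImC mu -> exists2 M : R, 0 <= M &
  forall x f, F mu (x, f) -> nr f <= M * nr x.
Proof.
move=> mup; have [M0 hM0] := F_bounded.
have c0 := cm_ge0 (mu - mu0).
pose M := `|M0|; have hM x f : F mu0 (x, f) -> nr f <= M * nr x.
  move/hM0; rewrite !nrE -rmorphM lecR => h; apply: le_trans h _.
  by rewrite ler_wpM2r ?nr_ge0 // ler_norm.
exists ((1 + cm (mu - mu0) / ImC mu) * M).
  by rewrite mulr_ge0 ?normr_ge0 // addr_ge0 // divr_ge0 // ltW.
move=> x f /FP[a [c [h1 h2 h3 h4 h5]]].
have [f0 [c' [h3' h4' h5']]] := A22_onto mu0_gt0 (Hm_Pm a).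
have hf0 : nr f0 <= M * nr x by apply: hM; apply/FP; exists a, c'; split.
have hd := A22_est mup (AB h3 h3') (HmB h4 h4').
have e1 : Pm (c - c') - mu *: (f - f0) = (mu - mu0) *: f0.
  have e2 : Pm c' = Pm c - mu *: f + mu0 *: f0 by rewrite -h5 -h5' subrK.
  by rewrite linearB e2; vring.
rewrite e1 nrZ mulrC -ler_pdivlMr // in hd.
apply: le_trans (_ : (1 + cm (mu - mu0) / ImC mu) * nr f0 <= _); last first.
  by rewrite -mulrA ler_wpM2l // addr_ge0 // divr_ge0 // ltW.
have := nr_triangle f f0 0; rewrite !subr0 => h.
by apply: le_trans h _; rewrite mulrDl mul1r addrC lerD2l mulrAC.
Qed.

Let preS mu := op_sub A11 (op_comp A12 (F mu)).

Hypothesis A_core : closure (op_restrict A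
  [set x + y | x in op_dom A `&` Hp & y in op_dom A `&` Hm]) = A.

Let Pp_Hm x : Hm x -> Pp x = 0.
Proof. by move=> [y _ <-]; exact: (proj_compl0 hP). Qed.

Let Pm_Hp x : Hp x -> Pm x = 0.
Proof. by move=> [y _ <-]; exact: (proj_compl0 (projC hP)). Qed.

Let Pp_Hp x : Hp x -> Pp x = x. Proof. by move/(proj_range hP). Qed.
Let Pm_Hm x : Hm x -> Pm x = x. Proof. by move/(proj_range (projC hP)). Qed.

(* With g = (A22 - mu)^-1 P- (A - mu) x and k = A g one has
   P+ A x - P+ k = S(mu) P+ x.  As F(mu') is bounded, replacing mu by mu' in
   P+ k = G(mu) P- (A - mu) x changes it by at most a multiple of |P+ x|. *)
Lemma schur_core mu gam : 0 < ImC mu -> 0 < gam ->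
  exists (e : R) mu', 0 <= e /\ forall q, A q ->
    [set x + y | x in op_dom A `&` Hp & y in op_dom A `&` Hm] q.1 ->
    exists g k, [/\ A (g, k), Hm g,
      Pm k - mu *: g = Pm q.2 - mu *: Pm q.1,
      preS mu (Pp q.1, Pp q.2 - Pp k) &
      nr (Pp k) <= e * nr (Pp q.1) + gam * nr (Pm q.2 - mu' *: Pm q.1)].
Proof.
move=> mup gam0; have [mu' mup' hG'] := G_small gam0.
have [M M0 hM] := G_bounded mup; have [N N0 hN] := F_bounded_all mup'.
exists (M * cm (mu - mu') * N), mu'; split.
  by rewrite !mulr_ge0 ?cm_ge0.
have [_ _ _ Afun] := A_lin.
move=> [q1 q2] /= Aq [x1 [[[a1 y1] /= A1 e1] Hx1] [x2 [[[a2 y2] /= A2 e2] Hx2] qE]].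
rewrite e1 in A1; rewrite e2 in A2.
have q2E : q2 = y1 + y2 by apply: Afun Aq _; rewrite -qE; exact: AD.
have Pq1 : Pp q1 = x1 by rewrite -qE PpD (Pp_Hp Hx1) (Pp_Hm Hx2) addr0.
have Pq2 : Pm q1 = x2 by rewrite -qE PmD (Pm_Hp Hx1) (Pm_Hm Hx2) add0r.
(* With q1 = x1 + x2 split along H+ and H-, f = F(mu) x1 and f' = F(mu') x1, and the g sought is f +
   x2. *)
have [f [c [h1 h2 h3]]] := A22_onto mup (Hm_Pm y1).
have [f' [c' [h1' h2' h3']]] := A22_onto mup' (Hm_Pm y1).
have hF' : F mu' (x1, f') by apply/FP; exists y1, c'; split.
exists (f + x2), (c + y2); rewrite Pq1 Pq2; split.
- exact: AD.
- exact: HmD.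
- by rewrite q2E !PmD -h3; vring.
- exists (Pp y1), (Pp c); split => /=.
  + by apply/op_blockP; exists y1.
  + exists f; split => /=; first by apply/FP; exists y1, c; split.
    by apply/op_blockP; exists c.
  by rewrite q2E !PpD; vring.
(* The second term is G(mu') applied to P- (A - mu') x, small by the choice of mu'; the first is
   G(mu) applied to (mu - mu') F(mu') x1, hence of order |x1|. *)
have -> : Pp (c + y2) = Pp (c - c') + Pp (c' + y2).
  by rewrite -PpD; congr (Pp _); vring.
apply: le_trans (nrD _ _) (lerD _ _); last first.
  apply: le_trans (hG' _ _ (AD h1' A2) (HmD h2' Hx2)) _.
  rewrite ler_wpM2l ?(ltW gam0) // q2E !PmD -h3'.
  rewrite (_ : _ - mu' *: (f' + x2) = Pm c' - mu' *: f' + Pm y2 - mu' *: x2) //.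
  by vring.
apply: le_trans (hM _ _ (AB h1 h1') (HmB h2 h2')) _.
have -> : Pm (c - c') - mu *: (f - f') = (mu - mu') *: f'.
  have cE : Pm c' = Pm c - mu *: f + mu' *: f' by rewrite h3 -h3' subrK.
  by rewrite linearB cE; vring.
by rewrite nrZ -!mulrA ler_wpM2l // ler_wpM2l ?cm_ge0 // hN.
Qed.

(** Extension from the core by approximation in the graph norm. P+ k is G(mu) applied to P- (A - mu)
    x, and G(mu) is bounded, so P+ k converges along with x and A x, and the limit pair falls into
    the closure S(mu). *)
Lemma schur_est mu gam : 0 < ImC mu -> 0 < gam ->
  exists (e : R) mu', 0 <= e /\ forall x y, A (x, y) ->
    exists s, closure (preS mu) (Pp x, s) /\
      nr (Pp y - s) <= e * nr (Pp x) + gam * nr (Pm y - mu' *: Pm x).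
Proof.
move=> mup gam0; have [e [mu' [e0 hcore]]] := schur_core mup gam0.
have [M M0 hM] := G_bounded mup.
exists e, mu'; split => // x y hxy.
have hsol n : exists t : (H * H) * (H * H), [/\ nr (x - t.1.1) <= 1 / n.+1%:R,
    nr (y - t.1.2) <= 1 / n.+1%:R, A t.2 /\ Hm t.2.1,
    Pm t.2.2 - mu *: t.2.1 = Pm t.1.2 - mu *: Pm t.1.1 &
    preS mu (Pp t.1.1, Pp t.1.2 - Pp t.2.2) /\ nr (Pp t.2.2) <=
      e * nr (Pp t.1.1) + gam * nr (Pm t.1.2 - mu' *: Pm t.1.1)].
  have n0 : 0 < 1 / n.+1%:R :> R by apply: divr_gt0.
  have /closure_prodP/(_ _ n0)[q [[Aq Dq] q1 q2]] : closure (op_restrict A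
    [set x + y | x in op_dom A `&` Hp & y in op_dom A `&` Hm]) (x, y) by rewrite A_core.
  have [g [k [h1 h2 h3 h4 h5]]] := hcore q Aq Dq.
  by exists (q, (g, k)).
have [t ht] := choice hsol.
have lx : seq_lim (fun n => (t n).1.1) x.
  by apply: (@seq_lim_le _ _ _ _ 1 0) => // n _; rewrite nrBC; have [] := ht n.
have ly : seq_lim (fun n => (t n).1.2) y.
  by apply: (@seq_lim_le _ _ _ _ 1 0) => // n _; rewrite nrBC; have [] := ht n.
have lPpx := proj_lim dot_norm hP lx.
have lPpy := proj_lim dot_norm hP ly.
have lPmx := proj_lim dot_norm (projC hP) lx.
have lPmy := proj_lim dot_norm (projC hP) ly.
have tA n : A ((t n).2.1, (t n).2.2) by have [_ _ [h _] _ _] := ht n; case: (t n).2 h.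
have tH n : Hm (t n).2.1 by have [_ _ [_ h] _ _] := ht n.
have [kap lkap] : exists kap, seq_lim (fun n => Pp (t n).2.2) kap.
  apply: seq_complete => d d0; have M1 : 0 < M + 1 by rewrite ltr_wpDl.
  have [N hN] := seq_lim_cauchy (seq_limB lPmy (seq_limZ mu lPmx))
    (e := d / (M + 1)) (divr_gt0 d0 M1).
  exists N => n m nN mN; rewrite -linearB.
  apply: le_trans (hM _ _ (AB (tA n) (tA m)) (HmB (tH n) (tH m))) _.
  have := hN n m nN mN; rewrite ler_pdivlMr //.
  have [_ _ _ e1 _] := ht n; have [_ _ _ e2 _] := ht m; rewrite -e1 -e2.
  have -> : Pm (t n).2.2 - mu *: (t n).2.1 - (Pm (t m).2.2 - mu *: (t m).2.1) =
      Pm ((t n).2.2 - (t m).2.2) - mu *: ((t n).2.1 - (t m).2.1).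
    by rewrite (linearB Pm); vring.
  by apply: le_trans; rewrite mulrC ler_wpM2l ?nr_ge0 // lerDl.
exists (Pp y - kap); split.
  apply/closure_prodP => d d0.
  have [N1 hN1] := lPpx d d0; have [N2 hN2] := (seq_limB lPpy lkap) d d0.
  pose n := maxn N1 N2; exists (Pp (t n).1.1, Pp (t n).1.2 - Pp (t n).2.2).
  split; first by have [_ _ _ _ [h _]] := ht n.
    by rewrite /= nrBC; apply: hN1; exact: leq_maxl.
  by rewrite /= nrBC; apply: hN2; exact: leq_maxr.
rewrite subKr; apply: ler_lincomb_approx => //; first exact: ltW.
move=> d d0.
have [N1 hN1] := lPpx _ d0; have [N2 hN2] := lkap _ d0.
have [N3 hN3] := (seq_limB lPmy (seq_limZ mu' lPmx)) _ d0.
pose n := maxn N1 (maxn N2 N3).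
have {}hN1 := hN1 n (leq_maxl _ _).
have {}hN2 := hN2 n ltac:(by rewrite /n !leq_max leqnn orbT).
have {}hN3 := hN3 n ltac:(by rewrite /n !leq_max leqnn !orbT).
have [_ _ _ _ [_ hk]] := ht n.
have tri u v : nr (u - v) <= d -> nr u <= nr v + d.
  move=> h; rewrite -{1}[u](subrK v) addrC.
  by apply: le_trans (nrD _ _) _; rewrite lerD2l.
exists (nr (Pp (t n).1.1)), (nr (Pp (t n).2.2)),
  (nr (Pm (t n).1.2 - mu' *: Pm (t n).1.1)); split => //; try exact: tri.
by apply: tri; rewrite nrBC.
Qed.

End Blocks.

(** * The estimate on the invariant subspace and the conclusion *)

Section Restriction.
Context {R : realType} {H : completeNormedModType R[i]}.

Lemma op_shiftP (T : set (H * H)) (c : R[i]) x z :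
  op_shift T c (x, z) <-> exists2 y, T (x, y) & z = y - c *: x.
Proof.
split=> [[[x' y] h [<- <-]]|[y h ->]]; first by exists y.
by exists (x, y).
Qed.

Lemma op_scaleP (T : set (H * H)) (c : R[i]) x z :
  op_scale c T (x, z) <-> exists2 y, T (x, y) & z = c *: y.
Proof.
split=> [[[x' y] h [<- <-]]|[y h ->]]; first by exists y.
by exists (x, y).
Qed.

Lemma cm_i : cm ('i : R[i]) = 1.
Proof. by rewrite /cm normc_def /= expr0n /= add0r expr1n sqrtr1. Qed.

(* For bounded l: resolvents are locally bounded, and the l with Im l <= - e
   and |l| <= r form a compact set. *)
Lemma resolvent_bound (L : set H) (T : set (H * H)) (r C e : R) :
  spectrum L T `<=` [set l | 0 <= ImC l] -> 0 < e ->
  (forall l x y, ImC l < 0 -> r <= cm l -> T (x, y) ->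
     cm l * nr x <= C * nr (y - l *: x)) ->
  exists2 M : R, 0 <= M & forall l x y, ImC l <= - e -> T (x, y) ->
    cm l * nr x <= M * nr (y - l *: x).
Proof.
move=> hs e0 far.
pose P (M : R) (l : R[i]) := forall x y, T (x, y) -> nr x <= M * nr (y - l *: x).
have Pmono M M' l : M <= M' -> P M l -> P M' l.
  move=> MM h x y hxy; apply: le_trans (h _ _ hxy) _.
  by rewrite ler_wpM2r // nr_ge0.
have Ploc l : ImC l < 0 -> exists M (d : R), 0 < d /\ forall l', cm (l - l') <= d -> P M l'.
  move=> l0; have [_ _ [M hM]] : resolvent_set L T l.
    by apply: contrapT => /hs /=; rewrite leNgt l0.
  have h1 x y : T (x, y) -> nr x <= `|M| * nr (y - l *: x).
    move=> hxy; have := hM (y - l *: x) x.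
    have hin : op_inv (op_shift T l) (y - l *: x, x).
      by exists (x, y - l *: x) => //; apply/op_shiftP; exists y.
    move=> /(_ hin); rewrite !nrE -rmorphM lecR => h; apply: le_trans h _.
    by rewrite ler_wpM2r ?nr_ge0 // ler_norm.
  have M0 := normr_ge0 M.
  (* Neumann perturbation: within this distance of l the perturbing term, multiplied by |M|, is at
     most |x|/2, so the constant doubles. *)
  exists (2 * `|M|), (2 * (`|M| + 1))^-1; split; first by rewrite invr_gt0; lra.
  move=> l' hl x y hxy; have := h1 x y hxy.
  have -> : y - l *: x = (y - l' *: x) - (l - l') *: x by vring.
  have := nrB (y - l' *: x) ((l - l') *: x); rewrite nrZ => h2 h3.
  rewrite -[X in _ <= X]mul1r ler_pdivlMr in hl; last by lra.
  have x0 := nr_ge0 x; have d0 := cm_ge0 (l - l').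
  move: (nr _) (nr (y - l' *: x)) (nr x) (cm _) h2 h3 hl x0 d0 => a b c d h2 h3 hl c0 d0.
  have h4 : `|M| * a <= `|M| * (b + d * c) by rewrite ler_wpM2l.
  have h5 : d * `|M| * c <= 2^-1 * c by rewrite ler_wpM2r //; lra.
  by lra.
have [M hM] := rectangle_bound r Pmono Ploc e0.
(* The first summand covers |l| < r, the second |l| >= r. *)
exists (`|r| * `|M| + `|C|); first by rewrite addr_ge0 ?mulr_ge0.
move=> l x y le hxy; have n0 := nr_ge0 (y - l *: x).
have [rl|lr] := lerP r (cm l).
  apply: le_trans (far l x y _ rl hxy) _; first by lra.
  rewrite ler_wpM2r //; apply: le_trans (ler_norm C) _.
  by rewrite lerDr mulr_ge0.
have := hM l le (ltW lr) x y hxy => h.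
apply: le_trans (_ : `|r| * (`|M| * nr (y - l *: x)) <= _).
  apply: ler_pM; rewrite ?cm_ge0 ?nr_ge0 //.
    by apply: le_trans (ltW lr) (ler_norm r).
  by apply: le_trans h _; rewrite ler_wpM2r // ler_norm.
by rewrite mulrA ler_wpM2r // lerDl.
Qed.

End Restriction.

Theorem theorem5 (R : realType) (H : completeNormedModType R[i])
    (dot : {dot H for @Num.conj R[i]}) (Pp Pm : {linear H -> H})
    (A : set (H * H)) (L : set H) (mu0 : R[i]) :
  let J := fun x => Pp x - Pm x in
  let Hp := range Pp in
  let Hm := range Pm in
  let Dp := op_dom A `&` Hp in
  let Dm := op_dom A `&` Hm in
  let A11 := op_block Pp A Hp in
  let A12 := op_block Pp A Hm in
  let A21 := op_block Pm A Hp in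
  let A22 := op_block Pm A Hm in
  let F mu := op_comp (op_inv (op_shift A22 mu)) A21 in
  let G mu := op_comp A12 (op_inv (op_shift A22 mu)) in
  let S mu := closure (op_sub A11 (op_comp A12 (F mu))) in
  let AL := op_restrict A L in
  separable_hilbert dot ->
  complementary_projections dot Pp Pm ->
  linear_operator [set: H] [set: H] A ->
  densely_defined [set: H] A ->
  closed A ->
  is_core A [set x + y | x in Dp & y in Dm] ->
  krein_max_dissipative dot J A ->
  max_dissipative dot Hm (op_scale (- 1) A22) ->
  0 < ImC mu0 ->
  op_bounded (F mu0) ->
  compact_operator Hm Hp (G mu0) ->
  max_nonnegative dot J L ->
  invariant_subspace A L ->
  spectrum L AL `<=` [set l | 0 <= ImC l] ->
  (exists mu : R[i], 0 < ImC mu /\ generates_H0 Hp (op_scale 'i (S mu))) ->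
  generates_H0 L (op_scale 'i AL).
Proof.
move=> J Hp Hm Dp Dm A11 A12 A21 A22 F G S AL [dot_norm _] hP A_lin _ _.
move=> [_ A_core] _ A22_max mu0_gt0 F_bd G_cpt [[hL Lnn] _] [Ldense Linv] Lspec.
move=> [mu [mup Sgen]] e e0.
have Hp_sub : linear_subspace Hp.
  by have [] := range_closed_subspace dot_norm hP.
(* The shift by 1 produces the additive term |p| in [Sest], which is absorbed for large |l|. *)
have [C1 C10 hC1] := generator_est Hp_sub (Sgen 1 ltr01).
have Sest l p s : ImC l < 0 -> S mu (p, s) ->
    cm l * nr p <= C1 * (nr (s - l *: p) + nr p).
  move=> l0 hps.
  have z0 : 0 < ReC ('i * l) by case: l l0 => a b /= b0; lra.
  have hT : op_shift (op_scale 'i (S mu)) 1%:C (p, 'i *: s - 1%:C *: p).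
    by apply/op_shiftP; exists ('i *: s) => //; apply/op_scaleP; exists s.
  have := hC1 _ z0 _ _ hT; rewrite cmM cm_i mul1r => h.
  apply: le_trans h _; rewrite ler_wpM2l //.
  have -> : ('i * l) *: p - ('i *: s - 1%:C *: p) = p - 'i *: (s - l *: p).
    by rewrite -[1%:C]/(1 : R[i]); vring.
  by apply: le_trans (nrB _ _) _; rewrite nrZ cm_i mul1r addrC.
(* C1 gam <= 1/2 lets the left-hand side absorb the term C1 gam |l| |P+ x| that arises below. *)
pose gam := (2 * (C1 + 1))^-1.
have gam0 : 0 < gam by rewrite invr_gt0; lra.
have gamC : C1 * gam <= 2^-1.
  by rewrite /gam ler_pdivrMr; lra.
clearbody gam.
have [E [mu' [E0 hE]]] := schur_est dot_norm hP A_lin A22_max mu0_gt0 F_bd G_cpt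
  A_core mup gam0.
have [_ A0 Alin Afun] := A_lin.
have [[L0 LL] Lclosed] := hL.
have LB x y : L x -> L y -> L (x - y).
  by move=> h1 h2; have := LL (-1) _ _ h2 h1; rewrite scaleN1r addrC.
have LZ c x : L x -> L (c *: x) by move=> h; have := LL c _ _ h L0; rewrite addr0.
have Lsqr x : L x -> nr (Pm x) ^+ 2 <= nr (Pp x) ^+ 2.
  move=> /Lnn; have [[Ppp hp] [Pmm hm] _] := hP.
  rewrite /J dotBl -{1}(Ppp x) -{1}(Pmm x) hp hm !(dotxx dot_norm).
  by rewrite -rmorphB ler0c subr_ge0.
have Lle x : L x -> nr (Pm x) <= nr (Pp x).
  by move=> /Lsqr; rewrite ler_pXn2r // nnegrE nr_ge0.
have Lle2 x : L x -> nr x <= 2 * nr (Pp x).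
  move=> /Lsqr h; rewrite -(ler_pXn2r (n := 2)) ?nnegrE ?mulr_ge0 ?nr_ge0 //.
  rewrite -(proj_sqr dot_norm hP x) exprMn; have := sqr_ge0 (nr (Pp x)); clear -h; lra.
have AL_lin : linear_operator L L AL.
  split.
  - by move=> x y [h1 h2]; split => //; exact: Linv h1 h2.
  - by [].
  - by move=> c x x' y y' [h1 h2] [h3 h4]; split; [exact: Alin | exact: LL].
  - by move=> x y y' [h1 _] [h2 _]; exact: Afun h1 h2.
have PpZ c v : Pp (c *: v) = c *: Pp v by exact: linearZ.
have PmZ c v : Pm (c *: v) = c *: Pm v by exact: linearZ.
pose C2 := C1 * (1 + E + gam * cm mu').
have C20 : 0 <= C2.
  by rewrite mulr_ge0 // !addr_ge0 // mulr_ge0 ?cm_ge0 // ltW.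
(* With p = |P+ x| and a = |A x - l x| the pieces combine to |l| p <= C1 (1 + gam) a + C2 p + |l| p
   / 2. For |l| >= 4 C2 this gives |l| p <= 4 C1 (1 + gam) a, and |x| <= 2 p doubles the
   constant. *)
have far l x y : ImC l < 0 -> 4 * C2 + 1 <= cm l -> AL (x, y) ->
    cm l * nr x <= (8 * C1 * (1 + gam)) * nr (y - l *: x).
  move=> l0 hl [hxy Lx]; have Ly : L y := Linv _ _ hxy Lx.
  pose r := y - l *: x; have Lr : L r by apply: LB => //; exact: LZ.
  have [s [hs hsE]] := hE x y hxy.
  have h1 := Sest l _ _ l0 hs.
  have h2 : nr (s - l *: Pp x) <= nr (Pp r) + nr (Pp y - s).
    have -> : s - l *: Pp x = Pp r - (Pp y - s).
      by rewrite /r (linearB Pp) PpZ; vring.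
    exact: nrB.
  (* Nonnegativity of [L] enters here: |P- x| <= |P+ x| leaves only |P+ x| next to the residual. *)
  have h3 : nr (Pm y - mu' *: Pm x) <= nr r + (cm l + cm mu') * nr (Pp x).
    have -> : Pm y - mu' *: Pm x = Pm r + (l - mu') *: Pm x.
      by rewrite /r (linearB Pm) PmZ; vring.
    apply: le_trans (nrD _ _) (lerD (nr_proj dot_norm (projC hP) r) _).
    by rewrite nrZ ler_pM ?cm_ge0 ?nr_ge0 ?cmB ?Lle.
  have h4 := nr_proj dot_norm hP r; have h5 := Lle2 x Lx.
  have p0 := nr_ge0 (Pp x); have r0 := nr_ge0 r; have l1 := cm_ge0 l.
  rewrite -/r; move: (nr (s - _)) (nr (Pp y - s)) (nr (Pm y - _)) h1 h2 h3 hsE.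
  move=> t1 t2 t3 h1 h2 h3 hsE.
  move: (nr r) (nr (Pp r)) (nr (Pp x)) (nr x) (cm l) h1 h2 h3 hsE h4 h5 p0 r0 hl l1.
  move=> a ap p x0 cl h1 h2 h3 hsE h4 h5 p0 a0 hl l1.
  have h6 : gam * t3 <= gam * (a + (cl + cm mu') * p) by rewrite ler_wpM2l // ltW.
  have h7 : t1 + p <= a * (1 + gam) + (1 + E + gam * cm mu') * p + gam * (cl * p).
    by clear -h1 h2 h3 hsE h4 h6; lra.
  have h8 : C1 * (t1 + p) <= C1 * (a * (1 + gam) + (1 + E + gam * cm mu') * p + gam * (cl * p)).
    by rewrite ler_wpM2l.
  have clp : 0 <= cl * p by exact: mulr_ge0.
  have h9 : C1 * gam * (cl * p) <= 2^-1 * (cl * p) by rewrite ler_wpM2r.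
  have h10 : 4 * C2 * p <= cl * p by rewrite ler_wpM2r //; clear -hl; lra.
  have h11 : cl * p <= 4 * C1 * (1 + gam) * a by rewrite /C2 in h10; clear -h1 h8 h9 h10; lra.
  have h12 : cl * x0 <= cl * (2 * p) by rewrite ler_wpM2l.
  clear -h11 h12; lra.
have [M M0 hM] := resolvent_bound Lspec e0 far.
pose T := op_shift (op_scale 'i AL) e%:C.
have TP x z : T (x, z) <-> exists2 y, AL (x, y) & z = 'i *: y - e%:C *: x.
  split=> [/op_shiftP[_ /op_scaleP[y h ->] ->]|[y h ->]]; first by exists y.
  by apply/op_shiftP; exists ('i *: y) => //; apply/op_scaleP; exists y.
have ii : 'i * 'i = -1 :> R[i] by rewrite -expr2 sqr_i.
(* With l = - i (z + e) the resolvent equation of i A - e at z becomes that of A at l, and Re z > 0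
   yields Im l <= - e. *)
have shift (z : R[i]) x y :
    z *: x - ('i *: y - e%:C *: x) = (- 'i) *: (y - (- 'i * (z + e%:C)) *: x).
  rewrite -[z in LHS]mul1r -[e%:C in LHS]mul1r -[1](opprK 1) -ii; vring.
have Iml (z : R[i]) : 0 < ReC z -> ImC (- 'i * (z + e%:C)) <= - e.
  by clear -e0; case: z => a b /= a0; lra.
apply: (sectorial_generates (M := M)) => //.
- split.
  + move=> x z /TP[y hxy ->]; have [TL _ _ _] := AL_lin; have [Lx Ly] := TL _ _ hxy.
    by split => //; apply: LB; exact: LZ.
  + by apply/TP; exists 0 => //; rewrite !scaler0 subr0.
  + move=> c x x' z z' /TP[y h ->] /TP[y' h' ->]; apply/TP; exists (c *: y + y').
      by have [_ _ h0 _] := AL_lin; exact: h0.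
    by vring.
  + move=> x z z' /TP[y h ->] /TP[y' h' ->]; have [_ _ _ h0] := AL_lin.
    by rewrite (h0 _ _ _ h h').
- move=> x /Ldense; apply: closureS => u [[[a b] /= h au] Lu].
  rewrite au in h; pose w : H := 'i *: b - e%:C *: u.
  by exists (u, w) => //; apply/TP; exists b.
- move=> z z0 v Lv.
  have [_ hdom _] : resolvent_set L AL (- 'i * (z + e%:C)).
    apply: contrapT => /Lspec h; have := le_trans h (Iml z z0).
    by rewrite oppr_ge0 leNgt e0.
  have : op_dom (op_inv (op_shift AL (- 'i * (z + e%:C)))) ('i *: v).
    by rewrite hdom; exact: LZ.
  move=> [[w x] /= [[x' w'] /= /op_shiftP[y hxy ew] [hw hx]] e1].
  rewrite hx in hxy ew; exists x, ('i *: y - e%:C *: x); split.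
    by apply/TP; exists y.
  by rewrite shift -ew hw e1 scalerA mulNr ii opprK scale1r.
- move=> z z0 x w /TP[y hxy ->]; rewrite shift nrZ cmN cm_i mul1r.
  (* |z| <= |z + e| = |l|, since Re z and e are positive. *)
  apply: le_trans (hM _ _ _ (Iml z z0) hxy).
  rewrite ler_wpM2r ?nr_ge0 // cmM cmN cm_i mul1r.
  rewrite -(ler_pXn2r (n := 2)) ?nnegrE ?cm_ge0 // !sqr_cm.
  by clear -e0 z0; case: z z0 => a b /= a0; rewrite addr0 lerD2r; nra.
Qed.
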